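(* For every $n\ge0$ and given $Q_h^n\in\mathcal T_h^G$ (obtained from the initial datum $Q_h^0\in\mathcal T_h^G$ by the previous steps of the scheme), there exists $Q_h^{n+1}\in\mathcal T_h^G$ satisfying $$\left\langle \frac{Q_h^{n+1}-Q_h^n}{\Delta t},\varphi\right\rangle = -M\,H^{n+\frac12}(\varphi)\qquad\text{for all }\varphi\in\mathcal T_h^0,$$ where $H^{n+\frac12}$ is the functional (depending on $Q_h^n$ and $Q_h^{n+1}$) defined in the context. Moreover, there is a constant $C>0$, independent of $h$ and $\Delta t$, such that if $\Delta t\le C h^{d+2}$, where $d$ is the spatial dimension ($d=3$ here), then the solution $Q_h^{n+1}$ is unique.
   Context: Setting and parameters. $\Omega\subset\mathbb R^3$ is a bounded domain with a family of quasi-uniform triangulations $\Omega_h$, where $h$ is the maximum element diameter of $\Omega_h$. $\mathcal S=\{Q\in\mathbb R^{3\times3}: Q^\top=Q,\ \mathrm{tr}\,Q=0\}$. Constants: $L_1,L_2,L_3,L_4>0$, $L_5\ge 0$, $M>0$, $\Delta t>0$, $a,b\in\mathbb R$, $c>0$, with $a<\frac{b^2}{27c}$, and $s_0=\frac{b+\sqrt{b^2-24ac}}{4c}$. The boundary datum is $G:\partial\Omega\to\mathcal S$. Notation. $A:B=\sum_{i,j}A_{ij}B_{ij}$, $|A|=\sqrt{A:A}$; $A_{ij,k}=\partial A_{ij}/\partial x_k$, $\nabla A:\nabla B=\sum_{i,j,k}A_{ij,k}B_{ij,k}$, $|\nabla A|=\sqrt{\nabla A:\nabla A}$. For a matrix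 field $A$ with rows $A_1,A_2,A_3$, $\mathrm{div}\,A$ is the vector whose $j$-th entry is $\mathrm{div}\,A_j$, and $\mathrm{curl}\,A$ is the matrix whose $j$-th column is $\mathrm{curl}\,A_j$. $\langle\cdot,\cdot\rangle$ denotes the $L^2(\Omega)$ inner product of scalar, vector, matrix fields or gradients of matrix fields (using the pointwise products above). Products such as $S\,\mathrm{div}\,Q$, $S\,\mathrm{curl}\,Q$, $\varphi\,\mathrm{div}\,Q$ are matrix-vector or matrix-matrix products. Finite element sets. $G_h:\Omega\to\mathcal S$ is the continuous function, affine on each element, equal to $0$ at every interior node and to $G(P)$ at every boundary node $P$. $\mathcal T_h^0$ is the space of continuous $\varphi:\Omega\to\mathcal S$ that are affine on each element and vanish on $\partial\Omega$; $\mathcal T_h^G=\{\varphi+G_h:\varphi\in\mathcal T_h^0\}$. Scheme. $S_1(Q)=\frac{s_0}{3}I+Q$, $S_2(Q)=\frac{2s_0}{3}I-Q$, $S_{i,h}^n=S_i(Q_h^n)$. For any time-indexed quantity, $(\cdot)^{n+\frac12}=\frac12\big((\cdot)^{n+1}+(\cdot)^n\big)$; this averaging is applied to the whole expression in parentheses, e.g. $(S_{1,h}\,\mathrm{div}\,Q_h)^{n+\frac12}=\frac12(S_{1,h}^{n+1}\mathrm{div}\,Q_h^{n+1}+S_{1,h}^n\,\mathrm{div}\,Q_h^n)$. Then $H^{n+\frac12}=\sum_{i=1}^6H_i^{n+\frac12}$ with - $H_1^{n+\frac12}(\varphi)=L_1\langle(S_{1,h}\,\mathrm{div}\,Q_h)^{n+\frac12},\,S_{1,h}^{n+\frac12}\,\mathrm{div}\,\varphi+\varphi\,\mathrm{div}\,Q_h^{n+\frac12}\rangle$,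 - $H_2^{n+\frac12}(\varphi)=L_2\langle(S_{1,h}\,\mathrm{curl}\,Q_h)^{n+\frac12},\,S_{1,h}^{n+\frac12}\,\mathrm{curl}\,\varphi+\varphi\,\mathrm{curl}\,Q_h^{n+\frac12}\rangle$, - $H_3^{n+\frac12}(\varphi)=L_3\langle(S_{2,h}\,\mathrm{div}\,Q_h)^{n+\frac12},\,S_{2,h}^{n+\frac12}\,\mathrm{div}\,\varphi-\varphi\,\mathrm{div}\,Q_h^{n+\frac12}\rangle$, - $H_4^{n+\frac12}(\varphi)=L_4\langle(S_{2,h}\,\mathrm{curl}\,Q_h)^{n+\frac12},\,S_{2,h}^{n+\frac12}\,\mathrm{curl}\,\varphi-\varphi\,\mathrm{curl}\,Q_h^{n+\frac12}\rangle$, - $H_5^{n+\frac12}(\varphi)=L_5\big(\langle(|\nabla Q_h|^2)^{n+\frac12}Q_h^{n+\frac12},\varphi\rangle+\langle(|Q_h|^2)^{n+\frac12}\nabla Q_h^{n+\frac12},\nabla\varphi\rangle\big)$, - $H_6^{n+\frac12}(\varphi)=\big\langle 2aQ_h^{n+\frac12}-\tfrac{2b}3\big(2(Q_h^2)^{n+\frac12}+Q_h^{n+1}Q_h^n\big)+2c\,(\mathrm{tr}(Q_h^2))^{n+\frac12}Q_h^{n+\frac12},\,\varphi\big\rangle$. *)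

(* Defs.v *)
From HB Require Import structures.
From mathcomp Require Import all_boot all_order all_algebra.
From mathcomp Require Import all_classical all_reals all_analysis.

Set Implicit Arguments.
Unset Strict Implicit.
Unset Printing Implicit Defensive.

Import Order.TTheory GRing.Theory Num.Theory.
Import numFieldNormedType.Exports.

Local Open Scope classical_set_scope.
Local Open Scope ring_scope.

Section Euclidean.
Variable R : realType.

Definition leb3 :=
  ((@lebesgue_measure R \x @lebesgue_measure R) \x @lebesgue_measure R)%E.

Definition vec3 (p : R * R * R) : 'rV[R]_3 :=
  \row_(i < 3) [:: p.1.1; p.1.2; p.2]`_i.

(* The library has Lebesgue measure on products of R only, so the integral over
   a subset of 'rV_3 is pulled back along vec3. *)
Definition integral3 (D : set 'rV[R]_3) (f : 'rV[R]_3 -> R) : R :=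
  Rintegral leb3 (vec3 @^-1` D) (fun p => f (vec3 p)).

(* The library norm on 'rV_3 is the sup norm. *)
Definition enorm (x : 'rV[R]_3) : R := Num.sqrt (\sum_i x 0 i ^+ 2).

Definition diam (A : set 'rV[R]_3) : R :=
  sup [set r | exists x y, [/\ A x, A y & r = enorm (x - y)]].

Definition boundary (A : set 'rV[R]_3) : set 'rV[R]_3 :=
  closure A `\` interior A.

Definition domain (A : set 'rV[R]_3) : Prop :=
  [/\ open A, connected A & A !=set0].

End Euclidean.

Section Triangulation.
Variable R : realType.

Definition vhull (v : 'I_4 -> 'rV[R]_3) (F : {set 'I_4}) : set 'rV[R]_3 :=
  [set x | exists w : 'I_4 -> R,
    [/\ forall i, 0 <= w i, forall i, i \notin F -> w i = 0,
        \sum_i w i = 1 & x = \sum_i w i *: v i]].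

(* Interiors of elements lie in Omega (elem_in), so by elem_cover the boundary of
   Omega is contained in the union of the faces and is negligible.
   vertex t lists the four vertices of the closed element number t; two elements
   meet in a common, possibly empty, vertex, edge or face (F and F' are then
   empty or have 1, 2 or 3 elements unless the elements are the same). *)
Record triangulation (Omega : set 'rV[R]_3) := Triangulation {
  nelem : nat;
  vertex : 'I_nelem -> 'I_4 -> 'rV[R]_3;
  elem := fun t : 'I_nelem => vhull (vertex t) [set: 'I_4];
  elem_nondegenerate : forall t, interior (elem t) !=set0;
  elem_in : forall t, interior (elem t) `<=` Omega;
  elem_cover : closure Omega = \bigcup_t elem t;
  elem_disjoint : forall t t', t != t' ->
    interior (elem t) `&` interior (elem t') = set0;
  elem_conforming : forall t t', exists F F' : {set 'I_4},
    elem t `&` elem t' = vhull (vertex t) F /\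
    elem t `&` elem t' = vhull (vertex t') F' }.

Definition meshsize (Omega : set 'rV[R]_3) (Th : triangulation Omega) : R :=
  \big[Num.max/0]_(t < nelem Th) diam (elem t).

Definition quasi_uniform (Omega : set 'rV[R]_3) (I : Type)
    (mesh : I -> triangulation Omega) : Prop :=
  exists2 sigma : R, 0 < sigma & forall i (t : 'I_(nelem (mesh i))),
    exists x r, sigma * meshsize (mesh i) <= r /\
      [set y | enorm (y - x) <= r] `<=` elem t.

End Triangulation.

Section Fields.
Variable R : realType.

Definition tensor_field := 'rV[R]_3 -> 'M[R]_3.

Definition symtl : set 'M[R]_3 := [set A | A^T = A /\ \tr A = 0].

Definition frob m n (A B : 'M[R]_(m, n)) : R := \sum_i \sum_j A i j * B i j.

Definition pd (A : tensor_field) (k i j : 'I_3) (x : 'rV[R]_3) : R :=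
  'D_(delta_mx 0 k) (fun y => A y i j) x.

Definition grad (A : tensor_field) (x : 'rV[R]_3) (k : 'I_3) : 'M[R]_3 :=
  \matrix_(i, j) pd A k i j x.

Definition graddot (F G : 'I_3 -> 'M[R]_3) : R := \sum_k frob (F k) (G k).

Definition div (A : tensor_field) (x : 'rV[R]_3) : 'cV[R]_3 :=
  \col_j \sum_k pd A k j k x.

(* Column j is the curl of row j of A; ordS is i |-> i+1 mod 3, so that
   (curl v)_i = d_{i+1} v_{i+2} - d_{i+2} v_{i+1}. *)
Definition curl (A : tensor_field) (x : 'rV[R]_3) : 'M[R]_3 :=
  \matrix_(i, j) (pd A (ordS i) j (ordS (ordS i)) x
                  - pd A (ordS (ordS i)) j (ordS i) x).

End Fields.

(* Functions are total on 'rV_3, but all conditions only concern their values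
   on the closure of Omega. *)

Section FiniteElements.
Variables (R : realType) (Omega : set 'rV[R]_3) (Th : triangulation Omega).

Definition affine_on (T : set 'rV[R]_3) (f : tensor_field R) : Prop :=
  exists (A : 'M[R]_3) (B : 'I_3 -> 'M[R]_3),
    forall x, T x -> f x = A + \sum_k x 0 k *: B k.

Definition P1_field (f : tensor_field R) : Prop :=
  [/\ {within closure Omega, continuous f},
      forall t : 'I_(nelem Th), affine_on (elem t) f
    & forall x, closure Omega x -> symtl (f x)].

Definition is_Gh (G Gh : tensor_field R) : Prop :=
  P1_field Gh /\ forall (t : 'I_(nelem Th)) (i : 'I_4),
    (boundary Omega (vertex t i) -> Gh (vertex t i) = G (vertex t i)) /\
    (~ boundary Omega (vertex t i) -> Gh (vertex t i) = 0).

Definition Th0 : set (tensor_field R) :=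
  [set phi | P1_field phi /\ forall x, boundary Omega x -> phi x = 0].

Definition ThG (G : tensor_field R) : set (tensor_field R) :=
  [set Q | exists Gh phi, [/\ is_Gh G Gh, Th0 phi &
    forall x, closure Omega x -> Q x = phi x + Gh x]].

End FiniteElements.

Record params (R : realType) := Params {
  L1 : R; L2 : R; L3 : R; L4 : R; L5 : R; M : R; a : R; b : R; c : R }.

Section Scheme.
Variables (R : realType) (p : params R) (Omega : set 'rV[R]_3).

Local Notation "\int_ x f" := (integral3 Omega (fun x => f))
  (at level 36, x name, f at level 36, only parsing).

Definition s0 : R :=
  (b p + Num.sqrt (b p ^+ 2 - 24 * a p * c p)) / (4 * c p).

Definition S1 (A : 'M[R]_3) : 'M[R]_3 := (s0 / 3)%:M + A.
Definition S2 (A : 'M[R]_3) : 'M[R]_3 := (2 * s0 / 3)%:M - A.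

Definition mid (V : lmodType R) (u v : V) : V := 2^-1 *: (u + v).

Section Functional.
(* Q' and Q are the iterates number n+1 and n. *)
Variables Q' Q phi : tensor_field R.

Definition H1 : R := L1 p * \int_x
  (frob (mid (S1 (Q' x) *m div Q' x) (S1 (Q x) *m div Q x))
        (mid (S1 (Q' x)) (S1 (Q x)) *m div phi x
         + phi x *m mid (div Q' x) (div Q x))).

Definition H2 : R := L2 p * \int_x
  (frob (mid (S1 (Q' x) *m curl Q' x) (S1 (Q x) *m curl Q x))
        (mid (S1 (Q' x)) (S1 (Q x)) *m curl phi x
         + phi x *m mid (curl Q' x) (curl Q x))).

Definition H3 : R := L3 p * \int_x
  (frob (mid (S2 (Q' x) *m div Q' x) (S2 (Q x) *m div Q x))
        (mid (S2 (Q' x)) (S2 (Q x)) *m div phi x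
         - phi x *m mid (div Q' x) (div Q x))).

Definition H4 : R := L4 p * \int_x
  (frob (mid (S2 (Q' x) *m curl Q' x) (S2 (Q x) *m curl Q x))
        (mid (S2 (Q' x)) (S2 (Q x)) *m curl phi x
         - phi x *m mid (curl Q' x) (curl Q x))).

Definition H5 : R := L5 p *
  (\int_x (frob ((mid (graddot (grad Q' x) (grad Q' x))
                      (graddot (grad Q x) (grad Q x)) : R)
                 *: mid (Q' x) (Q x)) (phi x))
   + \int_x (graddot (fun k => (mid (frob (Q' x) (Q' x))
                                    (frob (Q x) (Q x)) : R)
                               *: mid (grad Q' x k) (grad Q x k))
                     (grad phi x))).

Definition H6 : R := \int_x
  (frob ((2 * a p) *: mid (Q' x) (Q x)
         - (2 * b p / 3) *: (2 *: mid (Q' x *m Q' x) (Q x *m Q x)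
                             + Q' x *m Q x)
         + (2 * c p * (mid (\tr (Q' x *m Q' x)) (\tr (Q x *m Q x)) : R))
           *: mid (Q' x) (Q x))
        (phi x)).

Definition H : R := H1 + H2 + H3 + H4 + H5 + H6.

End Functional.

(* The energy of which H is the discrete gradient:
   H Q' Q (Q' - Q) = energy Q' - energy Q for Q, Q' in the same ThG. *)
Definition energy (Q : tensor_field R) : R := \int_x
  (L1 p / 2 * frob (S1 (Q x) *m div Q x) (S1 (Q x) *m div Q x)
   + L2 p / 2 * frob (S1 (Q x) *m curl Q x) (S1 (Q x) *m curl Q x)
   + L3 p / 2 * frob (S2 (Q x) *m div Q x) (S2 (Q x) *m div Q x)
   + L4 p / 2 * frob (S2 (Q x) *m curl Q x) (S2 (Q x) *m curl Q x)
   + L5 p / 2 * frob (Q x) (Q x) * graddot (grad Q x) (grad Q x)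
   + a p * \tr (Q x *m Q x) - 2 * b p / 3 * \tr (Q x *m Q x *m Q x)
   + c p / 2 * \tr (Q x *m Q x) ^+ 2).

Variables (Th : triangulation Omega) (G : tensor_field R) (dt : R).

Definition scheme_step (Q Q' : tensor_field R) : Prop :=
  forall phi, Th0 Th phi ->
    \int_x (frob (dt^-1 *: (Q' x - Q x)) (phi x)) = - M p * H Q' Q phi.

Definition scheme_iterates (n : nat) (Q : nat -> tensor_field R) : Prop :=
  ThG Th G (Q 0%N) /\
  forall k, (k < n)%N -> ThG Th G (Q k.+1) /\ scheme_step (Q k) (Q k.+1).

End Scheme.

(* Main.v *)
Require Import Defs.
From HB Require Import structures.
From mathcomp Require Import all_boot all_order all_algebra zify.

Set Implicit Arguments.
Unset Strict Implicit.
Unset Printing Implicit Defensive.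

(** Both halves rest on one algebraic fact: H is a discrete gradient of the
    energy.  Each term of the energy is a polynomial in Q and its gradient, and
    the averages at the half step are placed so that the product rule
    mid A' A * (B' - B) + (A' - A) * mid B' B = A' * B' - A * B turns
    H Q' Q (Q' - Q) into energy Q' - energy Q ([h_dens_diff], [H_diff]).  Since
    c > 0, the quartic bulk term controls |Q|^2 up to a constant
    ([bulk_coercive]), so the energy is bounded below by the L2 norm
    ([energy_lower]).

    Existence.  In a basis of the space of test fields ([Th0_basis]) one step of
    the scheme is a finite system F(u) = 0, with F continuous and
    F(u).u = |phi_u|^2 / dt + M (energy (Q + phi_u) - energy Q).  The first
    term is coercive in finite dimension and the second is bounded below, so F
    points outwards on a large sphere and has a zero inside
    ([residual_outward], [zero_of_outward], [step_exists]).  The fixed point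
    principle used here, equivalent to the Brouwer theorem, is derived from the
    combinatorial lemma of Scarf on families of linear orders ([scarf]), applied
    to the points of a fine grid of a simplex ([grid_colouring]): it yields
    grid points close to each other, one for each barycentric coordinate that is
    not small, at which that coordinate does not decrease under the map; a
    compactness argument takes the mesh of the grid to zero ([exists_bary_le]).

    Uniqueness.  Let d be the difference of two solutions of the same step.
    Testing with d gives |d|^2 / dt = - M (H Q1 Q d - H Q2 Q d).  The density of
    H is a polynomial in the fields and their gradients with at most two
    gradients in each monomial, so, a gradient being worth h^-1 times a value,
    its variation is bounded by C h^-2 q^2 |d| |d|, where q - 1 is the sum of
    the sizes of the three fields ([h_dens_lipschitz]).  The energy does not
    increase along the scheme, so q is bounded in L2 by the initial energy
    ([energy_decay], [J_weight_le]), while the supremum of |d|^2 is at most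
    C h^-3 times its L2 norm squared ([field_inverse]).  Hence
    |d|^2 / dt <= M C h^-5 |d|^2, and d = 0 as soon as dt is a small multiple
    of h^5 ([step_unique]).

    Gradients of piecewise affine fields make sense only inside the elements.
    The faces are contained in finitely many planes, which are null sets, so all
    integrals over Omega may be computed on the interiors of the elements
    ([integral_eq_off_negligible], [cells_full], [J_cells]).  The inverse
    inequality uses no reference element: an affine function has a constant sign
    and is large on a box of size comparable to h contained in the element,
    chosen along its gradient ([inverse_affine]). *)

(** * Scarf's lemma on families of linear orders *)

Section Scarf.
(** r i x is the rank of x in the linear order number i.  The slack point s i is
    the least point of the order i and lies above all ordinary points in the
    other orders: it plays the part of a vertex at infinity and has colour i. *)
Variables (I X : finType) (r : I -> X -> nat) (s : I -> X) (c : X -> I).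
Hypothesis r_inj : forall i, injective (r i).
Hypothesis s_min : forall i x, x != s i -> (r i (s i) < r i x)%N.
Hypothesis s_big : forall i j x, j != i -> x \notin codom s ->
  (r i x < r i (s j))%N.
Hypothesis c_s : forall i, c (s i) = i.

(** No point exceeds all the minima of A: the analogue of a face of a
    triangulation, with the dominant sets of cardinal #|I| as maximal
    simplices. *)
Definition dominant (A : {set X}) :=
  [forall y, exists i, [forall x in A, r i y <= r i x]].

Lemma dominantP (A : {set X}) :
  reflect (forall y, exists i, forall x, x \in A -> r i y <= r i x)
          (dominant A).
Proof.
apply: (iffP forallP) => [h y|h y].
  by have /existsP[i /forall_inP hi] := h y; exists i.
by apply/existsP; have [i hi] := h y; exists i; apply/forall_inP.
Qed.

Lemma dominantS (A B : {set X}) : A \subset B -> dominant B -> dominant A.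
Proof.
move=> /subsetP sAB /dominantP h; apply/dominantP => y.
by have [i hi] := h y; exists i => x /sAB; apply: hi.
Qed.

Lemma min_rankP (A : {set X}) i : A != set0 ->
  exists2 x, x \in A & forall y, y \in A -> r i x <= r i y.
Proof.
case/set0Pn => x0 x0A; case: (arg_minnP (r i) x0A) => x xA hx.
by exists x.
Qed.

Lemma max_rankP (A : {set X}) i : A != set0 ->
  exists2 x, x \in A & forall y, y \in A -> r i y <= r i x.
Proof.
case/set0Pn => x0 x0A; case: (arg_maxnP (r i) x0A) => x xA hx.
by exists x.
Qed.

(** Doorways are the facets that carry every colour but i0; a maximal simplex
    is a room, and its doors are the points whose removal leaves a doorway.
    Rooms and doorways are counted as in the proof of Sperner's lemma. *)
Definition doorway (i0 : I) (A : {set X}) :=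
  (#|A| == #|I|.-1) && (c @: A == [set~ i0]).

Definition completions (A : {set X}) := [set x | (x \notin A) && dominant (x |: A)].

Definition doors (i0 : I) (A : {set X}) :=
  [set x in A | c @: (A :\ x) == [set~ i0]].

Lemma card_setC1 (i0 : I) : #|[set~ i0]| = #|I|.-1.
Proof. by rewrite cardsC1. Qed.

(** If x is a door, then the points other than x have distinct colours, and the
    colour of x repeats that of exactly one x' among them, as the room misses
    the colour i0. The doors are then x and x'. *)
Lemma odd_doors i0 (A : {set X}) :
  #|A| = #|I| -> c @: A != [set: I] -> ~~ odd #|doors i0 A|.
Proof.
move=> cA ncol.
have [->|/set0Pn[x]] := eqVneq (doors i0 A) set0; first by rewrite cards0.
rewrite inE => /andP[xA /eqP cx].
have cAx : #|A :\ x| = #|I|.-1.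
  by rewrite -cA (cardsD1 x A) xA.
have inj : {in A :\ x &, injective c}.
  by apply/imset_injP; rewrite cx cAx card_setC1.
have cxi0 : c x != i0.
  apply: contra ncol => /eqP cxi.
  by rewrite -(setD1K xA) imsetU1 cxi cx setUCr.
have : c x \in c @: (A :\ x) by rewrite cx !inE.
case/imsetP => x' x'A cxx'.
have x'x : x' != x by move: x'A; rewrite !inE => /andP[].
have x'A' : x' \in A by move: x'A; rewrite !inE => /andP[].
suff -> : doors i0 A = [set x; x'] by rewrite cards2 eq_sym x'x.
apply/setP => z; rewrite !inE; apply/idP/idP.
  case/andP => zA /eqP cz; apply/negbNE; apply/negP; rewrite negb_or => /andP[zx zx'].
  have : c z \in c @: (A :\ z).
    rewrite cz -cx; apply: imset_f; by rewrite !inE zx zA.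
  case/imsetP => w; rewrite !inE => /andP[wz wA] czw.
  have [wx|wx] := eqVneq w x.
    move: czw; rewrite wx cxx' => /inj; rewrite !inE zx zA x'x x'A' => /(_ isT isT) e.
    by rewrite e eqxx in zx'.
  move: czw => /inj; rewrite !inE zx zA wx wA => /(_ isT isT) e.
  by rewrite e eqxx in wz.
case/orP => /eqP ->; first by rewrite xA cx eqxx.
rewrite x'A' /=; apply/eqP; rewrite -cx; apply/setP => i.
apply/imsetP/imsetP => -[w]; rewrite !inE => /andP[w1 wA] ->.
  have [->|wx] := eqVneq w x; first by exists x' => //.
  by exists w => //; rewrite !inE wx wA.
have [->|wx] := eqVneq w x'; first by exists x => //; rewrite !inE eq_sym x'x.
by exists w => //; rewrite !inE wx wA.
Qed.

(** The doorway on the outer boundary: the slack points of the colours other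
    than i0. *)
Definition slackset (i0 : I) : {set X} := s @: [set~ i0].

Section Door.
Variables (i0 : I) (A : {set X}).
Hypothesis cardI : (1 < #|I|)%N.
Hypothesis cA : #|A| = #|I|.-1.

Let A_neq0 : A != set0.
Proof. by rewrite -cards_eq0 cA; case: #|I| cardI => [|[|]]. Qed.

Lemma minfun : exists mu : I -> X, forall i, mu i \in A /\
  forall y, y \in A -> r i (mu i) <= r i y.
Proof.
have h i : exists x, (x \in A) && [forall y in A, r i x <= r i y].
  have [x xA hx] := min_rankP i A_neq0.
  by exists x; rewrite xA; apply/forall_inP.
exists (fun i => xchoose (h i)) => i.
by have /andP[h1 /forall_inP h2] := xchooseP (h i).
Qed.

Section Mu.
Variable mu : I -> X.
Hypothesis muP : forall i, mu i \in A /\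
  forall y, y \in A -> r i (mu i) <= r i y.

(** mu j is the minimum of A in the order j, so adding a point of above i to A
    changes at most the minimum of the order i. *)
Definition above (i : I) := [set y | [forall j, (j != i) ==> (r j (mu j) < r j y)]].

Lemma aboveP i y : reflect (forall j, j != i -> r j (mu j) < r j y) (y \in above i).
Proof.
rewrite inE; apply: (iffP forallP) => h j; first by move=> ji; have := h j; rewrite ji.
by apply/implyP; apply: h.
Qed.

(** The dominance of x added to A, applied to the point x itself, singles out
    an order i in which x is the least. Dominance at a point of A cannot be
    witnessed by i, so each point of A is the minimum of another order. If x
    were below the minimum of some j other than i, then dominance at mu j would
    make it the minimum of a third order as well, which leaves #|I|.-2 minima
    for the #|I|.-1 points of A. Maximality is dominance at the points of above
    i. *)
Lemma completion_above x : x \in completions A ->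
  exists i, [/\ mu @: [set~ i] = A, x \in above i
   & forall y, y \in above i -> r i y <= r i x].
Proof.
rewrite inE => /andP[xA /dominantP dom].
have [i hi] := dom x.
have sur : mu @: [set~ i] = A.
  apply/eqP; rewrite eqEsubset; apply/andP; split.
    by apply/subsetP => z /imsetP[j _ ->]; case: (muP j).
  apply/subsetP => z zA.
  have [j hj] := dom z; apply/imsetP; exists j.
    rewrite !inE; apply/eqP => ji; subst j.
    have h1 := hi z; have h2 := hj x.
    have : r i x = r i z.
      by apply/eqP; rewrite eqn_leq h1 ?h2 ?in_setU1 ?eqxx ?zA ?orbT.
    by move/r_inj => e; rewrite e zA in xA.
  apply: (@r_inj j); apply/eqP; rewrite eqn_leq.
  case: (muP j) => m1 m2; rewrite m2 // hj // in_setU1 m1 orbT //.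
exists i; split => //.
  apply/aboveP => j ji; rewrite ltnNge; apply/negP => le.
  (* then mu on the complement of {i, j} would still hit A minus mu j *)
  have hm : forall z, z \in A -> z != mu j -> z \in mu @: ([set~ i] :\ j).
    move=> z zA zj; move: zA; rewrite -{1}sur => /imsetP[k]; rewrite !inE => ki zk.
    apply/imsetP; exists k => //; rewrite !inE ki andbT.
    by apply: contra zj => /eqP kj; rewrite zk kj.
  have mj : mu j \in mu @: ([set~ i] :\ j).
    have [k hk] := dom (mu j).
    have ki : k != i.
      apply/eqP => ki; subst k.
      have := hk x; rewrite in_setU1 eqxx => /(_ isT) h2.
      have := hi (mu j); rewrite in_setU1 (muP j).1 orbT => /(_ isT) h1.
      have : r i x = r i (mu j) by apply/eqP; rewrite eqn_leq h1 h2.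
      by move/r_inj => e; rewrite e (muP j).1 in xA.
    have kj : k != j.
      apply/eqP => kj; subst k.
      have := hk x; rewrite in_setU1 eqxx => /(_ isT) h2.
      have : r j x = r j (mu j) by apply/eqP; rewrite eqn_leq le h2.
      by move/r_inj => e; rewrite e (muP j).1 in xA.
    apply/imsetP; exists k; first by rewrite !inE ki kj.
    apply: (@r_inj k); apply/eqP; rewrite eqn_leq (muP k).2 ?(muP j).1 // hk //.
    by rewrite in_setU1 (muP k).1 orbT.
  have : A \subset mu @: ([set~ i] :\ j).
    by apply/subsetP => z zA; have [->//|] := eqVneq z (mu j); apply: hm.
  move/subset_leq_card; rewrite leqNgt => /negP; apply.
  apply: leq_ltn_trans (leq_imset_card _ _) _.
  by rewrite cA -(card_setC1 i) [X in (_ < X)%N](cardsD1 j) !inE ji.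
move=> y /aboveP hy.
have [k hk] := dom y.
have [ki|ki] := eqVneq k i; first by subst k; apply: hk; rewrite in_setU1 eqxx.
have := hk (mu k); rewrite in_setU1 (muP k).1 orbT => /(_ isT).
by rewrite leqNgt hy.
Qed.

Lemma above_completion i x : dominant A -> mu @: [set~ i] = A ->
  x \in above i -> (forall y, y \in above i -> r i y <= r i x) ->
  x \in completions A.
Proof.
move=> /dominantP dom sur /aboveP xa xmax; rewrite inE.
have xA : x \notin A.
  rewrite -sur; apply/imsetP => -[j]; rewrite !inE => ji e.
  by have := xa j ji; rewrite e ltnn.
rewrite xA /=; apply/dominantP => y.
have [/xmax ya|/aboveP ya] := boolP (y \in above i).
  exists i => z; rewrite in_setU1 => /orP[/eqP->//|zA].
  have [k hk] := dom x.
  have ki : k = i.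
    apply/eqP/negPn/negP => ki; have := hk (mu k) (muP k).1.
    by rewrite leqNgt xa.
  by subst k; apply: leq_trans ya _; apply: hk.
have /existsP[j] : [exists j, (j != i) && (r j y <= r j (mu j))].
  rewrite -[X in is_true X]negbK negb_exists; apply/negP => /forallP h; apply: ya => j ji.
  by have := h j; rewrite ji /= -ltnNge.
case/andP => ji hj; exists j => z; rewrite in_setU1 => /orP[/eqP->|zA].
  by apply: leq_trans hj _; apply: ltnW; apply: xa.
by apply: leq_trans hj _; apply: (muP j).2.
Qed.

Lemma mu_double i : mu @: [set~ i] = A ->
  exists2 k, k != i & mu k = mu i.
Proof.
move=> sur; have : mu i \in A by case: (muP i).
by rewrite -{1}sur => /imsetP[k]; rewrite !inE => ki ->; exists k.
Qed.

(** The #|I| minima of A run through #|I|.-1 points, so exactly two orders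
    share their minimum, and only one of these two can be left out. *)
Lemma mu_surj i j k : mu @: [set~ i] = A -> k != i -> mu k = mu i ->
  mu @: [set~ j] = A -> (j == i) || (j == k).
Proof.
move=> suri ki e surj; apply/negPn/negP; rewrite negb_or => /andP[ji jk].
have inj : {in [set~ j] &, injective mu}.
  by apply/imset_injP; rewrite surj cA card_setC1.
have := inj k i; rewrite !inE eq_sym jk eq_sym ji => /(_ isT isT e) ke.
by rewrite ke eqxx in ki.
Qed.

Lemma mu_surj2 i k : mu @: [set~ i] = A -> k != i -> mu k = mu i ->
  mu @: [set~ k] = A.
Proof.
move=> sur ki e; apply/eqP; rewrite eqEsubset; apply/andP; split.
  by apply/subsetP => z /imsetP[j _ ->]; case: (muP j).
apply/subsetP => z; rewrite -{1}sur => /imsetP[l]; rewrite !inE => li ->.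
have [->|lk] := eqVneq l k; last by apply/imsetP; exists l; rewrite ?inE.
by apply/imsetP; exists i; rewrite ?inE // eq_sym.
Qed.

(** A completion is the maximum, for the order left out, of the points above
    the other minima. Two orders i and k can be left out, and their sets above
    are disjoint by the dominance of A, so there is one completion for each of
    the two that is nonempty. *)
Lemma card_completions i k : dominant A -> mu @: [set~ i] = A -> k != i ->
  mu k = mu i ->
  #|completions A| = ((above i != set0) + (above k != set0))%N.
Proof.
move=> dom sur ki e.
have surk := mu_surj2 sur ki e.
have disj x : x \in above i -> x \in above k -> False.
  move=> /aboveP h1 /aboveP h2; have /dominantP/(_ x)[j hj] := dom.
  have := hj (mu j) (muP j).1; rewrite leqNgt => /negP; apply.
  by have [->|ji] := eqVneq j i; [apply: h2; rewrite eq_sym|apply: h1].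
have one j : mu @: [set~ j] = A ->
   #|[set x in completions A | x \in above j]| = (above j != set0).
  move=> surj; have [->|ne] := eqVneq (above j) set0 => /=.
    by apply/eqP; rewrite cards_eq0; apply/eqP/setP => z; rewrite !inE andbF.
  have [x xa xm] := max_rankP j ne.
  suff -> : [set z in completions A | z \in above j] = [set x] by rewrite cards1.
  apply/setP => z; rewrite [LHS]inE [RHS]inE; apply/idP/eqP => [|->].
    case/andP => zc za.
    have [l [surl zl zm]] := completion_above zc.
    have jl : l = j.
      have [k' k'j e'] := mu_double surj.
      case/orP: (mu_surj surj k'j e' surl) => /eqP // lk'.
      subst l; have /dominantP/(_ z)[m hm] := dom.
      have := hm (mu m) (muP m).1; rewrite leqNgt => /negP; case.
      have [->|mj] := eqVneq m j; first by move/aboveP: zl; apply; rewrite eq_sym.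
      by move/aboveP: za; apply.
    subst l; apply: (@r_inj j); apply/eqP; rewrite eqn_leq.
    by rewrite xm // zm.
  by rewrite xa (above_completion dom surj xa xm).
rewrite -(one i sur) -(one k surk) -cardsUI.
have -> : [set x in completions A | x \in above i] :&:
          [set x in completions A | x \in above k] = set0.
  apply/setP => z; rewrite in_setI in_set0; apply/negP => /andP[].
  rewrite inE => /andP[_ zi]; rewrite inE => /andP[_ zk]; exact: (disj z).
rewrite cards0 addn0.
congr #|pred_of_set _|; apply/setP => z; rewrite in_setU !inE.
rewrite -andb_orr; case zc : (_ && _) => //=.
have zc' : z \in completions A by rewrite inE zc.
have [l [surl zl _]] := completion_above zc'.
case/orP: (mu_surj sur ki e surl) => /eqP le; move: zl; rewrite le inE => ->//.
by rewrite orbT.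
Qed.

End Mu.

(** A doorway that contains an ordinary point t has a completion on each side:
    for both orders i that can be left out, the slack point s i is in above i,
    as it exceeds t in the other orders. For the outer doorway the orders are
    i0 and some k whose slack point is also the minimum of the order i0. Then
    above i0 contains the ordinary points, while above k is empty: a point that
    exceeds s k in the order i0 is a slack point. *)
Lemma odd_completions t0 : t0 \notin codom s -> c @: A = [set~ i0] ->
  odd #|completions A| = (A == slackset i0).
Proof.
move=> t0s cAi0.
have [mu muP] := minfun.
have [As|nAs] := boolP (A \subset codom s).
  have eA : A = slackset i0.
    apply/setP => z; apply/idP/imsetP => [zA|[l]].
      have /codomP[i zi] := subsetP As z zA.
      exists i; last by [].
      rewrite -cAi0; apply/imsetP; exists z => //.
      by rewrite zi c_s.
    rewrite -cAi0 => /imsetP[z' z'A ->] ->.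
    by have /codomP[i zi] := subsetP As z' z'A; rewrite zi c_s -zi.
  rewrite eA eqxx -eA.
  have muE j : j != i0 -> mu j = s j.
    move=> ji; apply: (@r_inj j); apply/eqP; rewrite eqn_leq.
    rewrite (muP j).2; last by rewrite eA imset_f // !inE.
    by have [->|h] := eqVneq (mu j) (s j); [exact: leqnn|exact: ltnW (s_min h)].
  have sur : mu @: [set~ i0] = A.
    rewrite eA; apply: eq_in_imset => j; rewrite !inE; exact: muE.
  have [k ki e] := mu_double muP sur.
  have mk := muE k ki.
  have ak : above mu k = set0.
    apply/setP => y; rewrite in_set0; apply/aboveP => h.
    have hi0 : r i0 (s k) < r i0 y by rewrite -mk e; apply: h; rewrite eq_sym.
    have [ys|ys] := boolP (y \in codom s); last first.
      by move: (s_big ki ys); rewrite ltnNge ltnW.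
    case/codomP: ys => l yl; subst y.
    have [li|li] := eqVneq l i0.
      subst l; have := hi0; rewrite ltnNge => /negP; apply; apply: ltnW.
      by apply: s_min; apply: contra ki => /eqP /(congr1 c); rewrite !c_s => ->.
    have [lk|lk] := eqVneq l k; first by subst l; rewrite ltnn in hi0.
    by have := h l lk; rewrite muE // ltnn.
  have dom : dominant A.
    apply/dominantP => y; have /setP/(_ y) := ak; rewrite in_set0 => /negbT.
    rewrite inE negb_forall => /existsP[j]; rewrite negb_imply -leqNgt => /andP[_ hj].
    by exists j => x xA; apply: leq_trans hj _; apply: (muP j).2.
  rewrite (card_completions muP dom sur ki e) ak eqxx addn0.
  suff -> : above mu i0 != set0 by [].
  apply/set0Pn; exists t0; apply/aboveP => j ji; rewrite muE //.
  apply: s_min; apply: contra t0s => /eqP ->; exact: codom_f.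
have -> : (A == slackset i0) = false.
  apply: contraNF nAs => /eqP ->; apply/subsetP => z /imsetP[i _ ->].
  exact: codom_f.
have [e0|/set0Pn[x xc]] := eqVneq (completions A) set0; first by rewrite e0 cards0.
have [i [sur _ _]] := completion_above muP xc.
have dom : dominant A.
  move: xc; rewrite inE => /andP[_]; apply: dominantS; exact: subsetUr.
have [k ki e] := mu_double muP sur.
rewrite (card_completions muP dom sur ki e).
have ab j : above mu j != set0.
  case/subsetPn: nAs => t tA ts.
  apply/set0Pn; exists (s j); apply/aboveP => l lj.
  apply: leq_ltn_trans ((muP l).2 t tA) _; apply: s_big => //; by rewrite eq_sym.
by rewrite !ab.
Qed.

End Door.

(** Double counting of the pairs of a room and a door of it. If no room has all
    the colours, the rooms contribute an even number ([odd_doors]); the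
    doorways contribute an odd one, as only the outer doorway has an odd number
    of completions ([odd_completions]). *)
Theorem scarf t0 : (1 < #|I|)%N -> t0 \notin codom s ->
  exists A : {set X}, [/\ c @: A = [set: I], #|A| = #|I| & dominant A].
Proof.
move=> cI t0s.
have [i0 _] : exists i0 : I, true.
  by case/card_gt0P: (ltnW cI) => i; exists i.
have [/existsP[A /and3P[/eqP h1 /eqP h2 h3]]|none] :=
  boolP [exists A : {set X}, [&& c @: A == [set: I], #|A| == #|I| & dominant A]].
  by exists A.
exfalso.
have s_inj : injective s by move=> i j /(congr1 c); rewrite !c_s.
pose rooms := [pred A : {set X} | (#|A| == #|I|) && dominant A].
pose N := (\sum_(A : {set X} | rooms A) #|doors i0 A|)%N.
have evenN : ~~ odd N.
  rewrite /N; apply: (big_ind (fun n => ~~ odd n)) => //.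
    by move=> m n /negbTE hm /negbTE hn; rewrite oddD hm hn.
  move=> A /andP[/eqP cA dA]; apply: odd_doors => //.
  apply: contra none => cc; apply/existsP; exists A; by rewrite cc cA eqxx dA.
have eN : N = (\sum_(A : {set X} | doorway i0 A) #|completions A|)%N.
  rewrite /N; under eq_bigr do rewrite -sum1_card.
  under [RHS]eq_bigr do rewrite -sum1_card.
  rewrite (exchange_big_dep predT) //= [RHS](exchange_big_dep predT) //=.
  apply: eq_bigr => x _.
  rewrite (reindex_onto (fun A => x |: A) (fun A => A :\ x)); last first.
    by move=> A /andP[_]; rewrite inE => /andP[xA _]; rewrite setD1K.
  apply: eq_bigl => A; rewrite !inE eqxx /= /doorway.
  have [xA|xA] := boolP (x \in A).
    rewrite andbF; apply/negP => /andP[_ /eqP h].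
    by move: xA; rewrite -h !inE eqxx.
  have -> : (x |: A) :\ x = A.
    by apply/setP => z; rewrite !inE; have [->|] := eqVneq z x => //=; rewrite (negbTE xA).
  rewrite eqxx !andbT /= cardsU1 xA add1n.
  rewrite -[X in _ == X](prednK (ltnW cI)) eqSS.
  by rewrite -!andbA; congr (_ && _); rewrite andbC.
move: evenN; rewrite eN.
have ds : doorway i0 (slackset i0).
  apply/andP; split.
    by rewrite card_imset // card_setC1.
  apply/eqP/setP => i; apply/imsetP/idP => [[x /imsetP[j ji ->] ->]|ii].
    by rewrite c_s.
  by exists (s i); rewrite ?c_s // imset_f.
rewrite (bigD1 (slackset i0)) //= oddD.
case/andP: (ds) => /eqP d1 /eqP d2.
rewrite (odd_completions cI d1 t0s d2) eqxx /= negbK.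
apply/negP; apply: (big_ind (fun n => ~~ odd n)) => //.
  by move=> m n /negbTE hm /negbTE hn; rewrite oddD hm hn.
move=> A /andP[/andP[/eqP e1 /eqP e2] e3].
by rewrite (odd_completions cI e1 t0s e2).
Qed.
End Scarf.

(** * Colourings of a simplex grid *)

Lemma lex_lt g m N a b : (g <= m -> a < N -> g * N + a < m.+1 * N + b)%N.
Proof. by move=> gm aN; have := leq_mul gm (leqnn N); rewrite mulSn; lia. Qed.

Section Grid.
Variables (I : finType) (m : nat).
Hypothesis cardI : (1 < #|I|)%N.

(** The points of the simplex whose barycentric coordinates are multiples of
    1/m, scaled by m. *)
Definition gridpt := {p : {ffun I -> 'I_m.+1} | (\sum_i (p i : nat) == m)%N}.

Definition gcoord (p : gridpt) i : nat := val p i.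

Lemma gcoord_sum p : (\sum_i gcoord p i = m)%N.
Proof. by apply/eqP; case: p. Qed.

Lemma gcoord_le p i : (gcoord p i <= m)%N.
Proof. by rewrite -ltnS /gcoord. Qed.

Lemma gridpt_of (y : I -> nat) : (\sum_i y i = m)%N ->
  exists p : gridpt, forall i, gcoord p i = y i.
Proof.
move=> sy.
have ym i : (y i < m.+1)%N by rewrite ltnS -sy (bigD1 i) //= leq_addr.
pose f : {ffun I -> 'I_m.+1} := [ffun i => Ordinal (ym i)].
have fP : (\sum_i (f i : nat) == m)%N.
  by rewrite -[X in _ == X]sy; apply/eqP/eq_bigr => i _; rewrite ffunE.
by exists (exist _ f fP) => i; rewrite /gcoord /= ffunE.
Qed.

Lemma enum_rank_lt (p : gridpt) : (enum_rank p < #|{: gridpt}|)%N.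
Proof. exact: ltn_ord. Qed.

(** The order i sorts the grid points by their coordinate i. The rank of the
    point in the enumeration of the grid breaks ties, which makes the order
    linear; it is less than the cardinal of the grid, so it cannot override the
    coordinate. The slack point j comes first in its own order and after all
    grid points in the others. *)
Definition rank (i : I) (x : gridpt + I) : nat :=
  match x with
  | inl p => (gcoord p i * #|{: gridpt}| + enum_rank p).+1
  | inr j => if j == i then 0 else
      ((m.+1 * #|{: gridpt}|) + enum_rank j).+1
  end.

Lemma rank_inl_lt i p j : j != i -> (rank i (inl p) < rank i (inr j))%N.
Proof.
move=> /negbTE ji; rewrite /= ji ltnS.
exact: lex_lt _ (gcoord_le p i) (enum_rank_lt p).
Qed.

Lemma rank_coord i p p' : (rank i (inl p) <= rank i (inl p'))%N ->
  (gcoord p i <= gcoord p' i)%N.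
Proof.
rewrite /= ltnS => h; rewrite leqNgt; apply/negP => lt.
have := lex_lt 0 (leqnn (gcoord p' i)) (enum_rank_lt p').
have := leq_mul lt (leqnn #|{: gridpt}|) => h1; rewrite addn0 => h2.
by have := leq_trans h2 (leq_trans h1 (leq_trans (leq_addr _ _) h)); rewrite ltnn.
Qed.

Lemma rank_inj i : injective (rank i).
Proof.
move=> [p|j] [p'|j'].
- move=> h; have h1 := @rank_coord i p p'; have h2 := @rank_coord i p' p.
  rewrite h leqnn in h1 h2.
  have e : gcoord p i = gcoord p' i.
    by apply/eqP; rewrite eqn_leq h1 ?h2.
  move: h => /= -[]; rewrite e => /addnI /ord_inj /enum_rank_inj -> //.
- move=> /= h; have [j'i|j'i] := eqVneq j' i; first by rewrite j'i eqxx in h.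
  by have := rank_inl_lt p j'i; rewrite /= h ltnn.
- move=> /= h; have [ji|ji] := eqVneq j i; first by rewrite ji eqxx in h.
  by have := rank_inl_lt p' ji; rewrite /= h ltnn.
- rewrite /=; case: eqP => [->|_]; case: eqP => [->|_] // -[] /addnI.
  by move/ord_inj/enum_rank_inj ->.
Qed.

(** Let C be the set of the orders whose slack point is not in the set given by
    Scarf's lemma, and mm i the least coordinate i of its grid points.
    Dominance forbids a grid point with all coordinates i in C greater than mm
    i, so the sum of the mm i over C is at least m up to #|I|. As the
    coordinates of each point add up to m, those in C are mm i and the others
    0, up to #|I|: the grid points of the set are close to each other, and they
    carry all the colours in C. *)
Theorem grid_colouring (c : gridpt -> I) :
  exists (C : {set I}) (q : gridpt),
    (forall j, j \notin C -> (gcoord q j <= #|I|)%N) /\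
    (forall i, i \in C -> exists p : gridpt, c p = i /\
       forall j, (gcoord p j <= gcoord q j + #|I|)%N /\
                 (gcoord q j <= gcoord p j + #|I|)%N).
Proof.
have [i0 _] : exists i0 : I, true.
  by case/card_gt0P: (ltnW cardI) => i; exists i.
have [t0 _] : exists t : gridpt, forall i, gcoord t i = if i == i0 then m else 0.
  apply: gridpt_of; rewrite (bigD1 i0) //= eqxx big1 ?addn0 // => i.
  by move/negbTE ->.
pose s : I -> gridpt + I := inr.
pose c' (x : gridpt + I) := match x with inl p => c p | inr i => i end.
have ns p : inl p \notin codom s by apply/codomP => -[].
have smin : forall i x, x != s i -> (rank i (s i) < rank i x)%N.
  move=> i [p|j] /= h; rewrite eqxx //; case: eqP => // e; by rewrite e eqxx in h.
have sbig : forall i j x, j != i -> x \notin codom s ->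
    (rank i x < rank i (s j))%N.
  move=> i j [p|k] ji; first by move=> _; exact: rank_inl_lt.
  by rewrite codom_f.
have [A [cA _ /dominantP dom]] :=
  scarf rank_inj smin sbig (c := c') (fun _ => erefl) cardI (ns t0).
pose C := [set i | inr i \notin A].
pose AT := [set p | inl p \in A].
have domC y : exists2 i, i \in C & forall p, p \in AT -> (gcoord y i <= gcoord p i)%N.
  have [i hi] := dom (inl y); exists i.
    by rewrite inE; apply/negP => /hi; rewrite /= eqxx.
  by move=> p; rewrite inE => /hi; apply: rank_coord.
have colC i : i \in C -> exists2 p, p \in AT & c p = i.
  rewrite inE => iC; have : i \in c' @: A by rewrite cA inE.
  case/imsetP => -[p|j] xA /= e; first by exists p; rewrite ?inE.
  by rewrite e xA in iC.
have [i1 i1C _] := domC t0.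
have [q qA _] := colC _ i1C.
pose mm i := gcoord [arg min_(p < q in AT) gcoord p i] i.
have mmP i : (exists2 p, p \in AT & mm i = gcoord p i) /\
   forall p, p \in AT -> (mm i <= gcoord p i)%N.
  rewrite /mm; case: arg_minnP => // p pA hp; split; first by exists p.
  exact: hp.
have big : (m < \sum_(i in C) (mm i).+1)%N.
  rewrite ltnNge; apply/negP => le.
  (* otherwise there is room for a grid point y exceeding all the minima: the
     excess is put on the coordinate i1 *)
  pose y i := if i \in C then
    (if i == i1 then (mm i).+1 + (m - \sum_(i in C) (mm i).+1) else (mm i).+1) else 0.
  have [p py] : exists p : gridpt, forall i, gcoord p i = y i.
    apply: gridpt_of; rewrite (bigID (mem C)) /= [X in _ + X]big1 ?addn0; last first.
      by move=> i /negbTE iC; rewrite /y iC.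
    rewrite (bigD1 i1) //= /y i1C eqxx.
    rewrite [X in _ + _ + X](eq_bigr (fun i => (mm i).+1)); last first.
      move=> i; case/andP => iC ii1; rewrite (negbTE ii1).
      by have -> : i \in C = true by exact: iC.
    move: le; rewrite (bigD1 i1) //=; lia.
  have [i iC hi] := domC p.
  have [[p' p'A e] _] := mmP i.
  have := hi _ p'A; rewrite -e py /y iC; case: ifP => _; lia.
have cC : (\sum_(i in C) (mm i).+1 <= \sum_(i in C) mm i + #|I|)%N.
  under eq_bigr do rewrite -addn1.
  by rewrite big_split /= leq_add2l sum1_card max_card.
have bd p j : p \in AT -> (gcoord p j <= (if j \in C then mm j else 0) + #|I|)%N.
  move=> pA.
  have : (gcoord p j + \sum_(i in C | i != j) mm i <= m)%N.
    rewrite -(gcoord_sum p) [X in (_ <= X)%N](bigD1 j) //= leq_add2l.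
    rewrite big_mkcondl /=; apply: leq_sum => i _.
    by case: ifP => // _; case: (mmP i) => _; apply.
  case: ifP => jC.
    have e : (\sum_(i in C) mm i = mm j + \sum_(i in C | i != j) mm i)%N.
      by rewrite (bigD1 j).
    move: big cC; rewrite e; lia.
  have -> : (\sum_(i in C | i != j) mm i = \sum_(i in C) mm i)%N.
    by apply: eq_bigl => i; case: eqP => [->|_]; rewrite ?jC ?andbT.
  move: big cC; lia.
have lo p j : p \in AT -> ((if j \in C then mm j else 0) <= gcoord p j)%N.
  by move=> pA; case: ifP => // _; case: (mmP j) => _; apply.
exists C, q; split.
  by move=> j /negbTE jC; have := bd q j qA; rewrite jC.
move=> i iC; have [p pA cp] := colC i iC.
exists p; split => // j; split.
  by apply: leq_trans (bd p j pA) _; rewrite leq_add2r lo.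
by apply: leq_trans (bd q j qA) _; rewrite leq_add2r lo.
Qed.
End Grid.

From mathcomp Require Import all_classical all_reals all_analysis.
From mathcomp Require Import measurable_realfun ring lra.

Import Order.TTheory GRing.Theory Num.Theory.
Import numFieldNormedType.Exports.

Local Open Scope classical_set_scope.
Local Open Scope ring_scope.

(** * Zeros of vector fields pointing outwards on a sphere *)

Lemma continuous_sumR (R : realType) (T : topologicalType) n (f : 'I_n -> T -> R) :
  (forall j, continuous (f j : T -> R^o)) ->
  continuous (fun x => \sum_j f j x : R^o).
Proof.
move=> fc; apply: (@continuous_big R^o _ +%R 0 xpredT) => //.
exact: add_continuous.
Qed.

Section Brouwer.
Variables (R : realType) (k : nat).
Implicit Types u v w : 'rV[R]_k.

Definition dotr u v : R := \sum_i u 0 i * v 0 i.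
Definition norm2 u : R := Num.sqrt (dotr u u).

Lemma dotr_ge0 u : 0 <= dotr u u.
Proof. by apply: sumr_ge0 => i _; rewrite -expr2 sqr_ge0. Qed.

Lemma sqr_norm2 u : norm2 u ^+ 2 = dotr u u.
Proof. by rewrite sqr_sqrtr // dotr_ge0. Qed.

Lemma dotrZl a u v : dotr (a *: u) v = a * dotr u v.
Proof. by rewrite /dotr mulr_sumr; apply: eq_bigr => i _; rewrite mxE mulrA. Qed.

Lemma norm2Z a u : norm2 (a *: u) = `|a| * norm2 u.
Proof.
rewrite /norm2 (_ : dotr _ _ = a ^+ 2 * dotr u u); last first.
  rewrite /dotr mulr_sumr; apply: eq_bigr => i _; rewrite !mxE expr2; lra.
by rewrite sqrtrM ?sqr_ge0 // sqrtr_sqr.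
Qed.

Lemma coord_le_norm2 u i : `|u 0 i| <= norm2 u.
Proof.
rewrite -sqrtr_sqr ler_sqrt ?dotr_ge0 // /dotr (bigD1 i) //= -expr2 lerDl.
by apply: sumr_ge0 => j _; rewrite -expr2 sqr_ge0.
Qed.

Lemma rV_norm_le u (e : R) : 0 <= e -> (forall i, `|u 0 i| <= e) -> `|u| <= e.
Proof.
move=> e0 h; rewrite /Num.norm /= mx_normrE; apply: bigmax_le => // -[i j] _ /=.
by rewrite ord1.
Qed.

Lemma coord_le_norm u i : `|u 0 i| <= `|u|.
Proof.
rewrite [leRHS]/Num.norm /= mx_normrE.
exact: (le_bigmax _ (fun ij : 'I_1 * 'I_k => `|u ij.1 ij.2|) (0, i)).
Qed.

Variables (F : 'rV[R]_k -> 'rV[R]_k) (rho : R).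
Hypothesis rho_gt0 : 0 < rho.
Hypothesis F_cont : forall i, continuous (fun u => F u 0 i).
Hypothesis F_out : forall u, norm2 u = rho -> 0 < dotr (F u) u.

(** The nearest point retraction onto the ball of radius rho. *)
Definition retract w := (rho / Num.max rho (norm2 w)) *: w.

Definition retracted_step u := retract (u - F u).

Lemma max_rho_gt0 w : 0 < Num.max rho (norm2 w).
Proof. by rewrite lt_max rho_gt0. Qed.

Lemma norm2_retract w : norm2 (retract w) <= rho.
Proof.
rewrite norm2Z ger0_norm; last by rewrite divr_ge0 ?ltW // max_rho_gt0.
rewrite -mulrA; apply: ler_piMr; first exact: ltW.
by rewrite mulrC ler_pdivrMr ?max_rho_gt0 // mul1r le_max lexx orbT.
Qed.

(** If u - F u is in the ball, the fixed point equation is F u = 0. Otherwise u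
    is on the sphere and u - F u is a multiple t u with t > 1, so F u = (1 - t)
    u points inwards, against the hypothesis. *)
Lemma retracted_step_fixed u : retracted_step u = u -> F u = 0.
Proof.
rewrite /retracted_step /retract; set w := u - F u => e.
have Fu : F u = u - w by rewrite /w opprB addrC subrK.
have [le|gt] := leP (norm2 w) rho.
  by move: e; rewrite max_l // divff ?gt_eqF // scale1r Fu => ->; rewrite subrr.
have w0 : 0 < norm2 w by apply: lt_trans gt.
move: e; rewrite max_r ?ltW // => e.
have nu : norm2 u = rho.
  rewrite -e norm2Z ger0_norm ?divr_ge0 ?ltW // mulfVK ?gt_eqF //.
have wE : w = (norm2 w / rho) *: u.
  rewrite -[in RHS]e scalerA mulrA divfK ?gt_eqF // divff ?gt_eqF //.
  by rewrite scale1r.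
have := F_out nu.
rewrite Fu {1}wE -{1}[u]scale1r -scalerBl dotrZl -sqr_norm2 nu.
rewrite pmulr_lgt0 ?exprn_gt0 // subr_gt0 ltr_pdivrMr // mul1r.
by rewrite ltNge (ltW gt).
Qed.

Lemma cont_retracted_step i : continuous (fun u => retracted_step u 0 i).
Proof.
have sub_cont j : continuous (fun u => (u - F u) 0 j).
  move=> u; rewrite (_ : (fun u => _) = (fun u => u 0 j - F u 0 j)); last first.
    by apply/funext => v; rewrite !mxE.
  apply: (@continuousB R R^o); [exact: coord_continuous|exact: F_cont].
have norm_cont : continuous (fun u => norm2 (u - F u) : R^o).
  move=> u; rewrite /norm2.
  apply: (@continuous_comp _ _ _ (fun u => dotr (u - F u) (u - F u)) Num.sqrt).
    apply: continuous_sumR => j v; apply: (@continuousM R); exact: sub_cont.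
  exact: sqrt_continuous.
have inv_cont : continuous (fun u => (Num.max rho (norm2 (u - F u)))^-1 : R).
  move=> u; apply: (@continuousV R _ (fun u => Num.max rho (norm2 (u - F u))) u); first by rewrite gt_eqF // max_rho_gt0.
  apply: (@continuous_max R _ (fun=> rho) (fun u => norm2 (u - F u))).
    exact: cst_continuous.
  exact: norm_cont.
have -> : (fun u => retracted_step u 0 i) =
  (fun u => rho * (Num.max rho (norm2 (u - F u)))^-1 * (u - F u) 0 i).
  by apply/funext => v; rewrite /retracted_step /retract mxE.
move=> u; apply: (@continuousM R _ (fun u => rho * _) (fun u => (u - F u) 0 i)).
  by apply: (@continuousM R _ (fun=> rho)); [exact: cst_continuous|exact: inv_cont].
exact: sub_cont.
Qed.

(** The simplex with vertex (-rho, ..., -rho) and edges of length A along the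
    axes contains the ball of radius rho. *)
Let A : R := 2 * rho * k.+1%:R.

Let A_gt0 : 0 < A.
Proof. by rewrite !mulr_gt0 ?ltr0n. Qed.

(** Barycentric coordinates in this simplex, extended as affine functions to
    the whole space; the number 0 belongs to the vertex (-rho, ..., -rho). *)
Definition bary (i : 'I_k.+1) u : R :=
  if unlift ord0 i is Some j then (u 0 j + rho) / A
  else 1 - \sum_j (u 0 j + rho) / A.

Lemma bary0 u : bary ord0 u = 1 - \sum_j (u 0 j + rho) / A.
Proof. by rewrite /bary unlift_none. Qed.

Lemma baryS j u : bary (lift ord0 j) u = (u 0 j + rho) / A.
Proof. by rewrite /bary liftK. Qed.

Lemma sum_bary u : \sum_i bary i u = 1.
Proof.
rewrite big_ord_recl bary0 (eq_bigr _ (fun j _ => baryS j u)).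
by rewrite subrK.
Qed.

Lemma bary_ge0 i u : norm2 u <= rho -> 0 <= bary i u.
Proof.
move=> ule; have uj j : - rho <= u 0 j <= rho.
  by rewrite -ler_norml; apply: le_trans (coord_le_norm2 u j) ule.
case: (unliftP ord0 i) => [j|] ->.
  by rewrite baryS divr_ge0 ?(ltW A_gt0) //; have := uj j; lra.
rewrite bary0 subr_ge0 -mulr_suml ler_pdivrMr // mul1r.
apply: (@le_trans _ _ (\sum_(j < k) (2 * rho))).
  by apply: ler_sum => j _; have := uj j; lra.
rewrite sumr_const card_ord -[leLHS]mulr_natr /A; apply: ler_wpM2l.
  by rewrite mulr_ge0 // ltW.
by rewrite ler_nat.
Qed.

Lemma cont_bary i (g : 'rV[R]_k -> 'rV[R]_k) :
  (forall j, continuous (fun u => g u 0 j)) ->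
  continuous (fun u => bary i (g u) : R^o).
Proof.
move=> gc; have aff j : continuous (fun u => (g u 0 j + rho) / A : R^o).
  move=> u; apply: (@continuousM R _ (fun u => g u 0 j + rho) (fun=> A^-1)).
    apply: (@continuousD R R^o _ (fun u => g u 0 j) (fun=> rho)); first exact: gc.
    exact: cst_continuous.
  exact: cst_continuous.
case: (unliftP ord0 i) => [j|] -> u.
  rewrite (_ : (fun u => _) = (fun u => (g u 0 j + rho) / A)); first exact: aff.
  by apply/funext => v; rewrite baryS.
rewrite (_ : (fun u => _) = (fun u => 1 - \sum_j (g u 0 j + rho) / A)); last first.
  by apply/funext => v; rewrite bary0.
apply: (@continuousB R R^o _ (fun=> 1) (fun u => \sum_j (g u 0 j + rho) / A)).
  exact: cst_continuous.
exact: continuous_sumR.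
Qed.

Definition grid_vec m (p : gridpt 'I_k.+1 m) : 'rV[R]_k :=
  \row_j (A * ((gcoord p (lift ord0 j))%:R / m%:R) - rho).

Lemma bary_grid m (p : gridpt 'I_k.+1 m) i : (0 < m)%N ->
  bary i (grid_vec p) = (gcoord p i)%:R / m%:R.
Proof.
move=> m0; have baryE j : (grid_vec p 0 j + rho) / A =
    (gcoord p (lift ord0 j))%:R / m%:R.
  by rewrite mxE subrK mulrC mulKf // gt_eqF.
case: (unliftP ord0 i) => [j|] ->; first by rewrite baryS.
rewrite bary0 (eq_bigr _ (fun j _ => baryE j)) -mulr_suml.
have /(congr1 (fun n => n%:R : R)) := gcoord_sum p.
rewrite natr_sum big_ord_recl /= => e.
have -> : \sum_(j < k) (gcoord p (lift ord0 j))%:R = m%:R - (gcoord p ord0)%:R :> R.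
  by rewrite -e addrC addKr.
rewrite mulrBl divff ?subKr // pnatr_eq0 -lt0n //.
Qed.

Lemma grid_vec_near m n (p q : gridpt 'I_k.+1 m) : (0 < m)%N ->
  (forall j, (gcoord p j <= gcoord q j + n)%N /\ (gcoord q j <= gcoord p j + n)%N) ->
  `|grid_vec p - grid_vec q| <= A * n%:R / m%:R.
Proof.
move=> m0 h; have m0' : 0 < m%:R :> R by rewrite ltr0n.
apply: rV_norm_le => [|i].
  by rewrite divr_ge0 ?mulr_ge0 ?ler0n // ltW.
have [h1 h2] := h (lift ord0 i); rewrite !mxE.
have h1' : (gcoord p (lift ord0 i))%:R <= (gcoord q (lift ord0 i))%:R + n%:R :> R.
  by rewrite -natrD ler_nat.
have h2' : (gcoord q (lift ord0 i))%:R <= (gcoord p (lift ord0 i))%:R + n%:R :> R.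
  by rewrite -natrD ler_nat.
move: h1' h2'; set a := (gcoord p _)%:R; set b := (gcoord q _)%:R => h1' h2'.
rewrite (_ : _ - _ = A / m%:R * (a - b)); last by ring.
rewrite normrM gtr0_norm ?divr_gt0 // [leRHS]mulrAC; apply: ler_wpM2l.
  by rewrite divr_ge0 // ltW.
by rewrite ler_norml; lra.
Qed.

Lemma grid_vec_bounded m (p : gridpt 'I_k.+1 m) : (0 < m)%N ->
  `|grid_vec p| <= A + rho.
Proof.
move=> m0; have m0' : 0 < m%:R :> R by rewrite ltr0n.
apply: rV_norm_le => [|i]; first by rewrite addr_ge0 // ltW.
rewrite mxE; apply: le_trans (ler_normB _ _) _.
rewrite (gtr0_norm rho_gt0) lerD2r ger0_norm; last first.
  by rewrite mulr_ge0 ?divr_ge0 ?ler0n // ltW.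
by rewrite ger_pMr // ler_pdivrMr // mul1r ler_nat gcoord_le.
Qed.

(** A grid point is coloured by a coordinate that does not decrease under the
    map; there is one because the coordinates of the point and of its image
    both add up to 1. *)
Lemma approx_colour m : (0 < k)%N -> (0 < m)%N ->
  exists u, [/\ `|u| <= A + rho & forall i, bary i u <= k.+1%:R / m%:R \/
    exists2 v, `|v - u| <= A * k.+1%:R / m%:R & bary i v <= bary i (retracted_step v)].
Proof.
move=> k0 m0.
have ex (p : gridpt 'I_k.+1 m) : exists i, bary i (grid_vec p) <= bary i (retracted_step (grid_vec p)).
  apply/not_existsP => h.
  have : \sum_i bary i (retracted_step (grid_vec p)) < \sum_i bary i (grid_vec p).
    rewrite !big_ord_recl; apply: ltr_leD.
      by rewrite ltNge; apply/negP/h.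
    by apply: ler_sum => j _; rewrite leNgt; apply/negP => /ltW; exact: h.
  by rewrite !sum_bary ltxx.
have cI : (1 < #|'I_k.+1|)%N by rewrite card_ord.
have [c hc] := choice ex.
have [C [q [hq hp]]] := grid_colouring cI c.
exists (grid_vec q); split; first exact: grid_vec_bounded.
move=> i; have [iC|iC] := boolP (i \in C); last first.
  left; rewrite bary_grid //; apply: ler_wpM2r; first by rewrite invr_ge0.
  rewrite ler_nat; by have := hq i iC; rewrite card_ord.
right; have [p [cp near]] := hp i iC.
exists (grid_vec p); last by rewrite -{1 2}cp; exact: hc.
by apply: grid_vec_near => //; rewrite card_ord in near.
Qed.

(** A limit point u of the approximate solutions, as the mesh of the grid tends
    to 0. A coordinate that is not small along the sequence passes to the limit
    by continuity; a coordinate that tends to 0 vanishes at u, and the one of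
    the image, which lies in the ball, is nonnegative. *)
Lemma exists_bary_le : (0 < k)%N -> exists u, forall i, bary i u <= bary i (retracted_step u).
Proof.
move=> k0.
have ex (m : nat) : exists u, [/\ `|u| <= A + rho &
    forall i, bary i u <= k.+1%:R / m.+1%:R \/
    exists2 v, `|v - u| <= A * k.+1%:R / m.+1%:R & bary i v <= bary i (retracted_step v)].
  exact: approx_colour.
have [q hq] := choice ex.
have cB : compact [set u : 'rV[R]_k | `|u| <= A + rho].
  apply: bounded_closed_compact.
    exists (A + rho); split; first by rewrite num_real.
    by move=> x xl u /= ul; apply: le_trans ul (ltW xl).
  apply: (@closed_comp _ _ (fun u : 'rV[R]_k => `|u|) [set x | x <= A + rho]).
    by move=> u _; exact: norm_continuous.
  exact: closed_le.
have [|u [_ uc]] := cB (q @ \oo) _.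
  by exists 0%N => // m _ /=; have [] := hq m.
exists u => i; rewrite leNgt; apply/negP => lt.
(* the defect 3 * eta exceeds the errors, of size eta, made in passing to
   nearby points *)
pose eta := (bary i u - bary i (retracted_step u)) / 3.
have eta0 : 0 < eta by rewrite divr_gt0 // subr_gt0.
have c1 : continuous (fun u => bary i u : R^o).
  by apply: (@cont_bary i id) => j; exact: coord_continuous.
have c2 : continuous (fun u => bary i (retracted_step u) : R^o).
  by apply: cont_bary => j; exact: cont_retracted_step.
have /cvgrPdist_lt/(_ _ eta0)/nbhs_ballP[r1 /= r10 h1] := c1 u.
have /cvgrPdist_lt/(_ _ eta0)/nbhs_ballP[r2 /= r20 h2] := c2 u.
pose r := Num.min r1 r2.
have r0 : 0 < r by rewrite lt_min r10 r20.
have near v : `|u - v| < r -> [/\ bary i u - eta < bary i v &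
    bary i (retracted_step v) < bary i (retracted_step u) + eta].
  rewrite lt_min => /andP[l1 l2].
  have := h1 v; rewrite -ball_normE => /(_ l1) /=.
  have := h2 v; rewrite -ball_normE => /(_ l2) /=.
  rewrite !ltr_norml => /andP[a1 a2] /andP[b1 b2]; split; lra.
pose e := Num.min (r / 2) eta.
have e0 : 0 < e by rewrite lt_min eta0 divr_gt0.
have A1 : 0 < (A + 1) * k.+1%:R by rewrite mulr_gt0 ?ltr0n // addr_gt0.
have [N _ hN] := near_infty_natSinv_lt (PosNum (divr_gt0 e0 A1)).
have B : nbhs u (ball u (r / 2)) by apply: nbhsx_ballx; rewrite divr_gt0.
have Aq : (q @ \oo) [set q m | m in [set m | (N <= m)%N]].
  by exists N => // m /= Nm; exists m.
have [x [[m /= Nm <-]]] := uc _ _ Aq B.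
rewrite -ball_normE /= => um.
have small : (A + 1) * k.+1%:R / m.+1%:R < e.
  have := hN m Nm; rewrite /= => h.
  by rewrite -ltr_pdivlMl // mulrC.
have m0 : 0 < m.+1%:R^-1 :> R by rewrite invr_gt0 ltr0n.
have Ak : 0 < A * k.+1%:R / m.+1%:R by rewrite mulr_gt0 // mulr_gt0 ?ltr0n.
have k1 : 0 < k.+1%:R / m.+1%:R :> R by rewrite mulr_gt0 ?ltr0n.
move: small; rewrite mulrDl mul1r mulrDl lt_min => /andP[s1 s2].
have etaE : bary i u = bary i (retracted_step u) + 3 * eta by rewrite /eta; lra.
have [qb /(_ i) hqi] := hq m.
move: s1 s2 hqi Ak k1.
set d1 := A * _ / _; set d2 := (k.+1)%:R / _ => s1 s2 hqi Ak k1.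
have uqr : `|u - q m| < r by apply: lt_trans um _; lra.
have [n1 n2] := near _ uqr.
clearbody d1 d2 eta.
case: hqi => [hi|[v vq hv]].
  have b0 := bary_ge0 i (norm2_retract (u - F u)); rewrite -/(retracted_step u) in b0.
  lra.
have uv : `|u - v| < r.
  rewrite -[u](subrK (q m)) -addrA; apply: le_lt_trans (ler_normD _ _) _.
  by rewrite distrC in vq; lra.
have [n3 n4] := near _ uv; lra.
Qed.

(** Coordinates that do not decrease and have a constant sum are fixed, so the
    retracted step has a fixed point. *)
Theorem zero_of_outward : exists u, F u = 0.
Proof.
have [k0|k0] := posnP k.
  by exists 0; apply/rowP => -[j jk]; exfalso; rewrite k0 in jk.
have [u hu] := exists_bary_le k0; exists u; apply: retracted_step_fixed.
have eqb i : bary i (retracted_step u) = bary i u.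
  apply/eqP; rewrite eq_le hu andbT leNgt; apply/negP => lt.
  have : \sum_i bary i u < \sum_i bary i (retracted_step u).
    rewrite (bigD1 i) //= [ltRHS](bigD1 i) //=; apply: ltr_leD => //.
    by apply: ler_sum => j _; exact: hu.
  by rewrite !sum_bary ltxx.
apply/rowP => j; have := eqb (lift ord0 j); rewrite !baryS.
by move/(mulIf (invr_neq0 (lt0r_neq0 A_gt0)))/addIr.
Qed.
End Brouwer.

(** * Null sets and boxes in three dimensions *)

Section Negligible.
Context d (T : measurableType d) (R : realType).
Variable mu : {measure set T -> \bar R}.
Variable N : set T.
Hypothesis mN : measurable N.
Hypothesis N0 : mu N = 0%E.
Local Open Scope ereal_scope.
Import HBNNSimple.

(** The function g need not be measurable: its integral is a supremum over
    simple functions, and truncating a simple function to the complement of N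
    does not change its integral. This covers integrands whose gradients are
    meaningless on the boundaries of the elements. *)
Lemma ge0_integral_setC_negligible (g : T -> \bar R) : (forall x, 0 <= g x) ->
  \int[mu]_x g x = \int[mu]_(x in ~` N) g x.
Proof.
move=> g0; have mNC := measurableC mN.
apply/eqP; rewrite eq_le; apply/andP; split.
  rewrite [leLHS]ge0_integralTE //; apply/ge_ereal_sup => _ /= [h hg <-].
  have -> : sintegral mu h = sintegral mu (proj_nnsfun h mNC).
    have := integral_nnsfun mu measurableT h.
    rewrite patch_setT => <-.
    rewrite (@ge0_negligible_integral _ _ _ mu setT N) //.
    - by rewrite setTD integral_nnsfun // mrestrict.
    - by apply/measurable_EFinP.
    - by move=> x _; rewrite lee_fin.
  rewrite ge0_integralE //; apply: ereal_sup_ubound => /=.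
  exists (proj_nnsfun h mNC) => // x.
  rewrite -mrestrict /patch; case: ifP => // _; exact: hg.
rewrite [leLHS]ge0_integralE // [leRHS]ge0_integralTE //.
apply/ge_ereal_sup => _ /= [h hg <-]; apply: ereal_sup_ubound => /=.
exists h => //= x; apply: le_trans (hg x) _.
by rewrite /patch; case: ifP.
Qed.

Lemma integral_setD_negligible (D : set T) (f : T -> \bar R) :
  \int[mu]_(x in D) f x = \int[mu]_(x in D `\` N) f x.
Proof.
have pos g : (forall x, 0 <= g x) ->
    \int[mu]_(x in D) g x = \int[mu]_(x in D `\` N) g x.
  move=> g0; rewrite integral_mkcond ge0_integral_setC_negligible.
    by rewrite setDE setIC integral_mkcondr.
  by move=> x; rewrite /patch; case: ifP.
by rewrite integralE [RHS]integralE; congr (_ - _); apply: pos.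
Qed.

Lemma integral_eq_off_negligible (D E : set T) (f : T -> \bar R) :
  D `\` N = E `\` N -> \int[mu]_(x in D) f x = \int[mu]_(x in E) f x.
Proof. by move=> e; rewrite integral_setD_negligible e -integral_setD_negligible. Qed.
End Negligible.

Section Leb3.
Variable R : realType.

(** These are the measures behind integral3; the explicit type exposes their
    measure structure. *)
Definition leb2m :=
  ((@lebesgue_measure R \x @lebesgue_measure R)%E : {measure set (_ * _) -> \bar R}).
Definition leb3m :=
  ((leb2m \x @lebesgue_measure R)%E : {measure set (_ * _) -> \bar R}).

Lemma integral3E (D : set 'rV[R]_3) f :
  integral3 D f = Rintegral leb3m (@vec3 R @^-1` D) (f \o @vec3 R).
Proof. by []. Qed.

Lemma measurable_vec3_coord k : measurable_fun setT (fun p : R * R * R => vec3 p 0 k).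
Proof.
case: k => -[|[|[|//]]] k3.
- rewrite (_ : (fun p => _) = fst \o fst); last by apply/funext => p; rewrite mxE.
  by apply: measurableT_comp; [exact: measurable_fst|exact: measurable_fst].
- rewrite (_ : (fun p => _) = snd \o fst); last by apply/funext => p; rewrite mxE.
  by apply: measurableT_comp; [exact: measurable_snd|exact: measurable_fst].
- rewrite (_ : (fun p => _) = snd); last by apply/funext => p; rewrite mxE.
  exact: measurable_snd.
Qed.

Definition aff (c : R) (a : 'I_3 -> R) (x : 'rV[R]_3) : R := c + \sum_k x 0 k * a k.

Lemma measurable_aff c a D : measurable_fun D (aff c a \o @vec3 R).
Proof.
apply: (@measurable_funS _ _ _ _ setT) => //.
apply: measurable_funD => //.
apply: measurable_sum => k; apply: measurable_funM => //.
exact: measurable_vec3_coord.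
Qed.

Lemma measurable_aff_eq0 c a : measurable (@vec3 R @^-1` [set x | aff c a x = 0]).
Proof.
have := measurable_aff c a (D := setT) => /(_ measurableT [set 0]); rewrite setTI; apply.
exact: measurable_set1.
Qed.

Lemma measurable_aff_gt0 c a : measurable (@vec3 R @^-1` [set x | 0 < aff c a x]).
Proof.
have := measurable_aff c a (D := setT) => /(_ measurableT `]0, +oo[%classic).
rewrite setTI => h.
rewrite (_ : _ @^-1` _ = (aff c a \o @vec3 R) @^-1` `]0, +oo[%classic); first exact: h.
by apply/seteqP; split => p /=; rewrite in_itv /= andbT.
Qed.

Lemma lebesgue_null_sub1 (A : set R) (x0 : R) : A `<=` [set x0] ->
  lebesgue_measure A = 0%E.
Proof.
move=> sA; have [/eqP->|/set0P[y Ay]] := boolP (A == set0); first by rewrite measure0.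
have -> : A = [set x0].
  by apply/seteqP; split => // x ->; have <- := sA _ Ay.
exact: lebesgue_measure_set1.
Qed.

(** By Fubini, as the sections of a line are points. When the line is vertical
    it is a product with a null factor instead. *)
Lemma line_null (c a0 a1 : R) : (a0 != 0) || (a1 != 0) ->
  leb2m [set q | c + q.1 * a0 + q.2 * a1 = 0] = 0%E.
Proof.
have [->|a1n0 _] := eqVneq a1 0.
  rewrite orbF => a0n0.
  have -> : [set q : R * R | c + q.1 * a0 + q.2 * 0 = 0] = [set - c / a0] `*` setT.
    apply/seteqP; split => q /=.
      move=> e; split => //; apply: (mulIf a0n0); rewrite divfK //; lra.
    by move=> [-> _]; rewrite divfK //; lra.
  rewrite [LHS]product_measure1E //; first by rewrite [X in (X * _)%E]lebesgue_measure_set1 mul0e.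
rewrite /leb2m /= /product_measure1; apply: integral0_eq => x _ /=.
apply: (@lebesgue_null_sub1 _ ((- c - x * a0) / a1)) => y.
rewrite /xsection /= inE /= => e; apply: (mulIf a1n0); rewrite divfK //; lra.
Qed.

(** By Fubini, as the sections along the last axis are points, unless the plane
    is parallel to that axis; it is then a cylinder over a line. *)
Lemma plane_null c a : (exists k, a k != 0) ->
  leb3m (@vec3 R @^-1` [set x | aff c a x = 0]) = 0%E.
Proof.
pose i0 : 'I_3 := ord0; pose i1 : 'I_3 := Ordinal (isT : (1 < 3)%N).
pose i2 : 'I_3 := Ordinal (isT : (2 < 3)%N).
have affE p : aff c a (vec3 p) = c + p.1.1 * a i0 + p.1.2 * a i1 + p.2 * a i2.
  rewrite /aff !big_ord_recl big_ord0 !mxE /= addr0 !addrA.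
  by congr (_ + _ * a _ + _ * a _ + _ * a _); apply/val_inj.
move=> ak.
have [a20|a2n0] := eqVneq (a i2) 0; last first.
  rewrite /leb3m /= /product_measure1; apply: (@integral0_eq _ _ _ leb2m) => x _ /=.
  apply: (@lebesgue_null_sub1 _ ((- c - x.1 * a i0 - x.2 * a i1) / a i2)) => y.
  rewrite /xsection /= inE /= affE /= => e.
  by apply: (mulIf a2n0); rewrite divfK //; lra.
have a01 : (a i0 != 0) || (a i1 != 0).
  case: ak => -[[|[|[|//]]] k3] h.
  - by rewrite (_ : i0 = Ordinal k3) ?h //; apply/val_inj.
  - by rewrite (_ : i1 = Ordinal k3) ?h ?orbT //; apply/val_inj.
  - have e : Ordinal k3 = i2 by apply/val_inj.
    by rewrite e a20 eqxx in h.
have -> : @vec3 R @^-1` [set x | aff c a x = 0] =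
    [set q | c + q.1 * a i0 + q.2 * a i1 = 0] `*` setT.
  apply/seteqP; split => p /=; rewrite affE a20 mulr0 addr0 //.
  by case.
rewrite [LHS]product_measure1E //.
  by rewrite [X in (X * _)%E]line_null // mul0e.
have m1 : measurable_fun setT (fun q : R * R => c + q.1 * a i0 + q.2 * a i1).
  apply: measurable_funD; first apply: measurable_funD => //.
    by apply: measurable_funM => //; exact: measurable_fst.
  by apply: measurable_funM => //; exact: measurable_snd.
by have := m1 measurableT [set 0] (measurable_set1 _); rewrite setTI.
Qed.

Definition box (lo : 'rV[R]_3) (s : R) : set 'rV[R]_3 :=
  [set x | forall k, lo 0 k < x 0 k < lo 0 k + s].

Lemma vec3_boxE lo s : @vec3 R @^-1` box lo s =
  (`]lo 0 ord0, lo 0 ord0 + s[ `*` `]lo 0 1%:R, lo 0 1%:R + s[) `*`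
   `]lo 0 2%:R, lo 0 2%:R + s[.
Proof.
apply/seteqP; split => p /=.
  move=> h; have := h ord0; have := h 1%:R; have := h 2%:R; rewrite !mxE /= !in_itv /=.
  by move=> -> -> ->.
rewrite !in_itv /= => -[[h0 h1] h2] k; rewrite mxE.
case: k => -[|[|[|//]]] k3 /=.
- by rewrite (_ : Ordinal k3 = ord0) //; apply/val_inj.
- by rewrite (_ : Ordinal k3 = 1%:R) //; apply/val_inj.
- by rewrite (_ : Ordinal k3 = 2%:R) //; apply/val_inj.
Qed.

Lemma measurable_box lo s : measurable (@vec3 R @^-1` box lo s).
Proof. by rewrite vec3_boxE; do 2 apply: measurableX => //. Qed.

Lemma leb3_box lo s : 0 < s -> leb3m (@vec3 R @^-1` box lo s) = (s ^+ 3)%:E.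
Proof.
move=> s0; have itv b : lebesgue_measure `]b, b + s[%classic = s%:E :> \bar R.
  by rewrite lebesgue_measure_itv /= lte_fin ltrDl s0 -EFinB addrAC subrr add0r.
have -> : (s ^+ 3)%:E = (s%:E * s%:E * s%:E)%E.
  by rewrite -!EFinM !exprS expr0 mulr1 mulrA.
rewrite vec3_boxE [LHS]product_measure1E //; last exact: measurableX.
congr (_ * _)%E; last exact: itv.
by rewrite [LHS]product_measure1E //; congr (_ * _)%E; exact: itv.
Qed.

End Leb3.

Lemma null_bigcup_fin d (T : measurableType d) (R : realType)
    (mu : {measure set T -> \bar R}) (I : finType) (F : I -> set T) :
  (forall i, measurable (F i)) -> (forall i, mu (F i) = 0%E) ->
  measurable (\bigcup_i F i) /\ mu (\bigcup_i F i) = 0%E.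
Proof.
move=> mF F0.
have -> : \bigcup_i F i = \big[setU/set0]_(i <- enum I) F i.
  rewrite -bigcup_seq; congr (\bigcup_(i in _) _).
  by apply/seteqP; split => i //= _; rewrite mem_enum.
apply: (big_ind (fun A => measurable A /\ mu A = 0%E)) => //.
- move=> A B [A1 A2] [B1 B2]; split; first exact: measurableU.
  exact: null_set_setU.
Qed.

(** * Barycentric coordinates of a simplex *)

Section Simplex.
Variable R : realType.
Implicit Types (x y : 'rV[R]_3) (c : R) (a : 'I_3 -> R).

Lemma aff_cont c a : continuous (aff c a : 'rV[R]_3 -> R^o).
Proof.
move=> x; apply: (@continuousD R R^o _ (fun=> c) (fun x => \sum_k x 0 k * a k)).
  exact: cst_continuous.
move: x; apply: continuous_sumR => k x.
apply: (@continuousM R _ (fun x => x 0 k) (fun=> a k)).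
  exact: coord_continuous.
exact: cst_continuous.
Qed.

Lemma affD c a x y : aff c a (x + y) = aff c a x + \sum_k y 0 k * a k.
Proof.
rewrite /aff -addrA -big_split; congr (_ + _).
by apply: eq_bigr => k _; rewrite mxE mulrDl.
Qed.

Lemma aff_delta c a x (e : R) k : aff c a (x + e *: delta_mx 0 k) = aff c a x + e * a k.
Proof.
rewrite affD (bigD1 k) //= big1 ?addr0 ?mxE ?eqxx ?mulr1 // => j jk.
by rewrite !mxE (negbTE jk) andbF mulr0 mul0r.
Qed.

Lemma interior_aff (A : set 'rV[R]_3) x k : interior A x ->
  exists2 e : R, 0 < e & forall s, `|s| <= e -> A (x + s *: delta_mx 0 k).
Proof.
move=> /nbhs_ballP[e /= e0 he].
exists (e / 2); first by rewrite divr_gt0.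
move=> s se; apply: he; rewrite -ball_normE /= opprD addrA subrr sub0r normrN normrZ.
apply: (@le_lt_trans _ _ (`|s| * 1)).
  rewrite ler_wpM2l //; apply: rV_norm_le => // j; rewrite mxE eqxx /=.
  by case: eqP => _; rewrite ?normr1 ?normr0.
by rewrite mulr1; apply: le_lt_trans se _; rewrite ltr_pdivrMr // ltr_pMr // ltr1n.
Qed.

Variable v : 'I_4 -> 'rV[R]_3.
Let T := vhull v [set: 'I_4].
Hypothesis T_ndg : interior T !=set0.

(** Homogeneous coordinates (1, x): convex combinations of the vertices become
    the products w *m vmat, with the condition on the sum of the weights as
    first coordinate. *)
Definition homog x : 'rV[R]_(1 + 3) := row_mx 1%:M x.
Definition vmat : 'M[R]_(4, 1 + 3) := \matrix_i homog (v i).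

Lemma vmatE i : row i vmat = homog (v i). Proof. exact: rowK. Qed.

Lemma vhullP x : T x <-> exists w : 'rV[R]_4,
  (forall i, 0 <= w 0 i) /\ homog x = w *m vmat.
Proof.
have mulE (w : 'rV[R]_4) : w *m vmat =
    row_mx (\sum_i w 0 i)%:M (\sum_i w 0 i *: v i).
  rewrite mulmx_sum_row; apply/rowP => j; rewrite summxE.
  case: (splitP j) => k jk.
    have -> : j = lshift 3 k by apply/val_inj.
    rewrite row_mxEl; rewrite mxE ord1 eqxx mulr1n.
    by apply: eq_bigr => i _; rewrite vmatE mxE row_mxEl mxE eqxx mulr1.
  have -> : j = rshift 1 k by apply/val_inj.
  rewrite row_mxEr summxE; apply: eq_bigr => i _.
  by rewrite vmatE mxE row_mxEr mxE.
split => [[w [w0 _ w1 ->]]|[w [w0 e]]].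
  exists (\row_i w i); split => [i|]; first by rewrite mxE.
  rewrite mulE /homog; congr (row_mx (_%:M) _).
    by rewrite -w1; apply: eq_bigr => i _; rewrite mxE.
  by apply: eq_bigr => i _; rewrite mxE.
move: e; rewrite mulE => /eq_row_mx[e1 e2].
exists (fun i => w 0 i); split => //.
  by move=> i; rewrite inE.
by move/matrixP: e1 => /(_ 0 0); rewrite !mxE.
Qed.

(** A vector in the kernel is an affine function that vanishes at the vertices,
    hence on the simplex, which has interior points; its coefficients are
    therefore zero. *)
Lemma vmat_unit : vmat \in unitmx.
Proof.
rewrite unitmxE unitfE -det_tr; apply/negP => /det0P[u u0 uV].
have ker x : T x -> homog x *m u^T = 0.
  move=> /vhullP[w [_ ->]].
  by rewrite -mulmxA -[vmat]trmxK -trmx_mul uV trmx0 mulmx0.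
pose c := u 0 (lshift 3 (ord0 : 'I_1)); pose a k := u 0 (rshift 1 k).
have kerE x : T x -> aff c a x = 0.
  move=> /ker /matrixP/(_ 0 0); rewrite [X in X = _ -> _]mxE [X in _ = X -> _]mxE => <-.
  rewrite (big_split_ord _ (n := 3)) /= big_ord1 /homog row_mxEl !mxE eqxx mul1r.
  by congr (_ + _); apply: eq_bigr => k _; rewrite row_mxEr mxE.
case: T_ndg => x xi.
have ak k : a k = 0.
  have [e e0 he] := interior_aff k xi.
  have h1 : T (x + e *: delta_mx 0 k) by apply: he; rewrite ger0_norm // ltW.
  have h0 : T x by apply: interior_subset.
  have := kerE _ h1; rewrite aff_delta kerE // add0r => /eqP.
  by rewrite mulf_eq0 gt_eqF //= => /eqP.
have c0 : c = 0.
  have := kerE x (interior_subset xi); rewrite /aff big1 ?addr0 // => k _.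
  by rewrite ak mulr0.
case/negP: u0; apply/eqP/rowP => j; rewrite mxE.
case: (@splitP 1 3 j) => k jk.
  by have -> : j = lshift 3 (ord0 : 'I_1); [apply/val_inj => /=; rewrite jk ord1|exact: c0].
by have -> : j = rshift 1 k; [apply/val_inj|exact: ak].
Qed.

(** lam i is the barycentric coordinate of number i, read off the inverse
    matrix as an affine function. *)
Definition lam0 i : R := invmx vmat (lshift 3 (ord0 : 'I_1)) i.
Definition lamk i k : R := invmx vmat (rshift 1 k) i.
Definition lam i : 'rV[R]_3 -> R := aff (lam0 i) (lamk i).

Lemma lamE i x : lam i x = (homog x *m invmx vmat) 0 i.
Proof.
rewrite mxE (big_split_ord _ (n := 3)) /= big_ord1 /homog row_mxEl !mxE eqxx mul1r.
by congr (_ + _); apply: eq_bigr => k _; rewrite row_mxEr.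
Qed.

Lemma lam_vertex i j : lam i (v j) = (i == j)%:R.
Proof.
rewrite lamE -vmatE -row_mul mulmxV ?vmat_unit // !mxE.
by rewrite eq_sym.
Qed.

Lemma vhull_lam x : T x <-> forall i, 0 <= lam i x.
Proof.
rewrite vhullP; split => [[w [w0 e]] i|h].
  by rewrite lamE e mulmxK ?vmat_unit.
exists (homog x *m invmx vmat); split => [i|]; first by rewrite -lamE.
by rewrite mulmxKV // vmat_unit.
Qed.

Lemma lamk_neq0 i : exists k, lamk i k != 0.
Proof.
apply/not_existsP => h.
have h0 k : lamk i k = 0 by apply/eqP/negPn/negP; exact: h.
have cst x : lam i x = lam0 i by rewrite /lam /aff big1 ?addr0 // => k _; rewrite h0 mulr0.
have [j ji] : exists j : 'I_4, i != j.
  by case: (eqVneq i 0) => [->|i0]; [exists 1|exists 0].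
have := lam_vertex i i; have := lam_vertex i j.
rewrite !cst (negbTE ji) eqxx => -> /eqP; by rewrite eq_sym oner_eq0.
Qed.

(** lam i is affine and not constant, so it takes negative values near any
    point where it vanishes. *)
Lemma interior_vhull : interior T = [set x | forall i, 0 < lam i x].
Proof.
apply/seteqP; split => x /=; last first.
  have op : open [set x | forall i, 0 < lam i x].
    rewrite openE => y hy; apply: (@filter_forall _ _ (fun i x => is_true (0 < lam i x)) (nbhs y)) => i.
    have : open [set x | 0 < lam i x].
      apply: (@open_comp _ _ (lam i) [set z | 0 < z]); last exact: open_gt.
      by move=> z _; exact: aff_cont.
    by rewrite openE; apply; exact: hy.
  move=> h; have sub : [set x | forall i, 0 < lam i x] `<=` T.
    by move=> y hy; apply/vhull_lam => i; exact: ltW.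
  by move: sub; rewrite open_subsetE //; apply.
move=> xi i; have : 0 <= lam i x by apply: (vhull_lam x).1; exact: interior_subset.
rewrite le_eqVlt => /predU1P[e|//].
have [k ak] := lamk_neq0 i; have [s s0 hs] := interior_aff k xi.
pose s' := if 0 < lamk i k then - s else s.
have : T (x + s' *: delta_mx 0 k).
  by apply: hs; rewrite /s'; case: ifP => _; rewrite ?normrN ger0_norm // ltW.
move/vhull_lam/(_ i); rewrite /lam aff_delta -/(lam i x) -e add0r /s'.
case: ifP => [a0|/negbT].
  by rewrite mulNr oppr_ge0 pmulr_rle0 // leNgt a0.
rewrite -leNgt pmulr_rge0 // => a0 a1.
by case/negP: ak; rewrite eq_le a0 a1.
Qed.

Lemma vertex_in_vhull i : T (v i).
Proof. by apply/vhull_lam => j; rewrite lam_vertex ler0n. Qed.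

Lemma measurable_interior_vhull : measurable (@vec3 R @^-1` interior T).
Proof.
rewrite interior_vhull.
rewrite (_ : _ @^-1` _ = \bigcap_(i in [set: 'I_4]) @vec3 R @^-1` [set x | 0 < lam i x]).
  apply: fin_bigcap_measurable => [|i _]; first exact: finite_finset.
  exact: measurable_aff_gt0.
by apply/seteqP; split => [y h i _|y h i]; apply: h.
Qed.

(** At a boundary point some barycentric coordinate vanishes, so the boundary
    of the simplex is covered by four planes. *)
Lemma skeleton_null : exists N : set (R * R * R),
  [/\ measurable N, leb3m R N = 0%E & @vec3 R @^-1` (T `\` interior T) `<=` N].
Proof.
exists (\bigcup_i (@vec3 R @^-1` [set x | lam i x = 0])).
have [||h1 h2] := @null_bigcup_fin _ _ _ (leb3m R) 'I_4
    (fun i => @vec3 R @^-1` [set x | lam i x = 0]).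
  by move=> i; exact: measurable_aff_eq0.
  by move=> i; apply: plane_null; exact: lamk_neq0.
split => // p [/= Tp ip].
have [i] : exists i, lam i (vec3 p) = 0.
  apply/not_existsP => h; apply: ip; rewrite interior_vhull => i.
  rewrite lt_def; move/vhull_lam: Tp => /(_ i) ->; rewrite andbT.
  by apply/eqP; exact: h.
by move=> li; exists i.
Qed.

End Simplex.

(** * Integrals over a triangulated domain *)

Section Mesh.
Variables (R : realType) (Omega : set 'rV[R]_3) (Th : triangulation Omega).
Implicit Types (f g : 'rV[R]_3 -> R) (t : 'I_(nelem Th)).

Definition cell t : set 'rV[R]_3 := interior (elem t).
Definition cells : set 'rV[R]_3 := \bigcup_t cell t.

Lemma cell_sub_elem t x : cell t x -> elem t x.
Proof. exact: interior_subset. Qed.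

Lemma elem_sub_closure t x : elem t x -> closure Omega x.
Proof. by rewrite (elem_cover Th) => h; exists t. Qed.

Lemma cell_sub_Omega t x : cell t x -> Omega x.
Proof. exact: elem_in. Qed.

Lemma cells_sub_Omega x : cells x -> Omega x.
Proof. by case=> t _; exact: cell_sub_Omega. Qed.

Lemma cells_sub_closure x : cells x -> closure Omega x.
Proof. by move/cells_sub_Omega; exact: subset_closure. Qed.

Lemma measurable_cell t : measurable (@vec3 R @^-1` cell t).
Proof. exact: (measurable_interior_vhull (elem_nondegenerate t)). Qed.

Lemma measurable_cells : measurable (@vec3 R @^-1` cells).
Proof.
rewrite (_ : _ @^-1` _ = \bigcup_(t in [set: 'I_(nelem Th)]) @vec3 R @^-1` cell t).
  apply: fin_bigcup_measurable => [|t _]; first exact: finite_finset.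
  exact: measurable_cell.
by apply/seteqP; split => p [t _ h]; exists t.
Qed.

(** The elements cover the closure of Omega and their interiors are in Omega,
    so Omega and the union of the cells differ only inside the union of the
    boundaries of the elements. *)
Lemma cells_full : exists N : set (R * R * R),
  [/\ measurable N, leb3m R N = 0%E &
      (@vec3 R @^-1` Omega) `\` N = (@vec3 R @^-1` cells) `\` N].
Proof.
have [N hN] := choice (fun t => skeleton_null (elem_nondegenerate t)).
exists (\bigcup_t N t).
have [||h1 h2] := @null_bigcup_fin _ _ _ (leb3m R) 'I_(nelem Th) N.
- by move=> t; have [] := hN t.
- by move=> t; have [] := hN t.
split => //; apply/seteqP; split => p /= [h np]; split => //.
  have : closure Omega (vec3 p) by exact: subset_closure.
  rewrite (elem_cover Th) => -[t _ pt]; exists t => //; apply: contrapT => nt.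
  by apply: np; exists t => //; case: (hN t) => _ _ h3; apply: h3; split.
exact: cells_sub_Omega.
Qed.

Local Notation J := (integral3 Omega).

Lemma J_cells f : J f = Rintegral (leb3m R) (@vec3 R @^-1` cells) (f \o @vec3 R).
Proof.
have [N [mN N0 e]] := cells_full.
rewrite integral3E /Rintegral; congr fine.
exact: (@integral_eq_off_negligible _ _ _ (leb3m R) N mN N0 _ _ (fun p => ((f \o @vec3 R) p)%:E) e).
Qed.

Variable K : R.
Hypothesis K_gt0 : 0 < K.
Hypothesis K_bound : forall x k, closure Omega x -> `|x 0 k| <= K.

Lemma sub_big_box (S : set 'rV[R]_3) (x0 : 'rV[R]_3) (e : R) : 0 < e ->
  measurable (@vec3 R @^-1` S) ->
  (forall x k, S x -> `|x 0 k - x0 0 k| <= e) ->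
  (leb3m R (@vec3 R @^-1` S) <= ((4 * e) ^+ 3)%:E)%E.
Proof.
move=> e0 mS hS.
rewrite -(@leb3_box R (\row_k (x0 0 k - 2 * e))); last by rewrite mulr_gt0.
apply: le_measure; rewrite ?inE //; first exact: measurable_box.
by move=> p /= Sp k; have := hS _ k Sp; rewrite ler_norml mxE; lra.
Qed.

(** Bounded and measurable on the cells. This suffices for integrability, since
    Omega is bounded, and unlike integrability it is stable by products. *)
Definition good f := measurable_fun (@vec3 R @^-1` cells) (f \o @vec3 R) /\
  exists B, forall x, cells x -> `|f x| <= B.

Lemma cells_finite : (leb3m R (@vec3 R @^-1` cells) < +oo)%E.
Proof.
apply: le_lt_trans (sub_big_box (x0 := 0) K_gt0 measurable_cells _) _.
  by move=> x k /cells_sub_closure; rewrite mxE subr0; exact: K_bound.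
exact: ltry.
Qed.

Lemma good_integrable f : good f ->
  (leb3m R).-integrable (@vec3 R @^-1` cells) (EFin \o (f \o @vec3 R)).
Proof.
move=> [mf [B fB]]; apply: measurable_bounded_integrable => //.
- exact: measurable_cells.
- exact: cells_finite.
- exists B; split; first by rewrite num_real.
  by move=> x Bx p /= pc; apply: le_trans (fB _ pc) (ltW Bx).
Qed.

Lemma good_cst c : good (fun=> c).
Proof.
by split; [exact: measurable_cst|exists `|c|].
Qed.

Lemma goodD f g : good f -> good g -> good (fun x => f x + g x).
Proof.
move=> [mf [B fB]] [mg [B' gB]]; split; first exact: measurable_funD.
exists (B + B') => x cx; apply: le_trans (ler_normD _ _) _.
by rewrite lerD ?fB ?gB.
Qed.

Lemma goodM f g : good f -> good g -> good (fun x => f x * g x).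
Proof.
move=> [mf [B fB]] [mg [B' gB]]; split; first exact: measurable_funM.
by exists (B * B') => x cx; rewrite normrM ler_pM ?fB ?gB.
Qed.

Lemma goodZ c f : good f -> good (fun x => c * f x).
Proof. exact/goodM/good_cst. Qed.

Lemma good_norm f : good f -> good (fun x => `|f x|).
Proof.
move=> [mf [B fB]]; split; first exact: measurableT_comp.
by exists B => x cx; rewrite normr_id fB.
Qed.

Lemma good_eq f g : (forall x, cells x -> f x = g x) -> good f -> good g.
Proof.
move=> fg [mf [B fB]]; split; last by exists B => x cx; rewrite -fg ?fB.
apply: eq_measurable_fun mf => p; rewrite inE /= => cp; exact: fg.
Qed.

Lemma good_sum (I : Type) (s : seq I) (F : I -> 'rV[R]_3 -> R) :
  (forall i, good (F i)) -> good (fun x => \sum_(i <- s) F i x).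
Proof.
move=> hF; elim: s => [|i s IH].
  by apply: good_eq (good_cst 0) => x _; rewrite big_nil.
by apply: good_eq (goodD (hF i) IH) => x _; rewrite big_cons.
Qed.

Lemma good_exp f n : good f -> good (fun x => f x ^+ n).
Proof.
move=> gf; elim: n => [|n IH].
  by apply: good_eq (good_cst 1) => x _; rewrite expr0.
by apply: good_eq (goodM gf IH) => x _; rewrite exprS.
Qed.

Lemma good_indic (S : set 'rV[R]_3) : measurable (@vec3 R @^-1` S) ->
  good (\1_S).
Proof.
move=> mS; split.
  rewrite (_ : \1_S \o @vec3 R = \1_(@vec3 R @^-1` S)); first exact: measurable_indic.
  by apply/funext => p; rewrite /= !indicE; congr (_%:R); rewrite !in_setE.
by exists 1 => x _; rewrite indicE; case: (_ \in _); rewrite ?normr1 ?normr0.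
Qed.

Lemma good_piecewise f : (forall t, exists c a, forall x, cell t x -> f x = aff c a x) ->
  good f.
Proof.
move=> fa; split.
  move=> _ Y mY.
  rewrite (_ : _ `&` _ = \bigcup_(t in [set: 'I_(nelem Th)])
     (@vec3 R @^-1` cell t `&` (f \o @vec3 R) @^-1` Y)).
    apply: fin_bigcup_measurable => [|t _]; first exact: finite_finset.
    have [c [a e]] := fa t.
    have m : measurable_fun (@vec3 R @^-1` cell t) (f \o @vec3 R).
      apply: (eq_measurable_fun (aff c a \o @vec3 R)); last exact: measurable_aff.
      by move=> p; rewrite inE /= => /e ->.
    by apply: m => //; exact: measurable_cell.
  by apply/seteqP; split => p /= => [[[t _ pt] py]|[t _ [pt py]]];
    [exists t|split => //; exists t].
have h t : exists B, forall x, cell t x -> `|f x| <= B.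
  have [c [a e]] := fa t; exists (`|c| + \sum_k K * `|a k|) => x xt.
  rewrite e // /aff; apply: le_trans (ler_normD _ _) _; rewrite lerD2l.
  apply: le_trans (ler_norm_sum _ _ _) _; apply: ler_sum => k _.
  rewrite normrM ler_wpM2r // K_bound //.
  by apply: elem_sub_closure (cell_sub_elem xt).
have [B hB] := choice h; exists (\sum_t `|B t|) => x [t _ xt].
apply: le_trans (hB t x xt) _; apply: le_trans (ler_norm _) _.
by rewrite (bigD1 t) //= lerDl sumr_ge0.
Qed.

Lemma JD f g : good f -> good g -> J (fun x => f x + g x) = J f + J g.
Proof.
move=> gf gg; rewrite !J_cells.
by rewrite -RintegralD //; [exact: measurable_cells|exact: good_integrable|
  exact: good_integrable].
Qed.

Lemma JZ c f : good f -> J (fun x => c * f x) = c * J f.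
Proof.
move=> gf; rewrite !J_cells -RintegralZl //; first exact: measurable_cells.
exact: good_integrable.
Qed.

Lemma J_eq f g : (forall x, cells x -> f x = g x) -> J f = J g.
Proof.
move=> fg; rewrite !J_cells; apply: eq_Rintegral => p; rewrite inE /=.
exact: fg.
Qed.

Lemma J_le f g : good f -> good g -> (forall x, cells x -> f x <= g x) -> J f <= J g.
Proof.
move=> gf gg fg; rewrite !J_cells; apply: le_Rintegral.
- exact: measurable_cells.
- exact: good_integrable.
- exact: good_integrable.
- by move=> p; exact: fg.
Qed.

Lemma J0 : J (fun=> 0) = 0.
Proof.
rewrite (_ : (fun=> 0) = (fun x : 'rV[R]_3 => 0 * 0)); last by apply/funext => x; rewrite mul0r.
by rewrite JZ ?mul0r //; exact: good_cst.
Qed.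

Lemma J_ge0 f : good f -> (forall x, cells x -> 0 <= f x) -> 0 <= J f.
Proof. by move=> gf f0; rewrite -J0; apply: J_le => //; exact: good_cst. Qed.

Lemma J_sum (I : Type) (s : seq I) (F : I -> 'rV[R]_3 -> R) :
  (forall i, good (F i)) -> J (fun x => \sum_(i <- s) F i x) = \sum_(i <- s) J (F i).
Proof.
move=> gF; elim: s => [|i s IH].
  by rewrite big_nil -[RHS]J0; apply: J_eq => x _; rewrite big_nil.
rewrite big_cons -IH -JD //; last exact: good_sum.
by apply: J_eq => x _; rewrite big_cons.
Qed.

Lemma J_norm f : good f -> `|J f| <= J (fun x => `|f x|).
Proof.
move=> gf; have gN := good_norm gf; rewrite ler_norml; apply/andP; split.
  rewrite lerNl -mulN1r -JZ //; apply: J_le => //; first exact: goodZ.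
  by move=> x _; rewrite mulN1r -normrN ler_norm.
by apply: J_le => // x _; exact: ler_norm.
Qed.

Lemma J_indic (S : set 'rV[R]_3) : measurable (@vec3 R @^-1` S) -> S `<=` cells ->
  J (\1_S) = fine (leb3m R (@vec3 R @^-1` S)).
Proof.
move=> mS Sc; rewrite J_cells /Rintegral.
rewrite (_ : (fun x => _) = (fun p => (\1_(@vec3 R @^-1` S) p)%:E)); last first.
  by apply/funext => p /=; rewrite !indicE; congr ((_%:R)%:E); rewrite !in_setE.
rewrite integral_indic //; last exact: measurable_cells.
by rewrite setIidl // => p /=; exact: Sc.
Qed.

Lemma J_cell_le t (x0 : 'rV[R]_3) (e : R) : 0 < e ->
  (forall x k, cell t x -> `|x 0 k - x0 0 k| <= e) ->
  J (\1_(cell t)) <= (4 * e) ^+ 3.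
Proof.
move=> e0 he; rewrite J_indic; last 2 first.
- exact: measurable_cell.
- by move=> x xt; exists t.
have := sub_big_box e0 (measurable_cell t) he.
by move=> /fine_le -> //; rewrite ge0_fin_numE // (le_lt_trans _ (ltry ((4 * e) ^+ 3)))
  // ?sub_big_box //; exact: sub_big_box (measurable_cell t) he.
Qed.

(** Markov's inequality on a cube, whose volume is known exactly. *)
Lemma J_box (lo : 'rV[R]_3) (s : R) f (m : R) : 0 < s -> box lo s `<=` cells ->
  good f -> (forall x, cells x -> 0 <= f x) -> (forall x, box lo s x -> m <= f x) ->
  s ^+ 3 * m <= J f.
Proof.
move=> s0 bc gf f0 fm.
have -> : s ^+ 3 * m = J (fun x => m * \1_(box lo s) x).
  rewrite JZ; last by apply: good_indic; exact: measurable_box.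
  rewrite J_indic ?leb3_box //=; first by rewrite mulrC.
  exact: measurable_box.
apply: J_le => //; first by apply: goodZ; apply: good_indic; exact: measurable_box.
move=> x cx; rewrite indicE; have [|] := boolP (x \in _).
  by rewrite in_setE mulr1; exact: fm.
by rewrite mulr0 => _; exact: f0.
Qed.

Lemma sum_indic_cells x : cells x -> \sum_t \1_(cell t) x = 1 :> R.
Proof.
case=> t _ xt; rewrite (bigD1 t) //= big1 ?addr0.
  by rewrite indicE mem_set.
move=> t' t't; rewrite indicE memNset // => xt'.
have := elem_disjoint t't => /seteqP[h _]; exact: (h x).
Qed.

Lemma J_split f : good f -> J f = \sum_t J (fun x => \1_(cell t) x * f x).
Proof.
move=> gf; rewrite -J_sum; last first.
  by move=> t; apply: goodM => //; apply: good_indic; exact: measurable_cell.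
by apply: J_eq => x cx; rewrite -mulr_suml sum_indic_cells // mul1r.
Qed.

End Mesh.

Arguments JD {R Omega} Th {K} _ _ [f g] _ _.
Arguments JZ {R Omega} Th {K} _ _ c [f] _.
Arguments J_sum {R Omega} Th {K} _ _ [I] s [F] _.
Arguments J_eq {R Omega} Th [f g] _.

(** * The inverse inequality for affine functions *)

Section Enorm.
Variable R : realType.

Lemma coord_le_enorm (x : 'rV[R]_3) k : `|x 0 k| <= enorm x.
Proof.
rewrite -sqrtr_sqr; apply: ler_wsqrtr; rewrite (bigD1 k) //= lerDl.
by apply: sumr_ge0 => j _; exact: sqr_ge0.
Qed.

(** The crude factor 2 stands for the square root of 3. *)
Lemma enorm_le (x : 'rV[R]_3) (e : R) : 0 <= e ->
  (forall k, `|x 0 k| <= e / 2) -> enorm x <= e.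
Proof.
move=> e0 h; rewrite -(ger0_norm e0) -sqrtr_sqr; apply: ler_wsqrtr.
apply: (@le_trans _ _ (\sum_(k < 3) (e / 2) ^+ 2)).
  by apply: ler_sum => k _; rewrite -[leLHS]real_normK ?num_real // ler_sqr ?nnegrE //
    divr_ge0.
rewrite sumr_const card_ord -[leLHS]mulr_natl; have := sqr_ge0 e; nra.
Qed.

End Enorm.

Section Deriv.
Variable R : realType.

(** Near an interior point the difference quotients are constant. *)
Lemma derive_delta_aff (f : 'rV[R]_3 -> R) (A : set 'rV[R]_3) c a k x :
  (forall y, A y -> f y = aff c a y) -> interior A x ->
  'D_(delta_mx 0 k) f x = a k.
Proof.
move=> fa xi; have [e e0 he] := interior_aff k xi.
apply: cvg_lim => //.
apply: (@cvg_trans _ ((fun=> a k) @ 0^')); last exact: cvg_cst.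
apply: near_eq_cvg; near=> s => /=.
have s0 : s != 0 by near: s; exact: nbhs_dnbhs_neq.
have se : `|s| <= e.
  near: s; exact: dnbhs0_le.
have Ax : A x by exact: interior_subset.
rewrite [_ + x]addrC fa; last exact: he.
rewrite fa // aff_delta addrC addKr.
by rewrite /GRing.scale /= mulKf.
Unshelve. all: by end_near. Qed.

End Deriv.

Section Inverse.
Variables (R : realType) (Omega : set 'rV[R]_3) (Th : triangulation Omega).
Implicit Types (t : 'I_(nelem Th)).
Variable K : R.
Hypothesis K_gt0 : 0 < K.
Hypothesis K_bound : forall x k, closure Omega x -> `|x 0 k| <= K.

Lemma dist_le x y : closure Omega x -> closure Omega y -> enorm (x - y) <= 4 * K.
Proof.
move=> xO yO; apply: enorm_le => [|k]; first by rewrite mulr_ge0 // ltW.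
rewrite !mxE; have := K_bound k xO; have := K_bound k yO.
by rewrite !ler_norml; lra.
Qed.

Lemma dist_le_diam t x y : elem t x -> elem t y -> enorm (x - y) <= diam (elem t).
Proof.
move=> xt yt; apply: ub_le_sup; last by exists x, y.
exists (4 * K) => _ [x' [y' [x't y't ->]]].
by apply: dist_le; [exact: elem_sub_closure x't|exact: elem_sub_closure y't].
Qed.

Lemma dist_le_meshsize t x y : elem t x -> elem t y -> enorm (x - y) <= meshsize Th.
Proof.
move=> xt yt; apply: le_trans (dist_le_diam xt yt) _.
exact: (le_bigmax _ (fun t => diam (elem t))).
Qed.

Lemma meshsize_le : meshsize Th <= 4 * K.
Proof.
apply: bigmax_le => [|t _]; first by rewrite mulr_ge0 // ltW.
apply: ge_sup.
  have [x /interior_subset xt] := elem_nondegenerate t.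
  by exists (enorm (x - x)), x, x.
by move=> _ [x' [y' [x't y't ->]]]; apply: dist_le; [exact: elem_sub_closure x't|exact: elem_sub_closure y't].
Qed.

Lemma meshsize_gt0 : Omega !=set0 -> 0 < meshsize Th.
Proof.
case=> z /subset_closure; rewrite (elem_cover Th) => -[t _ _].
have [x xi] := elem_nondegenerate t.
have [e e0 he] := interior_aff ord0 xi.
have x1 : elem t (x + e *: delta_mx 0 ord0) by apply: he; rewrite ger0_norm // ltW.
have x0 : elem t x by exact: interior_subset.
apply: lt_le_trans (dist_le_meshsize x1 x0).
apply: lt_le_trans (coord_le_enorm _ ord0).
by rewrite !mxE !eqxx mulr1 [_ + e]addrC addrK normr_gt0 gt_eqF.
Qed.

Variable sigma : R.
Hypothesis sigma_gt0 : 0 < sigma.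
Hypothesis balls : forall t, exists x r, sigma * meshsize Th <= r /\
      [set y | enorm (y - x) <= r] `<=` elem t.
Hypothesis Omega_neq0 : Omega !=set0.

Local Notation h := (meshsize Th).

(** The element contains a ball of radius sigma * h. From its centre x0 one
    moves along each axis in the direction in which the absolute value of the
    function grows: on the cube of points at distance between s / 2 and s in
    these directions, the function is at least m = |f(x0)| + s / 2 * sum |a k|
    in absolute value. The same m bounds the values on the element and the
    gradient, as the diameter of the element is at most h. *)
Lemma inverse_affine t c a : exists m, [/\ 0 <= m,
  (sigma * h / 4) ^+ 3 * m ^+ 2 <= integral3 Omega (fun x => \1_(cell t) x * aff c a x ^+ 2),
  forall x, elem t x -> `|aff c a x| <= (1 + 4 / sigma) * m &
  forall k, h * `|a k| <= 4 / sigma * m].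
Proof.
have h_gt0 := meshsize_gt0 Omega_neq0; have [x0 [r [hr br]]] := balls t.
pose s := sigma * h / 2.
have s0 : 0 < s by rewrite divr_gt0 // mulr_gt0.
have s20 : 0 < s / 2 by rewrite divr_gt0.
pose f0 := aff c a x0; pose m := `|f0| + s / 2 * \sum_k `|a k|.
have sum0 : 0 <= \sum_k `|a k| by apply: sumr_ge0.
have m0 : 0 <= m by rewrite addr_ge0 // mulr_ge0 // ltW.
pose sg : R := if 0 <= f0 then 1 else -1.
have sgf : sg * f0 = `|f0|.
  by rewrite /sg; have [f0p|f0n] := leP 0 f0; [rewrite mul1r ger0_norm|rewrite mulN1r ltr0_norm].
have sg1 u : `|sg * u| = `|u|.
  by rewrite normrM /sg; case: ifP => _; rewrite ?normrN normr1 mul1r.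
have x0t : elem t x0.
  apply: br => /=; rewrite subrr; apply: enorm_le.
    by apply: le_trans hr; rewrite mulr_ge0 // ltW.
  by move=> k; rewrite mxE normr0 divr_ge0 //; apply: le_trans hr; rewrite mulr_ge0 // ltW.
(* along the axis k the cube lies on the side where sg * f increases *)
pose lo : 'rV[R]_3 := \row_k (x0 0 k + if 0 <= sg * a k then s / 2 else - s).
have inbox x k : box lo (s / 2) x -> `|x 0 k - x0 0 k| < s /\
    s / 2 * `|a k| <= sg * ((x 0 k - x0 0 k) * a k).
  have -> : sg * ((x 0 k - x0 0 k) * a k) = (x 0 k - x0 0 k) * (sg * a k) by ring.
  move=> /(_ k); rewrite mxE -(sg1 (a k)).
  have [ak|ak] := leP 0 (sg * a k) => bx.
    rewrite (ger0_norm ak); split; first by rewrite ltr_norml; lra.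
    by apply: ler_wpM2r => //; lra.
  rewrite (ltr0_norm ak); split; first by rewrite ltr_norml; lra.
  have : 0 <= (- (sg * a k)) * (x0 0 k - s / 2 - x 0 k).
    by apply: mulr_ge0; lra.
  lra.
have boxt : box lo (s / 2) `<=` cell t.
  rewrite /cell -open_subsetE.
    move=> x bx; apply: br => /=; apply: le_trans hr; apply: enorm_le => [|k].
      by rewrite mulr_ge0 // ltW.
    by rewrite !mxE ltW //; have [] := inbox x k bx.
  rewrite openE => x bx.
  apply: (@filter_forall _ _ (fun k x => is_true (lo 0 k < x 0 k < lo 0 k + s / 2)) (nbhs x)) => k.
  have : open [set y : 'rV[R]_3 | lo 0 k < y 0 k < lo 0 k + s / 2].
    apply: (@open_comp _ _ (fun y : 'rV[R]_3 => y 0 k) [set z | lo 0 k < z < lo 0 k + s / 2]).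
      by move=> y _; exact: coord_continuous.
    rewrite (_ : [set z | _] = `]lo 0 k, lo 0 k + s / 2[%classic); first exact: itv_open.
    by apply/seteqP; split => z /=; rewrite in_itv.
  by rewrite openE; apply; exact: bx.
have mle x : box lo (s / 2) x -> m <= `|aff c a x|.
  move=> bx; rewrite -sg1; apply: le_trans (ler_norm _).
  have -> : x = x0 + (x - x0) by rewrite addrC subrK.
  rewrite affD mulrDr sgf /m lerD2l mulr_sumr mulr_sumr; apply: ler_sum => k _.
  by rewrite !mxE; have [] := inbox x k bx.
have gf : good Th (fun x => \1_(cell t) x * aff c a x ^+ 2).
  apply: goodM; first by apply: good_indic; exact: measurable_cell.
  by apply: good_exp; apply: (good_piecewise K_bound) => t'; exists c, a.
have ak k : `|a k| <= 2 / s * m.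
  have : s / 2 * `|a k| <= m.
    rewrite /m (bigD1 k) //= mulrDr addrCA lerDl addr_ge0 //.
    by apply: mulr_ge0; [exact: ltW|exact: sumr_ge0].
  by rewrite -ler_pdivlMl // invf_div.
have s2E : 2 / s = 4 / sigma / h.
  by rewrite /s; field; rewrite !gt_eqF.
exists m; split => //.
- have -> : sigma * h / 4 = s / 2 by rewrite /s; field.
  have boxc : box lo (s / 2) `<=` cells Th by move=> x bx; exists t => //; exact: boxt.
  apply: (J_box K_gt0 K_bound s20 boxc gf).
  + by move=> x _; rewrite mulr_ge0 ?sqr_ge0 // indicE.
  + move=> x bx; rewrite indicE mem_set ?mul1r; last exact: boxt.
    by rewrite -[leRHS]real_normK ?num_real // ler_sqr ?nnegrE // mle.
- move=> x xt; have -> : x = x0 + (x - x0) by rewrite addrC subrK.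
  rewrite affD mulrDl mul1r; apply: le_trans (ler_normD _ _) _.
  apply: lerD; first by rewrite /m lerDl mulr_ge0 // ltW.
  have dk k : `|x 0 k - x0 0 k| <= h.
    apply: le_trans (dist_le_meshsize xt x0t); apply: le_trans (coord_le_enorm _ k).
    by rewrite !mxE.
  apply: (@le_trans _ _ (h * \sum_k `|a k|)).
    rewrite mulr_sumr; apply: le_trans (ler_norm_sum _ _ _) _.
    by apply: ler_sum => k _; rewrite !mxE normrM ler_wpM2r.
  have : s / 2 * \sum_k `|a k| <= m by rewrite /m lerDr.
  rewrite -ler_pdivlMl // invf_div s2E => /(ler_wpM2l (ltW h_gt0)) /le_trans; apply.
  by rewrite le_eqVlt; apply/orP; left; apply/eqP; field; rewrite !gt_eqF.
- move=> k; apply: le_trans (ler_wpM2l (ltW h_gt0) (ak k)) _.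
  by rewrite s2E le_eqVlt; apply/orP; left; apply/eqP; field; rewrite !gt_eqF.
Qed.

End Inverse.

(** * Densities of the discrete gradient and of the energy *)

Section Jets.
Variables (R : realType) (p : params R).
Local Notation M3 := 'M[R]_3.

(** The value of a field and its gradient at one point. The densities are
    polynomials in these 36 numbers, which separates their algebra from
    questions of differentiability. *)
Definition jet := (M3 * ('I_3 -> M3))%type.

Definition jet_of (A : tensor_field R) (x : 'rV[R]_3) : jet := (A x, grad A x).

Definition jdiv (j : jet) : 'cV[R]_3 := \col_i \sum_k j.2 k i k.
Definition jcurl (j : jet) : M3 :=
  \matrix_(i, l) (j.2 (ordS i) l (ordS (ordS i)) - j.2 (ordS (ordS i)) l (ordS i)).

Lemma div_jet A x : div A x = jdiv (jet_of A x).
Proof. by apply/colP => i; rewrite !mxE; apply: eq_bigr => k _; rewrite mxE. Qed.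

Lemma curl_jet A x : curl A x = jcurl (jet_of A x).
Proof. by apply/matrixP => i l; rewrite !mxE. Qed.

Definition jlin (c : R) (j1 j2 : jet) : jet :=
  (c *: j1.1 + j2.1, fun k => c *: j1.2 k + j2.2 k).

(** The pattern shared by the four terms with coefficients L1 to L4: S is S1 or
    S2, eps is the sign of Q in S, and D is the divergence or the curl. *)
Definition el_dens n (S : M3 -> M3) (eps : R) (D : jet -> 'M[R]_(3, n))
    (j' j f : jet) : R :=
  frob (mid (S j'.1 *m D j') (S j.1 *m D j))
       (mid (S j'.1) (S j.1) *m D f + eps *: (f.1 *m mid (D j') (D j))).

Definition h5a (j' j f : jet) : R :=
  frob ((mid (graddot j'.2 j'.2) (graddot j.2 j.2) : R) *: mid j'.1 j.1) f.1.
Definition h5b (j' j f : jet) : R :=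
  graddot (fun k => (mid (frob j'.1 j'.1) (frob j.1 j.1) : R) *: mid (j'.2 k) (j.2 k)) f.2.
Definition h6 (j' j f : jet) : R :=
  frob ((2 * a p) *: mid j'.1 j.1
         - (2 * b p / 3) *: (2 *: mid (j'.1 *m j'.1) (j.1 *m j.1) + j'.1 *m j.1)
         + (2 * c p * (mid (\tr (j'.1 *m j'.1)) (\tr (j.1 *m j.1)) : R))
           *: mid j'.1 j.1) f.1.

Definition h_dens (j' j f : jet) : R :=
  L1 p * el_dens (S1 p) 1 jdiv j' j f + L2 p * el_dens (S1 p) 1 jcurl j' j f
  + L3 p * el_dens (S2 p) (-1) jdiv j' j f + L4 p * el_dens (S2 p) (-1) jcurl j' j f
  + L5 p * (h5a j' j f + h5b j' j f) + h6 j' j f.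

Definition bulk (A : M3) : R :=
  a p * \tr (A *m A) - 2 * b p / 3 * \tr (A *m A *m A) + c p / 2 * \tr (A *m A) ^+ 2.

Definition e_dens (j : jet) : R :=
  L1 p / 2 * frob (S1 p j.1 *m jdiv j) (S1 p j.1 *m jdiv j)
  + L2 p / 2 * frob (S1 p j.1 *m jcurl j) (S1 p j.1 *m jcurl j)
  + L3 p / 2 * frob (S2 p j.1 *m jdiv j) (S2 p j.1 *m jdiv j)
  + L4 p / 2 * frob (S2 p j.1 *m jcurl j) (S2 p j.1 *m jcurl j)
  + L5 p / 2 * frob j.1 j.1 * graddot j.2 j.2 + bulk j.1.

Lemma frobDr m n (A B C : 'M[R]_(m, n)) : frob A (B + C) = frob A B + frob A C.
Proof.
rewrite /frob -big_split; apply: eq_bigr => i _; rewrite -big_split.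
by apply: eq_bigr => j _; rewrite mxE mulrDr.
Qed.

Lemma frobZr m n c (A B : 'M[R]_(m, n)) : frob A (c *: B) = c * frob A B.
Proof.
rewrite /frob mulr_sumr; apply: eq_bigr => i _; rewrite mulr_sumr.
by apply: eq_bigr => j _; rewrite mxE mulrCA.
Qed.

Lemma frobC m n (A B : 'M[R]_(m, n)) : frob A B = frob B A.
Proof. by apply: eq_bigr => i _; apply: eq_bigr => j _; rewrite mulrC. Qed.

Lemma frobDl m n (A B C : 'M[R]_(m, n)) : frob (B + C) A = frob B A + frob C A.
Proof. by rewrite frobC frobDr !(frobC A). Qed.

Lemma frobZl m n c (A B : 'M[R]_(m, n)) : frob (c *: B) A = c * frob B A.
Proof. by rewrite frobC frobZr (frobC A). Qed.

Lemma frobNr m n (A B : 'M[R]_(m, n)) : frob A (- B) = - frob A B.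
Proof. by rewrite -scaleN1r frobZr mulN1r. Qed.

Lemma frobBr m n (A B C : 'M[R]_(m, n)) : frob A (B - C) = frob A B - frob A C.
Proof. by rewrite frobDr frobNr. Qed.

Lemma frobBl m n (A B C : 'M[R]_(m, n)) : frob (B - C) A = frob B A - frob C A.
Proof. by rewrite frobC frobBr !(frobC A). Qed.

Lemma frob_ge0 m n (A : 'M[R]_(m, n)) : 0 <= frob A A.
Proof. by apply: sumr_ge0 => i _; apply: sumr_ge0 => j _; rewrite -expr2 sqr_ge0. Qed.

Lemma frob_mid m n (A B : 'M[R]_(m, n)) :
  frob (mid A B) (A - B) = (frob A A - frob B B) / 2.
Proof. by rewrite /mid frobZl frobDl !frobBr (frobC B A); lra. Qed.

Lemma mxtrace_frob n (A B : 'M[R]_n) : \tr (A *m B) = frob A B^T.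
Proof.
by apply: eq_bigr => i _; rewrite mxE; apply: eq_bigr => j _; rewrite mxE.
Qed.

Lemma graddotDr (F G K : 'I_3 -> M3) :
  graddot F (fun k => G k + K k) = graddot F G + graddot F K.
Proof. by rewrite /graddot -big_split; apply: eq_bigr => k _; rewrite frobDr. Qed.

Lemma graddotZr c (F G : 'I_3 -> M3) :
  graddot F (fun k => c *: G k) = c * graddot F G.
Proof. by rewrite /graddot mulr_sumr; apply: eq_bigr => k _; rewrite frobZr. Qed.

Lemma graddot_ge0 (F : 'I_3 -> M3) : 0 <= graddot F F.
Proof. by apply: sumr_ge0 => k _; exact: frob_ge0. Qed.

Lemma jdiv_lin c j1 j2 : jdiv (jlin c j1 j2) = c *: jdiv j1 + jdiv j2.
Proof.
apply/colP => i; rewrite !mxE mulr_sumr -big_split.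
by apply: eq_bigr => k _; rewrite !mxE.
Qed.

Lemma jcurl_lin c j1 j2 : jcurl (jlin c j1 j2) = c *: jcurl j1 + jcurl j2.
Proof. by apply/matrixP => i l; rewrite !mxE; ring. Qed.

Lemma el_dens_lin n S eps (D : jet -> 'M[R]_(3, n)) j' j c f g :
  D (jlin c f g) = c *: D f + D g ->
  el_dens S eps D j' j (jlin c f g) = c * el_dens S eps D j' j f + el_dens S eps D j' j g.
Proof.
move=> DL; rewrite /el_dens DL /= mulmxDr -scalemxAr mulmxDl -scalemxAl.
rewrite scalerDr scalerA (mulrC eps) -scalerA addrACA -scalerDr.
by rewrite frobDr frobZr.
Qed.

Lemma h_dens_lin j' j c f g :
  h_dens j' j (jlin c f g) = c * h_dens j' j f + h_dens j' j g.
Proof.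
rewrite /h_dens !el_dens_lin ?jdiv_lin ?jcurl_lin //.
rewrite /h5a /h5b /h6 /= graddotDr graddotZr !frobDr !frobZr.
ring.
Qed.

(** The product rule for averages, on which the discrete gradient identity rests. *)
Lemma mid_product n (A A' : M3) (B B' : 'M[R]_(3, n)) :
  mid A' A *m (B' - B) + (A' - A) *m mid B' B = A' *m B' - A *m B.
Proof.
rewrite /mid -scalemxAl -scalemxAr -scalerDr !mulmxDl !mulmxDr !mulmxN !mulNmx.
apply/matrixP => i k; rewrite !mxE; lra.
Qed.

Lemma el_dens_diff n S eps (D : jet -> 'M[R]_(3, n)) j' j :
  (forall A B, S A - S B = eps *: (A - B)) ->
  (forall j1 j2, D (jlin (-1) j1 j2) = -1 *: D j1 + D j2) ->
  el_dens S eps D j' j (jlin (-1) j j') =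
  (frob (S j'.1 *m D j') (S j'.1 *m D j') - frob (S j.1 *m D j) (S j.1 *m D j)) / 2.
Proof.
move=> SB DL; rewrite -frob_mid -mid_product /el_dens DL /= !scaleN1r.
by rewrite [- D j + _]addrC [- j.1 + _]addrC scalemxAl -SB.
Qed.

(** The cubic term is where the average 2 mid (A'^2) (A^2) + A' A comes from:
    its product with A' - A telescopes to the trace of A'^3 - A^3, the trace
    being cyclic. *)
Lemma h6_diff j' j : j'.1^T = j'.1 -> j.1^T = j.1 ->
  h6 j' j (jlin (-1) j j') = bulk j'.1 - bulk j.1.
Proof.
case: j' => A' g'; case: j => A g /= sA' sA.
rewrite /h6 /bulk /= scaleN1r [- A + A']addrC.
rewrite frobDl frobBl (frobZl (2 * a p)) (frobZl (2 * b p / 3)) (frobZl (2 * c p * _)).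
rewrite frob_mid [frob (2 *: _ + _) _]frobDl (frobZl 2).
have e2 : \tr (A *m A) = frob A A by rewrite mxtrace_frob sA.
have e2' : \tr (A' *m A') = frob A' A' by rewrite mxtrace_frob sA'.
have e (X Y : M3) : Y^T = Y -> frob X Y = \tr (X *m Y) by move=> sY; rewrite mxtrace_frob sY.
have cub : 2 * frob (mid (A' *m A') (A *m A)) (A' - A) + frob (A' *m A) (A' - A) =
    \tr (A' *m A' *m A') - \tr (A *m A *m A).
  rewrite /mid frobZl frobDl !frobBr !e //.
  have -> : \tr (A' *m A *m A') = \tr (A' *m A' *m A).
    by rewrite mxtrace_mulC mulmxA.
  have -> : \tr (A' *m A *m A) = \tr (A *m A *m A').
    by rewrite -mulmxA mxtrace_mulC.
  lra.
rewrite cub /mid e2 e2' /GRing.scale /=; lra.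
Qed.

Lemma h_dens_diff j' j : j'.1^T = j'.1 -> j.1^T = j.1 ->
  h_dens j' j (jlin (-1) j j') = e_dens j' - e_dens j.
Proof.
move=> sj' sj; rewrite /h_dens h6_diff //.
have s1 A B : S1 p A - S1 p B = 1 *: (A - B).
  by rewrite /S1 scale1r opprD addrACA subrr add0r.
have s2 A B : S2 p A - S2 p B = -1 *: (A - B).
  by rewrite /S2 scaleN1r opprD addrACA subrr add0r opprB opprK addrC.
rewrite !el_dens_diff //; try by [move=> j1 j2; exact: jdiv_lin|move=> j1 j2; exact: jcurl_lin].
have e5 : h5a j' j (jlin (-1) j j') + h5b j' j (jlin (-1) j j') =
    (frob j'.1 j'.1 * graddot j'.2 j'.2 - frob j.1 j.1 * graddot j.2 j.2) / 2.
  rewrite /h5a /h5b /= frobZl scaleN1r [- j.1 + _]addrC frob_mid.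
  have -> : graddot (fun k => (mid (frob j'.1 j'.1) (frob j.1 j.1) : R) *: mid (j'.2 k) (j.2 k))
      (fun k => -1 *: j.2 k + j'.2 k) =
      (frob j'.1 j'.1 + frob j.1 j.1) / 2 * ((graddot j'.2 j'.2 - graddot j.2 j.2) / 2).
    rewrite /graddot -sumrB mulr_suml mulr_sumr; apply: eq_bigr => k _.
    rewrite frobZl scaleN1r [- j.2 k + _]addrC frob_mid /mid /GRing.scale /=; lra.
  rewrite /mid /GRing.scale /=; lra.
rewrite e5 /e_dens; lra.
Qed.

Lemma entry_le_frob m n (A : 'M[R]_(m, n)) i j : `|A i j| <= Num.sqrt (frob A A).
Proof.
rewrite -sqrtr_sqr; apply: ler_wsqrtr; rewrite /frob (bigD1 i) //= (bigD1 j) //=.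
rewrite -expr2 -addrA lerDl; apply: addr_ge0.
  by apply: sumr_ge0 => k _; rewrite -expr2 sqr_ge0.
by apply: sumr_ge0 => l _; apply: sumr_ge0 => k _; rewrite -expr2 sqr_ge0.
Qed.

(** Each of the 27 products of three entries is at most |A|^3. *)
Lemma cube_trace_le (A : M3) : `|\tr (A *m A *m A)| <= 27 * Num.sqrt (frob A A) ^+ 3.
Proof.
set s := Num.sqrt _; have s0 : 0 <= s by exact: sqrtr_ge0.
rewrite /mxtrace; apply: le_trans (ler_norm_sum _ _ _) _.
apply: (@le_trans _ _ (\sum_(i < 3) (9 * s ^+ 3))); last first.
  by rewrite sumr_const card_ord -[leLHS]mulr_natl; lra.
apply: ler_sum => i _; rewrite mxE; apply: le_trans (ler_norm_sum _ _ _) _.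
apply: (@le_trans _ _ (\sum_(j < 3) (3 * s ^+ 3))); last first.
  by rewrite sumr_const card_ord -[leLHS]mulr_natl; lra.
apply: ler_sum => j _; rewrite mxE normrM.
rewrite exprSr mulrA; apply: ler_pM => //; last exact: entry_le_frob.
apply: le_trans (ler_norm_sum _ _ _) _.
apply: (@le_trans _ _ (\sum_(k < 3) (s ^+ 2))); last first.
  by rewrite sumr_const card_ord -[leLHS]mulr_natl; lra.
apply: ler_sum => k _; rewrite normrM expr2.
by apply: ler_pM => //; exact: entry_le_frob.
Qed.

(** The quartic term dominates the others for large A. With s = |A|, the
    difference is bounded below by a sum of two squares. *)
Lemma bulk_coercive : 0 < c p -> exists C0, forall A : M3, A^T = A ->
  frob A A - C0 <= bulk A.
Proof.
move=> c0; pose B := 18 * `|b p|; pose kp := 1 + `|a p| + B ^+ 2 / c p.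
exists (kp ^+ 2 / c p) => A sA.
set s := Num.sqrt (frob A A).
have s0 : 0 <= s by exact: sqrtr_ge0.
have fs : frob A A = s ^+ 2 by rewrite sqr_sqrtr // frob_ge0.
have e2 : \tr (A *m A) = s ^+ 2 by rewrite mxtrace_frob sA.
have h1 : - (`|a p| * s ^+ 2) <= a p * s ^+ 2.
  by rewrite -mulNr ler_wpM2r ?sqr_ge0 // lerNl -normrN ler_norm.
have h2 : 2 * b p / 3 * \tr (A *m A *m A) <= B * s ^+ 3.
  apply: le_trans (ler_norm _) _; rewrite normrM.
  apply: (@le_trans _ _ (`|2 * b p / 3| * (27 * s ^+ 3))).
    by rewrite ler_wpM2l // cube_trace_le.
  rewrite normrM normrM [`|2|]ger0_norm // [`|3^-1|]ger0_norm // /B; lra.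
have h3 : 0 <= (c p * s - 2 * B) ^+ 2 * s ^+ 2 / (4 * c p).
  by apply: divr_ge0; apply: mulr_ge0; rewrite ?sqr_ge0 // ltW.
have h4 : 0 <= (c p * s ^+ 2 - 2 * kp) ^+ 2 / (4 * c p).
  by rewrite divr_ge0 ?sqr_ge0 // mulr_ge0 // ltW.
have e3 : (c p * s - 2 * B) ^+ 2 * s ^+ 2 / (4 * c p) =
   c p / 4 * s ^+ 4 - B * s ^+ 3 + B ^+ 2 / c p * s ^+ 2.
  by field; rewrite gt_eqF.
have e4 : (c p * s ^+ 2 - 2 * kp) ^+ 2 / (4 * c p) =
   c p / 4 * s ^+ 4 - kp * s ^+ 2 + kp ^+ 2 / c p.
  by field; rewrite gt_eqF.
rewrite e3 in h3; rewrite e4 in h4.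
rewrite /bulk e2 fs -exprM; move: h3 h4.
have -> : kp * s ^+ 2 = s ^+ 2 + `|a p| * s ^+ 2 + B ^+ 2 / c p * s ^+ 2.
  by rewrite /kp; ring.
move: (_ / c p) => u; lra.
Qed.

End Jets.

(** * Weighted Lipschitz bounds for the densities *)

Section Graded.
Variables (R : realType) (p : params R) (Z : Type).
Variable P : nat -> nat -> nat -> (Z -> R) -> Prop.

(** An estimate that holds for constants and is stable by sums and products
    holds for all densities, and is checked once on the syntax of the density.
    In P k m l f, the index k counts gradients, m counts factors Q or Q' (or
    constants in their place), and l counts factors linear in the test field.
    The instances are the weighted Lipschitz bound below and, with trivial
    grading, boundedness and measurability on the cells. *)
Record graded_algebra : Prop := GradedAlgebra {
  ga_cst : forall c, P 0 0 0 (fun=> c);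
  ga_add : forall k m l f g, P k m l f -> P k m l g -> P k m l (fun z => f z + g z);
  ga_mul : forall k m l k' m' l' f g, P k m l f -> P k' m' l' g ->
    P (k + k')%N (m + m')%N (l + l')%N (fun z => f z * g z);
  ga_weak : forall k m l k' m' f, (k <= k')%N -> (m <= m')%N -> P k m l f -> P k' m' l f }.

Hypothesis gaP : graded_algebra.

Lemma ga_eq k m l f g : (forall z, f z = g z) -> P k m l f -> P k m l g.
Proof. by move=> /funext ->. Qed.

Lemma ga_scale k m l c f : P k m l f -> P k m l (fun z => c * f z).
Proof. by move=> Pf; have := ga_mul gaP (ga_cst gaP c) Pf; rewrite !add0n. Qed.

Lemma ga_zero k m l f : P k m l f -> P k m l (fun=> 0).
Proof. by move=> Pf; apply: ga_eq (ga_scale 0 Pf) => z; rewrite mul0r. Qed.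

Lemma ga_sum k m l n (f : 'I_n.+1 -> Z -> R) :
  (forall i, P k m l (f i)) -> P k m l (fun z => \sum_i f i z).
Proof.
move=> Pf.
suff h (s : seq 'I_n.+1) : P k m l (fun z => \sum_(i <- s) f i z) by exact: h.
elim: s => [|i s IH].
  by apply: ga_eq (ga_zero (Pf ord0)) => z; rewrite big_nil.
by apply: ga_eq (ga_add gaP (Pf i) IH) => z; rewrite big_cons.
Qed.

Definition Pmx k m l r s (A : Z -> 'M[R]_(r, s)) := forall i j, P k m l (fun z => A z i j).

Lemma pmx_add k m l r s (A B : Z -> 'M[R]_(r, s)) :
  Pmx k m l A -> Pmx k m l B -> Pmx k m l (fun z => A z + B z).
Proof.
move=> PA PB i j; apply: ga_eq (ga_add gaP (PA i j) (PB i j)) => z; by rewrite mxE.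
Qed.

Lemma pmx_scale k m l r s c (A : Z -> 'M[R]_(r, s)) :
  Pmx k m l A -> Pmx k m l (fun z => c *: A z).
Proof. by move=> PA i j; apply: ga_eq (ga_scale c (PA i j)) => z; rewrite mxE. Qed.

Lemma pmx_opp k m l r s (A : Z -> 'M[R]_(r, s)) :
  Pmx k m l A -> Pmx k m l (fun z => - A z).
Proof.
by move=> PA i j; apply: ga_eq (ga_scale (-1) (PA i j)) => z; rewrite mxE mulN1r.
Qed.

Lemma pmx_scalef k m l k' m' l' r s (f : Z -> R) (A : Z -> 'M[R]_(r, s)) :
  P k m l f -> Pmx k' m' l' A ->
  Pmx (k + k')%N (m + m')%N (l + l')%N (fun z => f z *: A z).
Proof.
by move=> Pf PA i j; apply: ga_eq (ga_mul gaP Pf (PA i j)) => z; rewrite mxE.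
Qed.

Lemma pmx_mul k m l k' m' l' r n s (A : Z -> 'M[R]_(r, n.+1)) (B : Z -> 'M[R]_(n.+1, s)) :
  Pmx k m l A -> Pmx k' m' l' B ->
  Pmx (k + k')%N (m + m')%N (l + l')%N (fun z => A z *m B z).
Proof.
move=> PA PB i j.
apply: ga_eq (ga_sum (fun q => ga_mul gaP (PA i q) (PB q j))) => z.
by rewrite mxE.
Qed.

Lemma pmx_mid k m l r s (A B : Z -> 'M[R]_(r, s)) :
  Pmx k m l A -> Pmx k m l B -> Pmx k m l (fun z => mid (A z) (B z)).
Proof. by move=> PA PB; apply: pmx_scale; exact: pmx_add. Qed.

Lemma ga_mid k m l (f g : Z -> R) :
  P k m l f -> P k m l g -> P k m l (fun z => mid (f z) (g z) : R).
Proof. by move=> Pf Pg; apply: ga_scale; exact: (ga_add gaP). Qed.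

Lemma pmx_weak k m l k' m' r s (A : Z -> 'M[R]_(r, s)) :
  (k <= k')%N -> (m <= m')%N -> Pmx k m l A -> Pmx k' m' l A.
Proof. by move=> kk mm PA i j; exact: (ga_weak gaP kk mm (PA i j)). Qed.

Lemma ga_frob k m l k' m' l' r s (A B : Z -> 'M[R]_(r.+1, s.+1)) :
  Pmx k m l A -> Pmx k' m' l' B ->
  P (k + k')%N (m + m')%N (l + l')%N (fun z => frob (A z) (B z)).
Proof.
move=> PA PB; apply: ga_sum => i; apply: ga_sum => j.
exact: (ga_mul gaP (PA i j) (PB i j)).
Qed.

Lemma ga_graddot k m l k' m' l' (A B : Z -> 'I_3 -> 'M[R]_3) :
  (forall q, Pmx k m l (fun z => A z q)) -> (forall q, Pmx k' m' l' (fun z => B z q)) ->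
  P (k + k')%N (m + m')%N (l + l')%N (fun z => graddot (A z) (B z)).
Proof. by move=> PA PB; apply: ga_sum => q; exact: (ga_frob (PA q) (PB q)). Qed.

Lemma ga_trace k m l n (A : Z -> 'M[R]_n.+1) :
  Pmx k m l A -> P k m l (fun z => \tr (A z)).
Proof. by move=> PA; apply: ga_sum => i; exact: PA. Qed.

(** The gradient of a field has one more index k than its value. *)
Definition Pjet m l (j : Z -> jet R) :=
  Pmx 0 m l (fun z => (j z).1) /\ forall q, Pmx 1 m l (fun z => (j z).2 q).

Lemma pmx_jdiv m l j : Pjet m l j -> Pmx 1 m l (fun z => jdiv (j z)).
Proof.
move=> [_ Pj] i i'; apply: ga_eq (ga_sum (fun q => Pj q i q)) => z.
by rewrite mxE.
Qed.

Lemma pmx_jcurl m l j : Pjet m l j -> Pmx 1 m l (fun z => jcurl (j z)).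
Proof.
move=> [_ Pj] i q.
have h1 := Pj (ordS i) q (ordS (ordS i)); have h2 := Pj (ordS (ordS i)) q (ordS i).
apply: ga_eq (ga_add gaP h1 (ga_scale (-1) h2)) => z.
by rewrite mxE mulN1r.
Qed.

Lemma pmx_cst r s (B : 'M[R]_(r, s)) : Pmx 0 1 0 (fun=> B).
Proof. by move=> i j; apply: (ga_weak gaP (leqnn 0) (leq0n 1)); exact: (ga_cst gaP). Qed.

Lemma pmx_S1 A : Pmx 0 1 0 A -> Pmx 0 1 0 (fun z => S1 p (A z)).
Proof. by move=> PA; apply: pmx_add => //; exact: pmx_cst. Qed.

Lemma pmx_S2 A : Pmx 0 1 0 A -> Pmx 0 1 0 (fun z => S2 p (A z)).
Proof. by move=> PA; apply: pmx_add; [exact: pmx_cst|exact: pmx_opp]. Qed.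

Section Density.
Variables j' j f : Z -> jet R.
Hypotheses (Pj' : Pjet 1 0 j') (Pj : Pjet 1 0 j) (Pf : Pjet 0 1 f).

Lemma ga_el_dens n (S : 'M[R]_3 -> 'M[R]_3) eps (D : jet R -> 'M[R]_(3, n.+1)) :
  (forall A, Pmx 0 1 0 A -> Pmx 0 1 0 (fun z => S (A z))) ->
  (forall m l j, Pjet m l j -> Pmx 1 m l (fun z => D (j z))) ->
  P 2 3 1 (fun z => el_dens S eps D (j' z) (j z) (f z)).
Proof.
move=> PS PD.
have s' := PS _ Pj'.1; have s := PS _ Pj.1.
have X := pmx_mid (pmx_mul s' (PD _ _ _ Pj')) (pmx_mul s (PD _ _ _ Pj)).
have Y1 := pmx_mul (pmx_mid s' s) (PD _ _ _ Pf).
have Y2 := pmx_scale eps (pmx_mul Pf.1 (pmx_mid (PD _ _ _ Pj') (PD _ _ _ Pj))).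
exact: (ga_frob X (pmx_add Y1 Y2)).
Qed.

Lemma ga_h5a : P 2 3 1 (fun z => h5a (j' z) (j z) (f z)).
Proof.
have X := ga_mid (ga_graddot Pj'.2 Pj'.2) (ga_graddot Pj.2 Pj.2).
exact: (ga_frob (pmx_scalef X (pmx_mid Pj'.1 Pj.1)) Pf.1).
Qed.

Lemma ga_h5b : P 2 3 1 (fun z => h5b (j' z) (j z) (f z)).
Proof.
have X := ga_mid (ga_frob Pj'.1 Pj'.1) (ga_frob Pj.1 Pj.1).
exact: (ga_graddot (fun q => pmx_scalef X (pmx_mid (Pj'.2 q) (Pj.2 q))) Pf.2).
Qed.

Lemma ga_h6 : P 2 3 1 (fun z => h6 p (j' z) (j z) (f z)).
Proof.
have A := pmx_scale (2 * a p) (pmx_mid Pj'.1 Pj.1).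
have sq' := pmx_mul Pj'.1 Pj'.1; have sq := pmx_mul Pj.1 Pj.1.
have B := pmx_opp (pmx_scale (2 * b p / 3)
  (pmx_add (pmx_scale 2 (pmx_mid sq' sq)) (pmx_mul Pj'.1 Pj.1))).
have C := pmx_scalef (ga_scale (2 * c p) (ga_mid (ga_trace sq') (ga_trace sq)))
  (pmx_mid Pj'.1 Pj.1).
have A3 := pmx_weak (leqnn 0) (isT : (1 <= 3)%N) A.
have B3 := pmx_weak (leqnn 0) (isT : (2 <= 3)%N) B.
apply: (ga_weak gaP (leq0n 2) (leqnn 3)).
exact: (ga_frob (pmx_add (pmx_add A3 B3) C) Pf.1).
Qed.

Lemma ga_h_dens : P 2 3 1 (fun z => h_dens p (j' z) (j z) (f z)).
Proof.
rewrite /h_dens; do ![apply: (ga_add gaP)|apply: ga_scale].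
- by apply: ga_el_dens; [exact: pmx_S1|exact: pmx_jdiv].
- by apply: ga_el_dens; [exact: pmx_S1|exact: pmx_jcurl].
- by apply: ga_el_dens; [exact: pmx_S2|exact: pmx_jdiv].
- by apply: ga_el_dens; [exact: pmx_S2|exact: pmx_jcurl].
- exact: ga_h5a.
- exact: ga_h5b.
- exact: ga_h6.
Qed.

Lemma ga_e_dens : P 2 4 0 (fun z => e_dens p (j z)).
Proof.
have sc c0 k m f0 : (k <= 2)%N -> (m <= 4)%N -> P k m 0 f0 -> P 2 4 0 (fun z => c0 * f0 z).
  by move=> kk mm Pf0; apply: ga_scale; exact: (ga_weak gaP kk mm Pf0).
have A2 := pmx_mul Pj.1 Pj.1.
have sq n (A : Z -> 'M[R]_(3, n.+1)) : Pmx 1 2 0 A ->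
    forall c0, P 2 4 0 (fun z => c0 * frob (A z) (A z)).
  by move=> PA c0; apply: ga_scale; exact: (ga_frob PA PA).
have D := pmx_jdiv Pj; have C := pmx_jcurl Pj.
have s1 := pmx_S1 Pj.1; have s2 := pmx_S2 Pj.1.
have tr2 := ga_trace A2.
rewrite /e_dens /bulk; do ![apply: (ga_add gaP)].
- exact: (sq _ _ (pmx_mul s1 D)).
- exact: (sq _ _ (pmx_mul s1 C)).
- exact: (sq _ _ (pmx_mul s2 D)).
- exact: (sq _ _ (pmx_mul s2 C)).
- exact: (ga_mul gaP (ga_scale (L5 p / 2) (ga_frob Pj.1 Pj.1)) (ga_graddot Pj.2 Pj.2)).
- exact: (sc _ _ _ _ (leq0n 2) (isT : (2 <= 4)%N) tr2).
- apply: ga_eq (ga_scale (-1) (sc (2 * b p / 3) _ _ _ (leq0n 2) (isT : (3 <= 4)%N)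
    (ga_trace (pmx_mul A2 Pj.1)))) => z; by rewrite mulN1r.
- apply: ga_eq (sc (c p / 2) _ _ _ (leq0n 2) (leqnn 4) (ga_mul gaP tr2 tr2)) => z.
  by rewrite expr2.
Qed.

End Density.
End Graded.

Section Lipschitz.
Variables (R : realType) (p : params R) (hmax : R).
Hypothesis hmax_gt0 : 0 < hmax.

Definition mx1 r s (A : 'M[R]_(r, s)) : R := \sum_i \sum_j `|A i j|.
(** Gradients are weighted by h, the weight for which values and gradients of a
    piecewise affine field have the same size. *)
Definition jnorm (h : R) (j : jet R) : R := mx1 j.1 + h * \sum_q mx1 (j.2 q).

Lemma mx1_ge0 r s (A : 'M[R]_(r, s)) : 0 <= mx1 A.
Proof. by apply: sumr_ge0 => i _; apply: sumr_ge0. Qed.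

Lemma entry_le_mx1 r s (A : 'M[R]_(r, s)) i j : `|A i j| <= mx1 A.
Proof.
rewrite /mx1 (bigD1 i) //= (bigD1 j) //= -addrA lerDl addr_ge0 //.
  by apply: sumr_ge0.
by apply: sumr_ge0 => l _; apply: sumr_ge0.
Qed.

Lemma jnorm_ge0 h j : 0 <= h -> 0 <= jnorm h j.
Proof.
by move=> h0; rewrite addr_ge0 ?mx1_ge0 ?mulr_ge0 // sumr_ge0 // => q _; exact: mx1_ge0.
Qed.

Lemma val_le_jnorm h (j : jet R) i l : 0 <= h -> `|j.1 i l| <= jnorm h j.
Proof.
move=> h0; apply: le_trans (entry_le_mx1 _ i l) _; rewrite lerDl mulr_ge0 //.
by apply: sumr_ge0 => q _; exact: mx1_ge0.
Qed.

Lemma grad_le_jnorm h (j : jet R) q i l : 0 < h -> `|j.2 q i l| <= h^-1 * jnorm h j.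
Proof.
move=> h0; rewrite ler_pdivlMl //; apply: (@le_trans _ _ (h * \sum_q mx1 (j.2 q))).
  apply: ler_wpM2l; first exact: ltW.
  apply: le_trans (entry_le_mx1 _ i l) _; rewrite (bigD1 q) //= lerDl.
  by apply: sumr_ge0 => k _; exact: mx1_ge0.
by rewrite lerDr mx1_ge0.
Qed.

(** Two values st_1 and st_2 of the new iterate to be compared, the old iterate
    st_0 and the test field st_f. A graded function also takes a boolean that
    selects which of st_1 and st_2 is used. *)
Record state := State { st_h : R; st_1 : jet R; st_2 : jet R; st_0 : jet R; st_f : jet R }.

Let valid s := 0 < st_h s <= hmax.
Let q s := 1 + jnorm (st_h s) (st_1 s) + jnorm (st_h s) (st_2 s) + jnorm (st_h s) (st_0 s).
Let d s := jnorm (st_h s) (jlin (-1) (st_2 s) (st_1 s)).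
Let e s := jnorm (st_h s) (st_f s).

Let q_ge1 s : valid s -> 1 <= q s.
Proof.
case/andP => /ltW h0 _; rewrite /q; have := jnorm_ge0 (st_1 s) h0.
by have := jnorm_ge0 (st_2 s) h0; have := jnorm_ge0 (st_0 s) h0; lra.
Qed.

Let e_ge0 s : valid s -> 0 <= e s.
Proof. by case/andP => /ltW h0 _; exact: jnorm_ge0. Qed.

Let d_ge0 s : valid s -> 0 <= d s.
Proof. by case/andP => /ltW h0 _; exact: jnorm_ge0. Qed.

Let w k m l s := (st_h s)^-1 ^+ k * q s ^+ m * e s ^+ l.

Let w_ge0 k m l s : valid s -> 0 <= w k m l s.
Proof.
move=> vs; have q1 := q_ge1 vs; have [h0 _] := andP vs.
rewrite /w !mulr_ge0 // exprn_ge0 ?e_ge0 //.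
  by rewrite invr_ge0 ltW.
by apply: le_trans q1.
Qed.

Let wM k m l k' m' l' s : w (k + k') (m + m') (l + l') s = w k m l s * w k' m' l' s.
Proof. by rewrite /w !exprD; ring. Qed.

(** The function is bounded by the weight h^-k q^m e^l, and in its variation
    one factor q is replaced by the distance d between st_1 and st_2. The
    factor q is moved to the left so that m = 0 needs no separate treatment. *)
Definition lipschitz_grade k m l (f : state * bool -> R) := exists2 C, 0 <= C &
  forall s, valid s -> (forall b, `|f (s, b)| <= C * w k m l s) /\
    q s * `|f (s, true) - f (s, false)| <= C * w k m l s * d s.

(** Weakening uses h <= hmax and 1 <= q, at the price of a power of hmax; the
    product is the Leibniz rule for differences. *)
Lemma lipschitz_graded : graded_algebra lipschitz_grade.
Proof.
split.
- move=> c; exists `|c| => // s vs; split => [_|].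
    by rewrite /w !expr0 !mulr1.
  by rewrite subrr normr0 mulr0 !mulr_ge0 ?w_ge0 ?d_ge0.
- move=> k m l f g [C C0 hf] [C' C'0 hg]; exists (C + C'); first exact: addr_ge0.
  move=> s vs; have [f1 f2] := hf s vs; have [g1 g2] := hg s vs; split => [b|].
    apply: le_trans (ler_normD _ _) _; rewrite (mulrDl C C'); apply: lerD; [exact: f1|exact: g1].
  rewrite opprD addrACA (mulrDl C C') (mulrDl (C * _)); apply: (@le_trans _ _ (q s * (`|f (s, true) - f (s, false)| + `|g (s, true) - g (s, false)|))).
    apply: ler_wpM2l; last exact: ler_normD.
    by apply: le_trans (q_ge1 vs).
  by rewrite (mulrDr (q s)) lerD.
- move=> k m l k' m' l' f g [C C0 hf] [C' C'0 hg]; exists (2 * (C * C')).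
    by rewrite !mulr_ge0.
  move=> s vs; have [f1 f2] := hf s vs; have [g1 g2] := hg s vs.
  have w1 := w_ge0 k m l vs; have w2 := w_ge0 k' m' l' vs.
  have q0 : 0 <= q s by apply: le_trans (q_ge1 vs).
  have CC : C * C' * (w k m l s * w k' m' l' s) = (C * w k m l s) * (C' * w k' m' l' s).
    by ring.
  split => [b|].
    rewrite normrM wM; apply: (@le_trans _ _ (C * C' * (w k m l s * w k' m' l' s))).
      by rewrite CC; apply: ler_pM.
    apply: ler_wpM2r; first exact: mulr_ge0.
    by rewrite ler_peMl ?mulr_ge0 // ler1n.
  have -> : f (s, true) * g (s, true) - f (s, false) * g (s, false) =
    (f (s, true) - f (s, false)) * g (s, true) + f (s, false) * (g (s, true) - g (s, false)).
    by ring.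
  apply: (@le_trans _ _ (q s * (`|f (s, true) - f (s, false)| * `|g (s, true)| +
      `|f (s, false)| * `|g (s, true) - g (s, false)|))).
    by apply: ler_wpM2l => //; apply: le_trans (ler_normD _ _) _; rewrite !normrM.
  have h1 : q s * (`|f (s, true) - f (s, false)| * `|g (s, true)|) <=
     (C * w k m l s * d s) * (C' * w k' m' l' s).
    by rewrite [leLHS]mulrA; apply: ler_pM; [exact: mulr_ge0| |exact: f2|exact: g1].
  have h2 : q s * (`|f (s, false)| * `|g (s, true) - g (s, false)|) <=
     (C * w k m l s) * (C' * w k' m' l' s * d s).
    by rewrite [leLHS]mulrCA; apply: ler_pM; [|exact: mulr_ge0|exact: f1|exact: g2].
  rewrite (mulrDr (q s)) wM; apply: le_trans (lerD h1 h2) _.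
  by rewrite le_eqVlt; apply/orP; left; apply/eqP; ring.
- move=> k m l k' m' f /subnKC <- /subnKC <-; move: (k' - k)%N (m' - m)%N => D D' [C C0 hf].
  exists (C * hmax ^+ D).
    by rewrite mulr_ge0 // exprn_ge0 // ltW.
  move=> s vs; have [h0 hh] := andP vs; have q1 := q_ge1 vs.
  have le : C * w k m l s <= C * hmax ^+ D * w (k + D) (m + D') l s.
    rewrite -mulrA; apply: ler_wpM2l => //.
    have -> : hmax ^+ D * w (k + D) (m + D') l s =
       w k m l s * ((hmax / st_h s) ^+ D * q s ^+ D').
      rewrite /w !exprD exprMn; ring.
    rewrite ler_peMr ?w_ge0 //.
    rewrite -[leLHS]mulr1; apply: ler_pM => //; apply: exprn_ege1 => //.
    by rewrite ler_pdivlMr // mul1r.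
  have [f1 f2] := hf s vs; split => [b|]; first exact: le_trans (f1 b) le.
  by apply: le_trans f2 _; rewrite ler_wpM2r ?d_ge0.
Qed.

Lemma lipschitz_var : Pjet lipschitz_grade 1 0
  (fun z : state * bool => if z.2 then st_1 z.1 else st_2 z.1).
Proof.
split => [i l|r i l]; exists 1 => // s vs; have [h0 hh] := andP vs;
  have q1 := q_ge1 vs; have h0' := ltW h0;
  have n1 := jnorm_ge0 (st_1 s) h0'; have n2 := jnorm_ge0 (st_2 s) h0';
  have n0 := jnorm_ge0 (st_0 s) h0'; rewrite /w !expr0 !expr1 !mul1r ?mulr1;
  have l1 : jnorm (st_h s) (st_1 s) <= q s by [rewrite /q; lra];
  have l2 : jnorm (st_h s) (st_2 s) <= q s by [rewrite /q; lra].
- split => [[]|] /=; first exact: le_trans (val_le_jnorm _ i l h0') l1.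
    exact: le_trans (val_le_jnorm _ i l h0') l2.
  apply: ler_wpM2l; first by apply: le_trans q1.
  have := val_le_jnorm (jlin (-1) (st_2 s) (st_1 s)) i l h0'.
  by rewrite /= !mxE mulN1r addrC.
- split => [[]|] /=.
  + apply: le_trans (grad_le_jnorm _ r i l h0) _.
    by apply: ler_wpM2l => //; rewrite invr_ge0.
  + apply: le_trans (grad_le_jnorm _ r i l h0) _.
    by apply: ler_wpM2l => //; rewrite invr_ge0.
  rewrite mulrAC [leRHS]mulrC; apply: ler_wpM2l; first by apply: le_trans q1.
  have := grad_le_jnorm (jlin (-1) (st_2 s) (st_1 s)) r i l h0.
  by rewrite /= !mxE mulN1r addrC.
Qed.

Lemma lipschitz_fixed : Pjet lipschitz_grade 1 0 (fun z : state * bool => st_0 z.1).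
Proof.
split => [i l|r i l]; exists 1 => // s vs; have [h0 hh] := andP vs;
  have q1 := q_ge1 vs; have h0' := ltW h0;
  have n1 := jnorm_ge0 (st_1 s) h0'; have n2 := jnorm_ge0 (st_2 s) h0';
  have n0 := jnorm_ge0 (st_0 s) h0';
  have l1 : jnorm (st_h s) (st_0 s) <= q s by [rewrite /q; lra].
- split => [b|]; last by rewrite subrr normr0 mulr0 mul1r mulr_ge0 ?w_ge0 ?d_ge0.
  rewrite /w !expr0 !expr1 !mul1r ?mulr1; exact: le_trans (val_le_jnorm _ i l h0') l1.
- split => [b|]; last by rewrite subrr normr0 mulr0 mul1r mulr_ge0 ?w_ge0 ?d_ge0.
  rewrite /w !expr0 !expr1 !mul1r ?mulr1; apply: le_trans (grad_le_jnorm _ r i l h0) _.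
  by apply: ler_wpM2l => //; rewrite invr_ge0.
Qed.

Lemma lipschitz_test : Pjet lipschitz_grade 0 1 (fun z : state * bool => st_f z.1).
Proof.
split => [i l|r i l]; exists 1 => // s vs; have [h0 hh] := andP vs; have h0' := ltW h0.
- split => [b|]; last by rewrite subrr normr0 mulr0 mul1r mulr_ge0 ?w_ge0 ?d_ge0.
  rewrite /w !expr0 !expr1 !mul1r ?mulr1; exact: val_le_jnorm.
- split => [b|]; last by rewrite subrr normr0 mulr0 mul1r mulr_ge0 ?w_ge0 ?d_ge0.
  rewrite /w !expr0 !expr1 !mul1r ?mulr1; exact: grad_le_jnorm.
Qed.

(** The density of H has grade (2, 3, 1): at most two gradients, three factors
    Q or Q', and one factor phi. *)
Theorem h_dens_lipschitz : exists2 C, 0 <= C & forall h j1 j2 j f, 0 < h -> h <= hmax ->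
  `|h_dens p j1 j f - h_dens p j2 j f| <= C * h^-1 ^+ 2 *
    (1 + jnorm h j1 + jnorm h j2 + jnorm h j) ^+ 2 *
    jnorm h (jlin (-1) j2 j1) * jnorm h f.
Proof.
have [C C0 hC] := ga_h_dens p lipschitz_graded lipschitz_var lipschitz_fixed lipschitz_test.
exists C => // h j1 j2 j f h0 hh.
have vs : valid (State h j1 j2 j f) by rewrite /valid /= h0 hh.
have [_ /=] := hC _ vs.
have q1 := q_ge1 vs; rewrite /w /d /e /=.
have -> : q (State h j1 j2 j f) = 1 + jnorm h j1 + jnorm h j2 + jnorm h j by [].
rewrite {1}/q /= in q1.
set qq := 1 + _ + _ + _ in q1 *.
have qq0 : 0 < qq by apply: lt_le_trans q1.
rewrite -ler_pdivlMl // => /le_trans; apply.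
rewrite le_eqVlt; apply/orP; left; apply/eqP; rewrite expr1; field.
by rewrite !gt_eqF.
Qed.

End Lipschitz.

(** * Piecewise affine fields *)

(** The inequality of Cauchy and Schwarz against constants. *)
Lemma sqr_sum_le (R : realType) n (f : 'I_n -> R) :
  (\sum_i f i) ^+ 2 <= n%:R * \sum_i f i ^+ 2.
Proof.
elim: n f => [f|n IH f]; first by rewrite !big_ord0 expr0n mul0r.
rewrite !big_ord_recr /=; have := IH (fun i => f (widen_ord (leqnSn n) i)).
set s := \sum_(i < n) _; set s2 := \sum_(i < n) _; set y := f ord_max => h.
have s20 : 0 <= s2 by apply: sumr_ge0 => i _; exact: sqr_ge0.
have [n0|n0] := posnP n.
  have -> : s = 0 by rewrite /s; clear -n0; subst n; rewrite big_ord0.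
  have -> : s2 = 0 by rewrite /s2; clear -n0; subst n; rewrite big_ord0.
  by rewrite !add0r n0 mul1r.
have N0 : 0 < n%:R :> R by rewrite ltr0n.
have : 0 <= (s - n%:R * y) ^+ 2 / n%:R by rewrite divr_ge0 ?sqr_ge0 // ltW.
have -> : (s - n%:R * y) ^+ 2 / n%:R = s ^+ 2 / n%:R - 2 * s * y + n%:R * y ^+ 2.
  by field; rewrite gt_eqF.
have : s ^+ 2 / n%:R <= s2 by rewrite ler_pdivrMr // mulrC.
rewrite -natr1; lra.
Qed.

Section Fields.
Variables (R : realType) (Omega : set 'rV[R]_3) (Th : triangulation Omega).
Implicit Types (t : 'I_(nelem Th)) (Q f g : tensor_field R).
Variable K : R.
Hypothesis K_gt0 : 0 < K.
Hypothesis K_bound : forall x k, closure Omega x -> `|x 0 k| <= K.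

Definition pw_affine f := forall t, affine_on (elem t) f.

Definition sqnorm f (x : 'rV[R]_3) : R := frob (f x) (f x).

Lemma pw_affine_jet f t : pw_affine f -> exists (A : 'M[R]_3) (B : 'I_3 -> 'M[R]_3),
  (forall x, elem t x -> f x = A + \sum_k x 0 k *: B k) /\
  (forall x, cell t x -> grad f x = B).
Proof.
move=> /(_ t)[A [B fAB]]; exists A, B; split => // x xt; apply/funext => k.
apply/matrixP => i j; rewrite mxE.
have fij y : elem t y -> f y i j = aff (A i j) (fun k => B k i j) y.
  move=> yt; rewrite fAB // !mxE summxE; congr (_ + _).
  by apply: eq_bigr => l _; rewrite mxE.
exact: (derive_delta_aff k fij xt).
Qed.

Lemma pw_affine_entry f t i j : pw_affine f -> exists c a,
  (forall x, elem t x -> f x i j = aff c a x) /\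
  (forall x k, cell t x -> grad f x k i j = a k).
Proof.
move=> /(pw_affine_jet t)[A [B [fAB gB]]].
exists (A i j), (fun k => B k i j); split => [y yt|x k /gB -> //].
rewrite fAB // !mxE summxE; congr (_ + _).
by apply: eq_bigr => l _; rewrite mxE.
Qed.

Lemma pw_affine_lin c f g : pw_affine f -> pw_affine g ->
  pw_affine (fun x => c *: f x + g x).
Proof.
move=> pf pg t; have [A [B fAB]] := pf t; have [A' [B' gAB]] := pg t.
exists (c *: A + A'), (fun k => c *: B k + B' k) => x xt.
rewrite fAB // gAB // scalerDr addrACA; congr (_ + _).
rewrite scaler_sumr -big_split; apply: eq_bigr => k _.
by rewrite scalerDr !scalerA mulrC.
Qed.

Lemma jet_lin c f g x : pw_affine f -> pw_affine g -> cells Th x ->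
  jet_of (fun x => c *: f x + g x) x = jlin c (jet_of f x) (jet_of g x).
Proof.
move=> pf pg [t _ xt]; rewrite /jet_of /jlin /=; congr pair; apply/funext => k.
apply/matrixP => i j; rewrite [RHS]mxE [X in _ = X + _]mxE.
have [cf [af [ef gf]]] := pw_affine_entry t i j pf.
have [cg [ag [eg gg]]] := pw_affine_entry t i j pg.
rewrite (gf x k xt) (gg x k xt) mxE.
apply: (@derive_delta_aff _ _ (elem t) (c * cf + cg) (fun k => c * af k + ag k)) => // y yt.
rewrite !mxE ef // eg // /aff mulrDr addrACA mulr_sumr -big_split; congr (_ + _).
by apply: eq_bigr => l _; rewrite /=; ring.
Qed.

(** Fields are only specified on the closure of Omega; this makes their
    gradients in the cells independent of the values elsewhere. *)
Lemma jet_eq f g x : pw_affine f -> pw_affine g ->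
  (forall y, closure Omega y -> f y = g y) -> cells Th x -> jet_of f x = jet_of g x.
Proof.
move=> pf pg fg [t _ xt]; rewrite /jet_of; congr pair.
  by apply: fg; apply: elem_sub_closure (cell_sub_elem xt).
apply/funext => k; apply/matrixP => i j.
have [cg [ag [eg gg]]] := pw_affine_entry t i j pg.
rewrite (gg x k xt) mxE.
apply: (@derive_delta_aff _ _ (elem t) cg ag) => // y yt.
by rewrite fg ?eg //; apply: elem_sub_closure yt.
Qed.

Lemma good_algebra : graded_algebra (fun _ _ _ => good Th).
Proof.
split.
- move=> c; exact: good_cst.
- move=> _ _ _ f g; exact: goodD.
- move=> _ _ _ _ _ _ f g; exact: goodM.
- by [].
Qed.

Lemma good_jet m l f : pw_affine f ->
  Pjet (fun _ _ _ => good Th) m l (jet_of f).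
Proof.
move=> pf; split => [i j|k i j]; apply: (good_piecewise K_bound) => t;
  have [c [a [e g]]] := pw_affine_entry t i j pf.
- by exists c, a => x xt; rewrite /= e //; exact: cell_sub_elem.
- by exists (a k), (fun=> 0) => x xt; rewrite /= g // /aff big1 ?addr0 // => q _; rewrite mulr0.
Qed.

Lemma good_frob f g : pw_affine f -> pw_affine g -> good Th (fun x => frob (f x) (g x)).
Proof.
move=> pf pg.
exact: (ga_frob good_algebra (good_jet 0 0 pf).1 (good_jet 0 0 pg).1).
Qed.

Lemma good_jnorm h f : pw_affine f -> good Th (fun x => jnorm h (jet_of f x)).
Proof.
move=> pf; have [g0 g1] := good_jet 0 0 pf.
apply: goodD.
  by apply: good_sum => i; apply: good_sum => j; apply: good_norm; exact: g0.
apply: goodZ; apply: good_sum => k.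
by apply: good_sum => i; apply: good_sum => j; apply: good_norm; exact: g1.
Qed.

(** A point of an element is a convex combination of the vertices, and affine
    functions commute with convex combinations. *)
Lemma vertex_vanish f : pw_affine f -> (forall t i, f (vertex t i) = 0) ->
  forall x, closure Omega x -> f x = 0.
Proof.
move=> pf fv x; rewrite (elem_cover Th) => -[t _ xt].
have [A [B fAB]] := pf t; have [w [_ _ w1 xE]] := xt.
have vt i : elem t (vertex t i).
  exact: (vertex_in_vhull (elem_nondegenerate t) i).
rewrite fAB // xE.
have -> : \sum_k (\sum_i w i *: vertex t i) 0 k *: B k =
    \sum_i w i *: \sum_k (vertex t i) 0 k *: B k.
  under [RHS]eq_bigr do rewrite scaler_sumr.
  rewrite exchange_big; apply: eq_bigr => k _; rewrite summxE scaler_suml.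
  by apply: eq_bigr => i _; rewrite mxE scalerA.
rewrite -[A in LHS]scale1r -w1 scaler_suml -big_split big1 // => i _.
by rewrite /= -scalerDr -fAB // fv scaler0.
Qed.

Section Functional.
Variable p : params R.

Definition hden Q' Q f (x : 'rV[R]_3) := h_dens p (jet_of Q' x) (jet_of Q x) (jet_of f x).

Lemma good_hden Q' Q f : pw_affine Q' -> pw_affine Q -> pw_affine f -> good Th (hden Q' Q f).
Proof.
move=> p' pQ pf.
exact: (ga_h_dens p good_algebra (good_jet _ _ p') (good_jet _ _ pQ) (good_jet _ _ pf)).
Qed.

Lemma good_eden Q : pw_affine Q -> good Th (fun x => e_dens p (jet_of Q x)).
Proof. by move=> pQ; exact: (ga_e_dens p good_algebra (good_jet _ _ pQ)). Qed.

(** The functional is a sum of separate integrals, one of them split further,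
    while the estimates are on the total density. *)
Lemma H_J Q' Q f : pw_affine Q' -> pw_affine Q -> pw_affine f ->
  H p Omega Q' Q f = integral3 Omega (hden Q' Q f).
Proof.
move=> p' pQ pf.
have g' := good_jet 1 0 p'; have gQ := good_jet 1 0 pQ; have gf := good_jet 0 1 pf.
have e1 n S eps (D : jet R -> 'M[R]_(3, n.+1)) := ga_el_dens good_algebra g' gQ gf (S := S) (D := D) eps.
have s1 := @pmx_S1 R p _ _ good_algebra; have s2 := @pmx_S2 R p _ _ good_algebra.
have dv m l j := @pmx_jdiv R _ _ good_algebra m l j.
have cl m l j := @pmx_jcurl R _ _ good_algebra m l j.
pose E n S eps (D : jet R -> 'M[R]_(3, n)) x := el_dens S eps D (jet_of Q' x) (jet_of Q x) (jet_of f x).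
have g1 : good Th (E _ (S1 p) 1 (@jdiv R)) by exact: e1.
have g2 : good Th (E _ (S1 p) 1 (@jcurl R)) by exact: e1.
have g3 : good Th (E _ (S2 p) (-1) (@jdiv R)) by exact: e1.
have g4 : good Th (E _ (S2 p) (-1) (@jcurl R)) by exact: e1.
have g5a := ga_h5a good_algebra g' gQ gf.
have g5b := ga_h5b good_algebra g' gQ gf.
have g6 := ga_h6 p good_algebra g' gQ gf.
have jD u v := JD Th K_gt0 K_bound (f := u) (g := v).
have jZ c u := JZ Th K_gt0 K_bound c (f := u).
have d1 := goodZ (L1 p) g1; have d2 := goodZ (L2 p) g2.
have d3 := goodZ (L3 p) g3; have d4 := goodZ (L4 p) g4.
have d5 := goodZ (L5 p) (goodD g5a g5b).
have d12 := goodD d1 d2; have d123 := goodD d12 d3; have d1234 := goodD d123 d4.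
have -> : integral3 Omega (hden Q' Q f) = L1 p * integral3 Omega (E _ (S1 p) 1 (@jdiv R)) +
    L2 p * integral3 Omega (E _ (S1 p) 1 (@jcurl R)) + L3 p * integral3 Omega (E _ (S2 p) (-1) (@jdiv R)) +
    L4 p * integral3 Omega (E _ (S2 p) (-1) (@jcurl R)) +
    L5 p * (integral3 Omega (fun x => h5a (jet_of Q' x) (jet_of Q x) (jet_of f x)) +
            integral3 Omega (fun x => h5b (jet_of Q' x) (jet_of Q x) (jet_of f x))) +
    integral3 Omega (fun x => h6 p (jet_of Q' x) (jet_of Q x) (jet_of f x)).
  rewrite -(jD _ _ g5a g5b) -(jZ _ _ g1) -(jZ _ _ g2) -(jZ _ _ g3) -(jZ _ _ g4).
  rewrite -(jZ _ _ (goodD g5a g5b)) -(jD _ _ d1 d2) -(jD _ _ d12 d3) -(jD _ _ d123 d4).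
  by rewrite -(jD _ _ d1234 d5) -(jD _ _ (goodD d1234 d5) g6).
have h1 : H1 p Omega Q' Q f = L1 p * integral3 Omega (E _ (S1 p) 1 (@jdiv R)).
  rewrite /H1; congr (_ * integral3 Omega _); apply/funext => x.
  by rewrite /E /el_dens !div_jet scale1r.
have h2 : H2 p Omega Q' Q f = L2 p * integral3 Omega (E _ (S1 p) 1 (@jcurl R)).
  rewrite /H2; congr (_ * integral3 Omega _); apply/funext => x.
  by rewrite /E /el_dens !curl_jet scale1r.
have h3 : H3 p Omega Q' Q f = L3 p * integral3 Omega (E _ (S2 p) (-1) (@jdiv R)).
  rewrite /H3; congr (_ * integral3 Omega _); apply/funext => x.
  by rewrite /E /el_dens !div_jet scaleN1r.
have h4 : H4 p Omega Q' Q f = L4 p * integral3 Omega (E _ (S2 p) (-1) (@jcurl R)).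
  rewrite /H4; congr (_ * integral3 Omega _); apply/funext => x.
  by rewrite /E /el_dens !curl_jet scaleN1r.
by rewrite /H h1 h2 h3 h4.
Qed.

Lemma energy_J Q : energy p Omega Q = integral3 Omega (fun x => e_dens p (jet_of Q x)).
Proof.
rewrite /energy; congr (integral3 Omega _); apply/funext => x.
by rewrite /e_dens /bulk !div_jet !curl_jet !addrA.
Qed.

Lemma H_lin Q' Q c f g : pw_affine Q' -> pw_affine Q -> pw_affine f -> pw_affine g ->
  H p Omega Q' Q (fun x => c *: f x + g x) = c * H p Omega Q' Q f + H p Omega Q' Q g.
Proof.
move=> p' pQ pf pg; have pl := pw_affine_lin c pf pg.
rewrite (H_J p' pQ pl) (H_J p' pQ pf) (H_J p' pQ pg).
rewrite -(JZ Th K_gt0 K_bound); last exact: good_hden.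
rewrite -(JD Th K_gt0 K_bound); last 2 first.
- by apply: goodZ; exact: good_hden.
- exact: good_hden.
apply: (J_eq Th) => x cx; by rewrite /hden jet_lin // h_dens_lin.
Qed.

Lemma H_eq Q1 Q2 Q f g : pw_affine Q1 -> pw_affine Q2 -> pw_affine Q ->
  pw_affine f -> pw_affine g ->
  (forall y, closure Omega y -> Q1 y = Q2 y) -> (forall y, closure Omega y -> f y = g y) ->
  H p Omega Q1 Q f = H p Omega Q2 Q g.
Proof.
move=> p1 p2 pQ pf pg Q12 fg; rewrite (H_J p1 pQ pf) (H_J p2 pQ pg).
apply: (J_eq Th) => x cx.
by rewrite /hden (jet_eq p1 p2 Q12 cx) (jet_eq pf pg fg cx).
Qed.

(** Symmetry of the fields makes the traces in the bulk term scalar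
    products. *)
Lemma H_diff Q' Q : pw_affine Q' -> pw_affine Q ->
  (forall x, closure Omega x -> (Q' x)^T = Q' x) -> (forall x, closure Omega x -> (Q x)^T = Q x) ->
  H p Omega Q' Q (fun x => -1 *: Q x + Q' x) = energy p Omega Q' - energy p Omega Q.
Proof.
move=> p' pQ s' sQ; have pl := pw_affine_lin (-1) pQ p'.
rewrite (H_J p' pQ pl) !energy_J -[- integral3 _ _]mulN1r -(JZ Th K_gt0 K_bound); last exact: good_eden.
rewrite -(JD Th K_gt0 K_bound); last 2 first.
- exact: good_eden.
- by apply: goodZ; exact: good_eden.
apply: (J_eq Th) => x cx; rewrite /hden jet_lin // h_dens_diff ?mulN1r //=.
- by apply: s'; exact: cells_sub_closure cx.
- by apply: sQ; exact: cells_sub_closure cx.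
Qed.

End Functional.
End Fields.

(** * Inverse inequalities for fields and for the functional *)

Section InverseFields.
Variables (R : realType) (Omega : set 'rV[R]_3) (Th : triangulation Omega).
Implicit Types (t : 'I_(nelem Th)) (Q f g : tensor_field R).
Variable K : R.
Hypothesis K_gt0 : 0 < K.
Hypothesis K_bound : forall x k, closure Omega x -> `|x 0 k| <= K.
Variable sigma : R.
Hypothesis sigma_gt0 : 0 < sigma.
Hypothesis balls : forall t, exists x r, sigma * meshsize Th <= r /\
      [set y | enorm (y - x) <= r] `<=` elem t.
Hypothesis Omega_neq0 : Omega !=set0.
Local Notation h := (meshsize Th).
Local Notation J := (integral3 Omega).

(** The 9 comes from the inequality of Cauchy and Schwarz over the entries, and
    1 + 16 / sigma is the sum of 1 + 4 / sigma for the values and of 4 / sigma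
    for each of the three partial derivatives ([inverse_affine]). *)
Definition inverse_const (sigma : R) : R := 9 * (1 + 16 / sigma) ^+ 2 * (4 / sigma) ^+ 3.

Lemma inverse_const_ge0 : 0 <= inverse_const sigma.
Proof.
have s0 : 0 <= 4 / sigma by rewrite divr_ge0 // ltW.
by apply: mulr_ge0; [apply: mulr_ge0 => //; exact: sqr_ge0|exact: exprn_ge0].
Qed.

Lemma good_cell t u : good Th u -> good Th (fun x => \1_(cell t) x * u x).
Proof. by move=> gu; apply: goodM => //; apply: good_indic; exact: measurable_cell. Qed.

(** A single m links the two sides of the inverse inequality: it is bounded by
    the L2 norm on the cell, and it bounds the values on the element and the
    gradients in the cell. *)
Lemma field_inverse t f : pw_affine Th f -> exists m, [/\ 0 <= m,
  m ^+ 2 <= inverse_const sigma * h ^- 3 * J (fun x => \1_(cell t) x * sqnorm f x),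
  forall x i j, elem t x -> `|f x i j| <= m &
  forall x, cell t x -> jnorm h (jet_of f x) <= m].
Proof.
have h_gt0 := meshsize_gt0 Th K_gt0 K_bound Omega_neq0; move=> pf.
have ex (ij : 'I_3 * 'I_3) : exists m, [/\ 0 <= m,
    (sigma * h / 4) ^+ 3 * m ^+ 2 <= J (fun x => \1_(cell t) x * f x ij.1 ij.2 ^+ 2),
    forall x, elem t x -> `|f x ij.1 ij.2| <= (1 + 4 / sigma) * m &
    forall x k, cell t x -> h * `|grad f x k ij.1 ij.2| <= 4 / sigma * m].
  case: ij => i j; have [c [a [e g]]] := pw_affine_entry t i j pf.
  have [m [m0 h1 h2 h3]] := inverse_affine K_gt0 K_bound sigma_gt0 balls Omega_neq0 t c a.
  exists m; split => //=.
  - apply: le_trans h1 _; rewrite le_eqVlt; apply/orP; left; apply/eqP.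
    apply: (J_eq Th) => x _; rewrite indicE; have [xt|] := boolP (x \in cell t).
      by rewrite e // ; apply: cell_sub_elem; rewrite in_setE in xt.
    by rewrite !mul0r.
  - by move=> x xt; rewrite e //; exact: h2.
  - by move=> x k xt; rewrite g //; exact: h3.
have [m hm] := choice ex.
have m0 ij : 0 <= m ij by have [] := hm ij.
have s4 : 0 <= 4 / sigma by rewrite divr_ge0 // ltW.
have s16 : 16 / sigma = 4 * (4 / sigma) by rewrite mulrA; congr (_ / _); ring.
pose S := \sum_i \sum_j m (i, j).
have S0 : 0 <= S by apply: sumr_ge0 => i _; apply: sumr_ge0.
exists ((1 + 16 / sigma) * S); split.
- by rewrite mulr_ge0 // s16 addr_ge0 // mulr_ge0.
- have S2 : S ^+ 2 <= 9 * \sum_i \sum_j m (i, j) ^+ 2.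
    apply: le_trans (sqr_sum_le _) _.
    have -> : 9 = 3%:R * 3%:R :> R by rewrite -natrM.
    rewrite -mulrA ler_wpM2l // mulr_sumr; apply: ler_sum => i _; exact: sqr_sum_le.
  have sh0 : 0 < (sigma * h / 4) ^+ 3 by rewrite exprn_gt0 // divr_gt0 // mulr_gt0.
  have mJ : \sum_i \sum_j m (i, j) ^+ 2 <= (sigma * h / 4) ^- 3 *
      J (fun x => \1_(cell t) x * sqnorm f x).
    have gij i j : good Th (fun x => \1_(cell t) x * f x i j ^+ 2).
      apply: good_cell; apply: good_exp; exact: ((good_jet K_bound 0 0 pf).1 i j).
    have -> : J (fun x => \1_(cell t) x * sqnorm f x) =
        \sum_i \sum_j J (fun x => \1_(cell t) x * f x i j ^+ 2).
      under eq_bigr do rewrite -(J_sum Th K_gt0 K_bound) //.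
      rewrite -(J_sum Th K_gt0 K_bound); last by move=> i; exact: good_sum.
      apply: (J_eq Th) => x _; rewrite /sqnorm /frob mulr_sumr.
      by apply: eq_bigr => i _; rewrite mulr_sumr; apply: eq_bigr => j _; rewrite expr2.
    rewrite mulr_sumr; apply: ler_sum => i _; rewrite mulr_sumr; apply: ler_sum => j _.
    by rewrite ler_pdivlMl //; have [] := hm (i, j).
  rewrite exprMn /inverse_const.
  have c0 : 0 <= (1 + 16 / sigma) ^+ 2 by exact: sqr_ge0.
  apply: le_trans (ler_wpM2l c0 (le_trans S2 (ler_wpM2l (ler0n _ 9) mJ))) _.
  rewrite le_eqVlt; apply/orP; left; apply/eqP.
  by field; rewrite !gt_eqF.
- move=> x i j xt; have [_ _ h2 _] := hm (i, j); apply: le_trans (h2 x xt) _ => /=.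
  apply: ler_pM => //; first by rewrite addr_ge0.
    by rewrite s16; lra.
  rewrite /S (bigD1 i) //= (bigD1 j) //= -addrA lerDl addr_ge0 //.
    by apply: sumr_ge0.
  by apply: sumr_ge0 => l _; apply: sumr_ge0.
- move=> x xt; rewrite /jnorm mulr_sumr.
  have h1 : mx1 (jet_of f x).1 <= (1 + 4 / sigma) * S.
    rewrite /S mulr_sumr; apply: ler_sum => i _; rewrite mulr_sumr; apply: ler_sum => j _.
    by have [_ _ h2 _] := hm (i, j); apply: h2; exact: cell_sub_elem.
  have h2 k : h * mx1 ((jet_of f x).2 k) <= 4 / sigma * S.
    rewrite /S /mx1 !mulr_sumr; apply: ler_sum => i _; rewrite !mulr_sumr; apply: ler_sum => j _.
    by have [_ _ _ h3] := hm (i, j); exact: h3.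
  have h3 : \sum_k h * mx1 ((jet_of f x).2 k) <= \sum_(k < 3) 4 / sigma * S.
    by apply: ler_sum => k _; exact: h2.
  apply: le_trans (lerD h1 h3) _; rewrite sumr_const card_ord -mulr_natl s16.
  by rewrite le_eqVlt; apply/orP; left; apply/eqP; ring.
Qed.

Lemma good_sqnorm f : pw_affine Th f -> good Th (sqnorm f).
Proof. by move=> pf; exact: (good_frob K_bound pf pf). Qed.

Lemma J_cell_part t f : pw_affine Th f ->
  J (fun x => \1_(cell t) x * sqnorm f x) <= J (sqnorm f).
Proof.
move=> pf; have gf := good_sqnorm pf; apply: (J_le K_gt0 K_bound (good_cell t gf) gf).
move=> x _; rewrite indicE; case: (_ \in _); rewrite ?mul1r ?mul0r //.
exact: frob_ge0.
Qed.

Lemma J_sqnorm_ge0 f : pw_affine Th f -> 0 <= J (sqnorm f).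
Proof.
move=> pf; apply: (J_ge0 K_gt0 K_bound (good_sqnorm pf)).
by move=> x _; exact: frob_ge0.
Qed.

Lemma field_sup f x i j : pw_affine Th f -> closure Omega x ->
  f x i j ^+ 2 <= inverse_const sigma * h ^- 3 * J (sqnorm f).
Proof.
have h_gt0 := meshsize_gt0 Th K_gt0 K_bound Omega_neq0; move=> pf; rewrite (elem_cover Th) => -[t _ xt].
have [m [m0 h1 h2 _]] := field_inverse t pf.
apply: (@le_trans _ _ (m ^+ 2)).
  by rewrite -[leLHS]real_normK ?num_real // ler_sqr ?nnegrE // h2.
apply: le_trans h1 _; apply: ler_wpM2l; last exact: J_cell_part.
by rewrite mulr_ge0 ?inverse_const_ge0 // invr_ge0 exprn_ge0 // ltW.
Qed.

Lemma jnorm_sup f x : pw_affine Th f -> cells Th x ->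
  jnorm h (jet_of f x) ^+ 2 <= inverse_const sigma * h ^- 3 * J (sqnorm f).
Proof.
have h_gt0 := meshsize_gt0 Th K_gt0 K_bound Omega_neq0; move=> pf [t _ xt]; have [m [m0 h1 _ h3]] := field_inverse t pf.
have n0 := jnorm_ge0 (jet_of f x) (ltW h_gt0).
apply: (@le_trans _ _ (m ^+ 2)); first by rewrite ler_sqr ?nnegrE // h3.
apply: le_trans h1 _; apply: ler_wpM2l; last exact: J_cell_part.
by rewrite mulr_ge0 ?inverse_const_ge0 // invr_ge0 exprn_ge0 // ltW.
Qed.

(** Unlike the bound on the supremum, this one loses no power of h: the factor
    h^-3 is compensated by the volume of the cell, at most 64 h^3. *)
Lemma jnorm_L2 f : pw_affine Th f ->
  J (fun x => jnorm h (jet_of f x) ^+ 2) <= 64 * inverse_const sigma * J (sqnorm f).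
Proof.
have h_gt0 := meshsize_gt0 Th K_gt0 K_bound Omega_neq0; move=> pf; have gf := good_sqnorm pf.
have gj := good_exp 2 (good_jnorm K_bound h pf).
rewrite (J_split K_gt0 K_bound gj) (J_split K_gt0 K_bound gf) mulr_sumr.
apply: ler_sum => t _.
have [m [m0 h1 _ h3]] := field_inverse t pf.
have [x0 x0t] := elem_nondegenerate t.
have vol : J (\1_(cell t)) <= (4 * h) ^+ 3.
  apply: (J_cell_le (x0 := x0) h_gt0) => x k xt.
  apply: le_trans (dist_le_meshsize K_gt0 K_bound (cell_sub_elem xt) (cell_sub_elem x0t)).
  by apply: le_trans (coord_le_enorm _ k); rewrite !mxE.
have g1 : good Th (\1_(cell t)) by apply: good_indic; exact: measurable_cell.
apply: (@le_trans _ _ (J (fun x => m ^+ 2 * \1_(cell t) x))).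
  apply: (J_le K_gt0 K_bound (good_cell t gj) (goodZ (m ^+ 2) g1)).
  move=> x _; rewrite indicE; have [xt|] := boolP (x \in cell t); last by rewrite mulr0 mul0r.
  rewrite mul1r mulr1 ler_sqr ?nnegrE //; last exact: jnorm_ge0 (ltW h_gt0).
  by apply: h3; rewrite in_setE in xt.
rewrite (JZ Th K_gt0 K_bound) //.
have m20 := sqr_ge0 m.
apply: le_trans (ler_wpM2l m20 vol) _.
have v0 : 0 <= (4 * h) ^+ 3 by rewrite exprn_ge0 // mulr_ge0 // ltW.
apply: le_trans (ler_wpM2r v0 h1) _.
rewrite le_eqVlt; apply/orP; left; apply/eqP.
by field; rewrite gt_eqF.
Qed.

Variables (p : params R) (CL : R).
Hypothesis CL_ge0 : 0 <= CL.
Hypothesis CL_lip : forall (s : R) (j1 j2 j f : jet R), 0 < s -> s <= 4 * K ->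
  `|h_dens p j1 j f - h_dens p j2 j f| <= CL * s^-1 ^+ 2 *
    (1 + jnorm s j1 + jnorm s j2 + jnorm s j) ^+ 2 *
    jnorm s (jlin (-1) j2 j1) * jnorm s f.

(** The factor q^2 of the Lipschitz bound on the density. Only its integral is
    estimated, by the L2 norms of the fields, which costs no power of h. *)
Definition weight Q1 Q2 Q x : R :=
  (1 + jnorm h (jet_of Q1 x) + jnorm h (jet_of Q2 x) + jnorm h (jet_of Q x)) ^+ 2.

Lemma good_weight Q1 Q2 Q : pw_affine Th Q1 -> pw_affine Th Q2 -> pw_affine Th Q ->
  good Th (weight Q1 Q2 Q).
Proof.
move=> p1 p2 pQ; refine (good_exp 2 (goodD (goodD (goodD (good_cst Th 1) (good_jnorm K_bound h p1)) (good_jnorm K_bound h p2)) (good_jnorm K_bound h pQ))).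
Qed.

(** The differences of the solutions and the test field are bounded in
    supremum, by D and E; the weight stays under the integral, as its supremum
    would cost further powers of h. *)
Lemma H_lipschitz Q1 Q2 Q f (D E : R) : pw_affine Th Q1 -> pw_affine Th Q2 ->
  pw_affine Th Q -> pw_affine Th f -> 0 <= D -> 0 <= E ->
  (forall x, cells Th x -> jnorm h (jet_of (fun x => -1 *: Q2 x + Q1 x) x) <= D) ->
  (forall x, cells Th x -> jnorm h (jet_of f x) <= E) ->
  `|H p Omega Q1 Q f - H p Omega Q2 Q f| <=
    CL * h^-1 ^+ 2 * D * E * J (weight Q1 Q2 Q).
Proof.
have h_gt0 := meshsize_gt0 Th K_gt0 K_bound Omega_neq0; move=> p1 p2 pQ pf D0 E0 hD hE; have pd := pw_affine_lin (-1) p2 p1.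
have g1 := good_hden K_bound p p1 pQ pf; have g2 := good_hden K_bound p p2 pQ pf.
have g2' := goodZ (-1) g2; have gw := good_weight p1 p2 pQ.
rewrite (H_J K_gt0 K_bound p p1 pQ pf) (H_J K_gt0 K_bound p p2 pQ pf) -[- J _]mulN1r -(JZ Th K_gt0 K_bound (-1) g2) -(JD Th K_gt0 K_bound g1 g2').
apply: le_trans (J_norm K_gt0 K_bound (goodD g1 g2')) _.
rewrite -(JZ Th K_gt0 K_bound _ gw).
apply: (J_le K_gt0 K_bound (good_norm (goodD g1 g2')) (goodZ _ gw)).
move=> x cx; rewrite mulN1r /hden.
apply: le_trans (CL_lip _ _ _ _ h_gt0 (meshsize_le Th K_gt0 K_bound)) _.
rewrite -(jet_lin (-1) p2 p1 cx) -/(weight Q1 Q2 Q x).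
have := hD x cx; have := hE x cx.
have := jnorm_ge0 (jet_of f x) (ltW h_gt0).
have := jnorm_ge0 (jet_of (fun x => -1 *: Q2 x + Q1 x) x) (ltW h_gt0).
move: (jnorm _ _) (jnorm _ _) => d e d0 e0 eE dD.
have w0 : 0 <= weight Q1 Q2 Q x by exact: sqr_ge0.
have c0 : 0 <= CL * h^-1 ^+ 2 by rewrite mulr_ge0 ?sqr_ge0.
have := ler_wpM2l (mulr_ge0 c0 w0) (ler_pM d0 e0 dD eE).
move: (CL * _) (weight _ _ _ _) => u v.
have -> : u * D * E * v = u * v * (D * E) by ring.
by rewrite !mulrA.
Qed.

End InverseFields.

(** * The finite element spaces *)

Section Spaces.
Variables (R : realType) (Omega : set 'rV[R]_3) (Th : triangulation Omega).
Implicit Types (Q f g : tensor_field R) (G : tensor_field R).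

Lemma symtl_lin c (A B : 'M[R]_3) : symtl A -> symtl B -> symtl (c *: A + B).
Proof.
move=> [tA trA] [tB trB]; split.
  by rewrite linearD linearZ /= tA tB.
by rewrite mxtraceD mxtraceZ trA trB mulr0 addr0.
Qed.

Lemma P1_pw f : P1_field Th f -> pw_affine Th f. Proof. by case. Qed.
Lemma Th0_pw f : Th0 Th f -> pw_affine Th f. Proof. by case => /P1_pw. Qed.

Lemma within_continuous_lin (A : set 'rV[R]_3) c f g :
  {within A, continuous f} -> {within A, continuous g} ->
  {within A, continuous (fun x => c *: f x + g x)}.
Proof.
move=> cf cg x; apply: (@cvgD _ 'M[R]_3); last exact: cg.
by apply: (@cvgZr _ 'M[R]_3); exact: cf.
Qed.

Lemma P1_lin c f g : P1_field Th f -> P1_field Th g ->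
  P1_field Th (fun x => c *: f x + g x).
Proof.
move=> [cf af sf] [cg ag sg]; split.
- exact: within_continuous_lin.
- exact: pw_affine_lin.
- by move=> x xO; apply: symtl_lin; [exact: sf|exact: sg].
Qed.

Lemma P1_eq f g : (forall x, closure Omega x -> f x = g x) -> P1_field Th f -> P1_field Th g.
Proof.
move=> fg [cf af sf]; split.
- by apply: subspace_eq_continuous cf => x; rewrite inE => /fg.
- move=> t; have [A [B h]] := af t; exists A, B => x xt.
  by rewrite -fg ?h //; exact: elem_sub_closure xt.
- by move=> x xO; rewrite -fg //; exact: sf.
Qed.

Lemma Th0_lin c f g : Th0 Th f -> Th0 Th g -> Th0 Th (fun x => c *: f x + g x).
Proof.
move=> [pf bf] [pg bg]; split; first exact: P1_lin.
by move=> x xb; rewrite bf // bg // scaler0 addr0.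
Qed.

Lemma Th0_eq f g : (forall x, closure Omega x -> f x = g x) -> Th0 Th f -> Th0 Th g.
Proof.
move=> fg [pf bf]; split; first exact: P1_eq pf.
by move=> x xb; rewrite -fg ?bf //; case: xb.
Qed.

Lemma pw_affine_zero : pw_affine Th (fun=> 0).
Proof.
move=> t; exists 0, (fun=> 0) => x _; rewrite add0r big1 // => k _.
by rewrite scaler0.
Qed.

Lemma Th0_zero : Th0 Th (fun=> 0).
Proof.
split => //; split; last by move=> x _; split; [rewrite trmx0|rewrite mxtrace0].
- by apply: continuous_subspaceT => x; exact: cst_continuous.
- exact: pw_affine_zero.
Qed.

Lemma ThG_P1 G Q : ThG Th G Q -> P1_field Th Q.
Proof.
move=> [Gh [f [[pG _] [pf _] Qe]]]; apply: P1_eq (P1_lin 1 pf pG) => x xO.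
by rewrite scale1r Qe.
Qed.

Lemma ThG_pw G Q : ThG Th G Q -> pw_affine Th Q.
Proof. by move/ThG_P1/P1_pw. Qed.

Lemma ThG_sym G Q x : ThG Th G Q -> closure Omega x -> (Q x)^T = Q x.
Proof. by move=> /ThG_P1[_ _ h] /h[]. Qed.

(** Piecewise affine fields are determined by their values at the vertices.
    Uniqueness of G_h makes differences of elements of T_h^G test fields. *)
Lemma is_Gh_unique G g1 g2 : is_Gh Th G g1 -> is_Gh Th G g2 ->
  forall x, closure Omega x -> g1 x = g2 x.
Proof.
move=> [p1 h1] [p2 h2] x xO.
have p12 := pw_affine_lin (-1) (P1_pw p1) (P1_pw p2).
have : -1 *: g1 x + g2 x = 0.
  apply: (vertex_vanish p12) => // t i.
  have [a1 b1] := h1 t i; have [a2 b2] := h2 t i.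
  have [vb|vb] := pselect (boundary Omega (vertex t i)).
    by rewrite a1 // a2 // scaleN1r addNr.
  by rewrite b1 // b2 // scaler0 addr0.
by rewrite scaleN1r addrC => /eqP; rewrite subr_eq0 => /eqP ->.
Qed.

Lemma ThG_sub G Q Q' : ThG Th G Q -> ThG Th G Q' -> Th0 Th (fun x => -1 *: Q x + Q' x).
Proof.
move=> [Gh [f [hG tf Qe]]] [Gh' [f' [hG' tf' Qe']]].
apply: Th0_eq (Th0_lin (-1) tf tf') => x xO.
rewrite Qe // Qe' // (is_Gh_unique hG hG') // scalerDr addrACA.
by rewrite [-1 *: Gh' x]scaleN1r addNr addr0.
Qed.

Lemma ThG_add G Q f : ThG Th G Q -> Th0 Th f -> ThG Th G (fun x => Q x + f x).
Proof.
move=> [Gh [g [hG tg Qe]]] tf; exists Gh, (fun x => 1 *: g x + f x); split => //.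
  exact: Th0_lin.
by move=> x xO; rewrite Qe // scale1r addrAC.
Qed.

Definition comb n (phi : 'I_n -> tensor_field R) (u : 'rV[R]_n) : tensor_field R :=
  fun x => \sum_i u 0 i *: phi i x.

Lemma Th0_comb n (phi : 'I_n -> tensor_field R) u :
  (forall i, Th0 Th (phi i)) -> Th0 Th (comb phi u).
Proof.
move=> tphi.
have h (s : seq 'I_n) : Th0 Th (fun x => \sum_(i <- s) u 0 i *: phi i x).
  elim: s => [|i s IH].
    by apply: Th0_eq Th0_zero => x _; rewrite big_nil.
  by apply: Th0_eq (Th0_lin (u 0 i) (tphi i) IH) => x _; rewrite big_cons.
exact: h.
Qed.

(** The linearity of the functionals of interest is known on piecewise affine
    fields only, so these cannot be treated as linear maps on the space of all
    fields. *)
Lemma functional_comb n (phi : 'I_n -> tensor_field R) (L : tensor_field R -> R) u :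
  (forall i, pw_affine Th (phi i)) ->
  (forall c f g, pw_affine Th f -> pw_affine Th g ->
     L (fun x => c *: f x + g x) = c * L f + L g) ->
  L (comb phi u) = \sum_i u 0 i * L (phi i).
Proof.
move=> pphi hL.
have h (s : seq 'I_n) : pw_affine Th (fun x => \sum_(i <- s) u 0 i *: phi i x) /\
    L (fun x => \sum_(i <- s) u 0 i *: phi i x) = \sum_(i <- s) u 0 i * L (phi i).
  elim: s => [|i s [IH1 IH2]].
    have -> : (fun x => \sum_(i <- [::]) u 0 i *: phi i x) = (fun=> 0).
      by apply/funext => x; rewrite big_nil.
    split; first exact: pw_affine_zero.
    have := hL (-1) _ _ pw_affine_zero pw_affine_zero; rewrite mulN1r addNr big_nil => <-.
    by congr L; apply/funext => x; rewrite scaler0 addr0.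
  have -> : (fun x => \sum_(j <- i :: s) u 0 j *: phi j x) =
      (fun x => u 0 i *: phi i x + \sum_(j <- s) u 0 j *: phi j x).
    by apply/funext => x; rewrite big_cons.
  split; first exact: pw_affine_lin.
  by rewrite hL // IH2 big_cons.
exact: (h (index_enum 'I_n)).2.
Qed.

Definition vtx_index := (('I_(nelem Th) * 'I_4) * ('I_3 * 'I_3))%type.

(** The values at the vertices, which determine a piecewise affine field;
    linear independence of fields is read on these rows. *)
Definition vtx_row f : 'rV[R]_#|{: vtx_index}| :=
  \row_q let: ((t, k), (i, j)) := enum_val q in f (vertex t k) i j.

Lemma vtx_row_entry f t k i j :
  vtx_row f 0 (enum_rank ((t, k), (i, j))) = f (vertex t k) i j.
Proof. by rewrite mxE enum_rankK. Qed.

Lemma vtx_row_comb n (phi : 'I_n -> tensor_field R) u :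
  vtx_row (comb phi u) = u *m \matrix_i vtx_row (phi i).
Proof.
apply/rowP => q; rewrite !mxE; case e: (enum_val q) => [[t k] [i j]].
by rewrite /comb summxE; apply: eq_bigr => l _; rewrite !mxE e.
Qed.

(** A free family of maximal size among rows of vertex values. It spans, since
    otherwise it could be extended; a right inverse of its matrix recovers the
    coordinates from the vertex values, with a bound. *)
Lemma Th0_basis : exists n (phi : 'I_n -> tensor_field R),
  [/\ forall i, Th0 Th (phi i),
      forall f, Th0 Th f -> exists u, forall x, closure Omega x -> f x = comb phi u x &
      exists2 C, 0 <= C & forall u (m : R), 0 <= m ->
        (forall (t : 'I_(nelem Th)) k i j, `|comb phi u (vertex t k) i j| <= m) ->
        forall i, `|u 0 i| <= C * m].
Proof.
pose P (n : nat) := `[< exists phi : 'I_n -> tensor_field R,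
  (forall i, Th0 Th (phi i)) /\ row_free (\matrix_i vtx_row (phi i)) >].
have P0 : exists n, P n.
  exists 0%N; apply/asboolP; exists (fun _ _ => 0); split => //.
    by move=> i; exact: Th0_zero.
  by rewrite /row_free -leqn0 rank_leq_row.
have Pb n : P n -> (n <= #|{: vtx_index}|)%N.
  by move=> /asboolP[phi [_ /eqP <-]]; exact: rank_leq_col.
case: (ex_maxnP P0 Pb) => n /asboolP[phi [tphi free]] nmax.
have tcomb u : Th0 Th (comb phi u) := Th0_comb u tphi.
exists n, phi; split => //.
- move=> f tf.
  have [/submxP[u fu]|nsub] := boolP (vtx_row f <= \matrix_i vtx_row (phi i))%MS.
    exists u => x xO.
    have p := pw_affine_lin (-1) (Th0_pw (tcomb u)) (Th0_pw tf).
    have : -1 *: comb phi u x + f x = 0.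
      apply: (vertex_vanish p) => // t k; apply/matrixP => i j.
      rewrite !mxE -!vtx_row_entry vtx_row_comb fu; ring.
    by rewrite scaleN1r addrC => /eqP; rewrite subr_eq0 => /eqP.
  exfalso; have := nmax n.+1; rewrite ltnn => /(_ _) h; suff : false by []; apply: h.
  pose psi (i : 'I_n.+1) := if unlift ord0 i is Some j then phi j else f.
  have psi0 : psi ord0 = f by rewrite /psi unlift_none.
  have psiS j : psi (lift ord0 j) = phi j by rewrite /psi liftK.
  apply/asboolP; exists psi.
  split; first by move=> i; rewrite /psi; case: (unlift ord0 i).
  set A := (\matrix_i vtx_row (phi i)) in free nsub *.
  have -> : (\matrix_i vtx_row (psi i)) =
      col_mx (vtx_row f) A :> 'M[R]_(1 + n, #|{: vtx_index}|).
    apply/row_matrixP => i; rewrite rowK.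
    have [j|] := unliftP (ord0 : 'I_n.+1) i => ->.
      rewrite psiS; have -> : lift (ord0 : 'I_n.+1) j = rshift 1 j :> 'I_(1 + n) by apply/val_inj.
      by rewrite rowKd rowK.
    rewrite psi0; have -> : ord0 = lshift n (ord0 : 'I_1) :> 'I_(1 + n) by apply/val_inj.
    by rewrite rowKu row_id.
  have lt : (n < \rank (col_mx (vtx_row f) A))%N.
    rewrite -{1}(eqP free) -addsmxE.
    apply: rank_ltmx; rewrite ltmxE addsmxSr /=.
    by apply: contra nsub => /(submx_trans (addsmxSl _ _)).
  by rewrite /row_free eqn_leq rank_leq_row.
- have /row_freeP[B AB] := free.
  exists (\sum_q \sum_i `|B q i|).
    by apply: sumr_ge0 => q _; apply: sumr_ge0.
  move=> u m m0 hm i.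
  have -> : u = vtx_row (comb phi u) *m B by rewrite vtx_row_comb -mulmxA AB mulmx1.
  rewrite mxE; apply: le_trans (ler_norm_sum _ _ _) _; rewrite mulr_suml.
  apply: ler_sum => q _; rewrite normrM mulrC; apply: ler_pM => //.
    by rewrite (bigD1 i) //= lerDl; apply: sumr_ge0.
  rewrite mxE; case: (enum_val q) => [[t k] [a b]]; exact: hm.
Qed.

End Spaces.

(** * One step of the scheme *)

Section Step.
Variables (R : realType) (Omega : set 'rV[R]_3) (Th : triangulation Omega).
Implicit Types (Q f g : tensor_field R).
Variable K : R.
Hypothesis K_gt0 : 0 < K.
Hypothesis K_bound : forall x k, closure Omega x -> `|x 0 k| <= K.
Variable p : params R.
Hypotheses (L1_gt0 : 0 < L1 p) (L2_gt0 : 0 < L2 p) (L3_gt0 : 0 < L3 p)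
  (L4_gt0 : 0 < L4 p) (L5_ge0 : 0 <= L5 p) (M_gt0 : 0 < M p).
Variable C0 : R.
Hypothesis C0_bulk : forall A : 'M[R]_3, A^T = A -> frob A A - C0 <= bulk p A.
Variable G : tensor_field R.
Local Notation J := (integral3 Omega).
Local Notation jD := (JD Th K_gt0 K_bound).
Local Notation jZ := (JZ Th K_gt0 K_bound).
Local Notation jle := (J_le (Th := Th) K_gt0 K_bound).

Definition volume_bound : R := (4 * K) ^+ 3.

Lemma volume_bound_ge0 : 0 <= volume_bound.
Proof. by rewrite exprn_ge0 // mulr_ge0 // ltW. Qed.

Lemma J1_le : 0 <= J (fun=> 1) <= volume_bound.
Proof.
apply/andP; split; first by apply: (J_ge0 K_gt0 K_bound (good_cst Th 1)).
have -> : J (fun=> 1) = J (\1_(cells Th)).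
  by apply: (J_eq Th) => x cx; rewrite indicE mem_set.
rewrite (J_indic (Th := Th) (measurable_cells Th)) //.
have b : (leb3m R (@vec3 R @^-1` cells Th) <= ((4 * K) ^+ 3)%:E)%E.
  apply: (sub_big_box (x0 := 0) K_gt0); first exact: measurable_cells.
  by move=> x k cx; rewrite mxE subr0; apply: K_bound; exact: cells_sub_closure cx.
rewrite -[leRHS]/(fine ((4 * K) ^+ 3)%:E); apply: fine_le => //.
rewrite ge0_fin_numE //; apply: le_lt_trans b _; exact: ltry.
Qed.

(** The elastic terms are nonnegative, and the bulk term is coercive; the
    constant C0 is integrated over a domain of bounded volume. *)
Lemma energy_lower Q : pw_affine Th Q ->
  (forall x, closure Omega x -> (Q x)^T = Q x) ->
  J (sqnorm Q) - `|C0| * volume_bound <= energy p Omega Q.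
Proof.
move=> pQ sQ; rewrite energy_J.
have gs := good_sqnorm K_bound pQ; have gc := good_cst Th (- `|C0|).
have /andP[v0 v1] := J1_le.
apply: (@le_trans _ _ (J (fun x => sqnorm Q x + - `|C0|))).
  rewrite (jD gs gc) lerD2l.
  have -> : J (fun=> - `|C0|) = - `|C0| * J (fun=> 1).
    by rewrite -(jZ _ (good_cst Th 1)); apply: (J_eq Th) => x _; rewrite mulr1.
  by rewrite mulNr lerN2 ler_wpM2l.
apply: (jle (goodD gs gc) (good_eden K_bound p pQ)) => x cx.
have b := C0_bulk (sQ x (cells_sub_closure cx)).
rewrite /e_dens; have := frob_ge0 (S1 p (jet_of Q x).1 *m jdiv (jet_of Q x)).
have := frob_ge0 (S1 p (jet_of Q x).1 *m jcurl (jet_of Q x)).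
have := frob_ge0 (S2 p (jet_of Q x).1 *m jdiv (jet_of Q x)).
have := frob_ge0 (S2 p (jet_of Q x).1 *m jcurl (jet_of Q x)).
move: (frob (S2 _ _ *m jcurl _) _) (frob (S2 _ _ *m jdiv _) _)
  (frob (S1 _ _ *m jcurl _) _) (frob (S1 _ _ *m jdiv _) _) => u1 u2 u3 u4 h1 h2 h3 h4.
have h5 : 0 <= L5 p / 2 * frob (jet_of Q x).1 (jet_of Q x).1 * graddot (jet_of Q x).2 (jet_of Q x).2.
  by rewrite !mulr_ge0 ?frob_ge0 ?graddot_ge0 // divr_ge0.
have k1 := mulr_ge0 (ltW L1_gt0) h4; have k2 := mulr_ge0 (ltW L2_gt0) h3.
have k3 := mulr_ge0 (ltW L3_gt0) h2; have k4 := mulr_ge0 (ltW L4_gt0) h1.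
have cle : - `|C0| <= - C0 by rewrite lerN2 ler_norm.
move: h5 b; rewrite /sqnorm /=.
lra.
Qed.

Lemma good_pair Q f : pw_affine Th Q -> pw_affine Th f -> good Th (fun x => frob (Q x) (f x)).
Proof. by move=> pQ pf; exact: (good_frob K_bound pQ pf). Qed.

Lemma J_pair_lin Q f g c : pw_affine Th Q -> pw_affine Th f -> pw_affine Th g ->
  J (fun x => frob (Q x) (c *: f x + g x)) =
  c * J (fun x => frob (Q x) (f x)) + J (fun x => frob (Q x) (g x)).
Proof.
move=> pQ pf pg; have g1 := good_pair pQ pf; have g2 := good_pair pQ pg.
rewrite -(jZ c g1) -(jD (goodZ c g1) g2); apply: (J_eq Th) => x _.
by rewrite frobDr frobZr.
Qed.

Lemma scheme_stepE dt Q Q' f : pw_affine Th Q -> pw_affine Th Q' -> pw_affine Th f ->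
  integral3 Omega (fun x => frob (dt^-1 *: (Q' x - Q x)) (f x)) =
  dt^-1 * J (fun x => frob (-1 *: Q x + Q' x) (f x)).
Proof.
move=> pQ p' pf; rewrite -(jZ dt^-1 (good_pair (pw_affine_lin (-1) pQ p') pf)).
by congr (integral3 Omega _); apply/funext => x; rewrite frobZl scaleN1r [- Q x + _]addrC.
Qed.

(** The step is tested with the increment Q' - Q, for which H is the increment
    of the energy. *)
Lemma energy_decay dt Q Q' : 0 < dt -> ThG Th G Q -> ThG Th G Q' ->
  scheme_step p Th dt Q Q' -> energy p Omega Q' <= energy p Omega Q.
Proof.
move=> dt0 hQ hQ' /(_ _ (ThG_sub hQ hQ')).
have pQ := ThG_pw hQ; have p' := ThG_pw hQ'; have pd := pw_affine_lin (-1) pQ p'.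
rewrite scheme_stepE // (H_diff K_gt0 K_bound p p' pQ (fun x => ThG_sym hQ' (x := x)) (fun x => ThG_sym hQ (x := x))).
have d0 : 0 <= dt^-1 * J (sqnorm (fun x => -1 *: Q x + Q' x)).
  by rewrite mulr_ge0 ?invr_ge0 ?(ltW dt0) // (J_sqnorm_ge0 K_gt0 K_bound pd).
rewrite -[J _]/(J (sqnorm (fun x => -1 *: Q x + Q' x))) => e.
by move: d0; rewrite e mulNr oppr_ge0 pmulr_rle0 // subr_le0.
Qed.

Lemma iterates_ThG dt n (Q : nat -> tensor_field R) : scheme_iterates p Th G dt n Q -> ThG Th G (Q n).
Proof. by case: n => [|n] [h0 h]; [exact: h0|case: (h n (ltnSn n))]. Qed.

Lemma iterates_energy dt n (Q : nat -> tensor_field R) : 0 < dt -> scheme_iterates p Th G dt n Q ->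
  energy p Omega (Q n) <= energy p Omega (Q 0%N).
Proof.
move=> dt0; elim: n => [//|n IH] [h0 h].
have it : scheme_iterates p Th G dt n Q by split => // k kn; apply: h; exact: ltnW.
have [hn st] := h n (ltnSn n).
exact: le_trans (energy_decay dt0 (iterates_ThG it) hn st) (IH it).
Qed.

(** The absolute values make the bound nonnegative whatever the signs of E0 and
    C0. *)
Lemma L2_bound Q E0 : ThG Th G Q -> energy p Omega Q <= E0 ->
  J (sqnorm Q) <= `|E0| + `|C0| * volume_bound.
Proof.
move=> hQ hE; have := energy_lower (ThG_pw hQ) (fun x => ThG_sym hQ (x := x)).
by have := ler_norm E0; lra.
Qed.

Variable sigma : R.
Hypothesis sigma_gt0 : 0 < sigma.
Hypothesis balls : forall t, exists x r, sigma * meshsize Th <= r /\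
      [set y | enorm (y - x) <= r] `<=` elem (t0 := Th) t.
Hypothesis Omega_neq0 : Omega !=set0.
Local Notation h := (meshsize Th).
Variable CL : R.
Hypothesis CL_ge0 : 0 <= CL.
Hypothesis CL_lip : forall (s : R) (j1 j2 j f : jet R), 0 < s -> s <= 4 * K ->
  `|h_dens p j1 j f - h_dens p j2 j f| <= CL * s^-1 ^+ 2 *
    (1 + jnorm s j1 + jnorm s j2 + jnorm s j) ^+ 2 *
    jnorm s (jlin (-1) j2 j1) * jnorm s f.

Lemma J_weight_le Q1 Q2 Q : pw_affine Th Q1 -> pw_affine Th Q2 -> pw_affine Th Q ->
  J (weight Th Q1 Q2 Q) <= 4 * (volume_bound + 64 * inverse_const sigma *
    (J (sqnorm Q1) + J (sqnorm Q2) + J (sqnorm Q))).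
Proof.
move=> p1 p2 pQ.
pose n2 (f : tensor_field R) x := jnorm h (jet_of f x) ^+ 2.
have gn f (pf : pw_affine Th f) : good Th (n2 f).
  exact: (good_exp 2 (good_jnorm K_bound h pf)).
have g12 := goodD (gn _ p1) (gn _ p2); have g12Q := goodD g12 (gn _ pQ).
have g1 := good_cst Th (1 : R); have gall := goodD g1 g12Q.
apply: (@le_trans _ _ (J (fun x => 4 * (1 + (n2 Q1 x + n2 Q2 x + n2 Q x))))).
  apply: (jle (good_weight K_bound p1 p2 pQ) (goodZ 4 gall)) => x _.
  rewrite /weight /n2; move: (jnorm _ _) (jnorm _ _) (jnorm _ _) => a b c.
  have := sqr_ge0 (1 - a); have := sqr_ge0 (1 - b); have := sqr_ge0 (1 - c).
  have := sqr_ge0 (a - b); have := sqr_ge0 (a - c); have := sqr_ge0 (b - c).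
  rewrite !expr2; lra.
rewrite (jZ 4 gall) (jD g1 g12Q) (jD g12 (gn _ pQ)) (jD (gn _ p1) (gn _ p2)).
have /andP[_ v1] := J1_le.
have L2 f (pf : pw_affine Th f) := jnorm_L2 K_gt0 K_bound sigma_gt0 balls Omega_neq0 pf.
have l1 : J (n2 Q1) <= 64 * inverse_const sigma * J (sqnorm Q1) by exact: L2 p1.
have l2 : J (n2 Q2) <= 64 * inverse_const sigma * J (sqnorm Q2) by exact: L2 p2.
have lQ : J (n2 Q) <= 64 * inverse_const sigma * J (sqnorm Q) by exact: L2 pQ.
apply: ler_wpM2l => //; apply: lerD => //; rewrite !mulrDr.
by apply: lerD lQ; apply: lerD.
Qed.

(** With the estimate |d|^2 / dt <= M kappa h^-5 |d|^2, this is 1 / (M kappa +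
    1); the 1 makes the inequality strict. *)
Definition uniqueness_const (E0 : R) : R := (M p * (CL * inverse_const sigma *
  (4 * (volume_bound + 64 * inverse_const sigma *
     (3 * (`|E0| + `|C0| * volume_bound))))) + 1)^-1.

Lemma uniqueness_const_gt0 E0 : 0 < uniqueness_const E0.
Proof.
rewrite invr_gt0 ltr_wpDl // mulr_ge0 ?(ltW M_gt0) //.
have i0 := inverse_const_ge0 sigma_gt0; have v0 := volume_bound_ge0.
apply: mulr_ge0; first exact: mulr_ge0.
apply: mulr_ge0 => //; apply: addr_ge0 => //; apply: mulr_ge0; first exact: mulr_ge0.
apply: mulr_ge0 => //; apply: addr_ge0 => //; exact: mulr_ge0.
Qed.

(** The exponent 5 is 2 + 3: the factor h^-2 comes from the two gradients in
    the density of H, and h^-3 from bounding the square of the supremum of the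
    difference d by its L2 norm. *)
Theorem step_unique E0 dt Q Q1 Q2 : 0 < dt -> dt <= uniqueness_const E0 * h ^+ 5 ->
  energy p Omega Q <= E0 ->
  ThG Th G Q -> ThG Th G Q1 -> scheme_step p Th dt Q Q1 ->
  ThG Th G Q2 -> scheme_step p Th dt Q Q2 ->
  forall x, closure Omega x -> Q1 x = Q2 x.
Proof.
move=> dt0 dtC hE hQ h1 st1 h2 st2 x xO.
have h_gt0 : 0 < h := meshsize_gt0 Th K_gt0 K_bound Omega_neq0.
have pQ := ThG_pw hQ; have p1 := ThG_pw h1; have p2 := ThG_pw h2.
have td := ThG_sub h2 h1; have pd := Th0_pw td.
set d := fun x => -1 *: Q2 x + Q1 x in td pd.
have E1 := le_trans (energy_decay dt0 hQ h1 st1) hE.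
have E2 := le_trans (energy_decay dt0 hQ h2 st2) hE.
pose B := `|E0| + `|C0| * volume_bound.
have B1 : J (sqnorm Q1) <= B := L2_bound h1 E1.
have B2 : J (sqnorm Q2) <= B := L2_bound h2 E2.
have BQ : J (sqnorm Q) <= B := L2_bound hQ hE.
have i0 := inverse_const_ge0 sigma_gt0; have v0 := volume_bound_ge0.
pose W := 4 * (volume_bound + 64 * inverse_const sigma * (3 * B)).
have hW : J (weight Th Q1 Q2 Q) <= W.
  apply: le_trans (J_weight_le p1 p2 pQ) _; rewrite ler_wpM2l // lerD2l ler_wpM2l //.
    exact: mulr_ge0.
  lra.
have Jd0 := J_sqnorm_ge0 K_gt0 K_bound pd.
pose D := Num.sqrt (inverse_const sigma * h ^- 3 * J (sqnorm d)).
have ih0 : 0 <= inverse_const sigma * h ^- 3 * J (sqnorm d).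
  apply: mulr_ge0 => //; apply: mulr_ge0 => //; by rewrite invr_ge0 exprn_ge0 // ltW.
have D0 : 0 <= D by exact: sqrtr_ge0.
have hD y : cells Th y -> jnorm h (jet_of d y) <= D.
  move=> cy; have n0 := jnorm_ge0 (jet_of d y) (ltW h_gt0).
  rewrite -(ger0_norm n0) -sqrtr_sqr; apply: ler_wsqrtr.
  exact: (jnorm_sup K_gt0 K_bound sigma_gt0 balls Omega_neq0 pd cy).
have lip := H_lipschitz K_gt0 K_bound Omega_neq0 CL_ge0 CL_lip p1 p2 pQ pd D0 D0 hD hD.
have eq : dt^-1 * J (sqnorm d) = - M p * (H p Omega Q1 Q d - H p Omega Q2 Q d).
  have := st1 _ td; have := st2 _ td; rewrite !scheme_stepE // => e2 e1.
  rewrite mulrBr -e1 -e2 -mulrBr; congr (_ * _).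
  have g1 := good_pair (pw_affine_lin (-1) pQ p1) pd.
  have g2 := good_pair (pw_affine_lin (-1) pQ p2) pd.
  rewrite -[- J _]mulN1r -(jZ (-1) g2) -(jD g1 (goodZ (-1) g2)); apply: (J_eq Th) => y _.
  rewrite /sqnorm -frobZl -frobDl; congr frob; rewrite /d.
  by apply/matrixP => i j; rewrite !mxE; ring.
have Jd_eq0 : J (sqnorm d) = 0.
  apply/eqP; rewrite eq_le Jd0 andbT leNgt; apply/negP => Jpos.
  pose kappa := CL * inverse_const sigma * W.
  have k0 : 0 <= kappa.
    rewrite /kappa; apply: mulr_ge0; first exact: mulr_ge0.
    by apply: le_trans hW; apply: (J_ge0 K_gt0 K_bound (good_weight K_bound p1 p2 pQ)) => y _; exact: sqr_ge0.
  have up : dt^-1 * J (sqnorm d) <= M p * (kappa * h ^- 5 * J (sqnorm d)).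
    rewrite eq mulNr -mulrN; apply: ler_wpM2l; first exact: ltW.
    rewrite lerNl; have := lip; rewrite ler_norml => /andP[l1 _]; apply: le_trans l1.
    rewrite lerN2; apply: (@le_trans _ _ (CL * h^-1 ^+ 2 * D * D * W)).
      by apply: ler_wpM2l hW; do 3![apply: mulr_ge0 => //]; exact: sqr_ge0.
    rewrite -[_ * D * D]mulrA -expr2 sqr_sqrtr // /kappa.
    by rewrite le_eqVlt; apply/orP; left; apply/eqP; field; rewrite gt_eqF.
  have dtk : dt <= (M p * kappa + 1)^-1 * h ^+ 5 := dtC.
  clearbody kappa; move: up; rewrite !mulrA ler_pM2r // => up.
  have : 1 <= M p * kappa * h ^- 5 * dt by rewrite -ler_pdivrMr // mul1r.
  have h5 : 0 < h ^+ 5 by rewrite exprn_gt0.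
  have Mk : 0 <= M p * kappa by rewrite mulr_ge0 // ltW.
  have : M p * kappa * h ^- 5 * dt <= M p * kappa * (M p * kappa + 1)^-1.
    rewrite -mulrA; apply: ler_wpM2l => //.
    by rewrite mulrC ler_pdivrMr.
  have : M p * kappa * (M p * kappa + 1)^-1 < 1.
    by rewrite ltr_pdivrMr ?mul1r ?ltrDl // ltr_wpDl.
  by move=> a1 a2 a3; have := le_lt_trans (le_trans a3 a2) a1; rewrite ltxx.
have dx0 : d x = 0.
  apply/matrixP => i j; rewrite [RHS]mxE; apply/eqP; rewrite -sqrf_eq0 eq_le sqr_ge0 andbT.
  apply: le_trans (field_sup K_gt0 K_bound sigma_gt0 balls Omega_neq0 i j pd xO) _.
  by rewrite Jd_eq0 mulr0.
by move: dx0; rewrite /d scaleN1r addrC => /eqP; rewrite subr_eq0 => /eqP.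
Qed.

Section Existence.
Variables (dt : R) (Q : tensor_field R) (n : nat) (phi : 'I_n -> tensor_field R) (C1 : R).
Hypothesis dt_gt0 : 0 < dt.
Hypothesis hQ : ThG Th G Q.
Hypothesis tphi : forall i, Th0 Th (phi i).
Hypothesis C1_ge0 : 0 <= C1.
Hypothesis coord : forall u (m : R), 0 <= m ->
  (forall (t : 'I_(nelem Th)) k i j, `|comb phi u (vertex t k) i j| <= m) ->
  forall i, `|u 0 i| <= C1 * m.

Let pQ : pw_affine Th Q. Proof. exact: ThG_pw hQ. Qed.
Let pphi i : pw_affine Th (phi i). Proof. exact: Th0_pw. Qed.

Let pcomb u : pw_affine Th (comb phi u). Proof. exact: Th0_pw (Th0_comb u tphi). Qed.

Definition shifted u : tensor_field R := fun x => Q x + comb phi u x.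

Lemma shifted_ThG u : ThG Th G (shifted u).
Proof. exact: ThG_add hQ (Th0_comb u tphi). Qed.

Let pshift u : pw_affine Th (shifted u). Proof. exact: ThG_pw (shifted_ThG u). Qed.

(** The equations of the step tested with the basis fields, for the unknown
    iterate Q + comb phi u. *)
Definition residual u : 'rV[R]_n :=
  \row_i (dt^-1 * J (fun x => frob (comb phi u x) (phi i x)) +
          M p * H p Omega (shifted u) Q (phi i)).

Lemma J_comb f w : pw_affine Th f ->
  J (fun x => frob (f x) (comb phi w x)) = \sum_i w 0 i * J (fun x => frob (f x) (phi i x)).
Proof.
move=> pf.
apply: (functional_comb (Th := Th) (L := fun g => J (fun x => frob (f x) (g x)))) => //.
by move=> c g1 g2 p1 p2; exact: J_pair_lin.
Qed.

Lemma H_comb u w : H p Omega (shifted u) Q (comb phi w) =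
  \sum_i w 0 i * H p Omega (shifted u) Q (phi i).
Proof.
apply: (functional_comb (Th := Th) (L := H p Omega (shifted u) Q)) => //.
by move=> c g1 g2 p1 p2; exact: (H_lin K_gt0 K_bound).
Qed.

Lemma residual_dot u w : dotr (residual u) w =
  dt^-1 * J (fun x => frob (comb phi u x) (comb phi w x)) +
  M p * H p Omega (shifted u) Q (comb phi w).
Proof.
rewrite (J_comb w (pcomb u)) H_comb !mulr_sumr -big_split; apply: eq_bigr => i _.
by rewrite mxE /=; ring.
Qed.

Let q u := J (sqnorm (comb phi u)).
Let gram i j := J (fun x => frob (phi i x) (phi j x)).

Lemma qE u : q u = \sum_i \sum_j u 0 i * (u 0 j * gram i j).
Proof.
rewrite /q /sqnorm (J_comb u (pcomb u)); apply: eq_bigr => i _; rewrite -mulr_sumr.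
congr (_ * _); rewrite -(J_comb u (pphi i)).
by apply: (J_eq Th) => x _; rewrite frobC.
Qed.

Let kap := inverse_const sigma * h ^- 3.
Let kap_ge0 : 0 <= kap.
Proof.
rewrite mulr_ge0 ?(inverse_const_ge0 sigma_gt0) // invr_ge0 exprn_ge0 //.
exact/ltW/(meshsize_gt0 Th K_gt0 K_bound Omega_neq0).
Qed.

(** The L2 norm is equivalent to the norm of the coordinates: it controls the
    vertex values by the inverse inequality, hence the coordinates. *)
Lemma coord_le_q u : dotr u u <= (n%:R * C1 ^+ 2 * kap + 1) * q u.
Proof.
have q0 : 0 <= q u by exact: (J_sqnorm_ge0 K_gt0 K_bound (pcomb u)).
pose m := Num.sqrt (kap * q u).
have m0 : 0 <= m by exact: sqrtr_ge0.
have m2 : m ^+ 2 = kap * q u by rewrite sqr_sqrtr // mulr_ge0.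
have hu := coord m0 (u := u) _.
have {}hu i : `|u 0 i| <= C1 * m.
  apply: hu => t k a b; rewrite -sqrtr_sqr; apply: ler_wsqrtr.
  apply: (field_sup K_gt0 K_bound sigma_gt0 balls Omega_neq0 a b (pcomb u)).
  apply: elem_sub_closure; exact: (vertex_in_vhull (elem_nondegenerate t) k).
apply: (@le_trans _ _ (\sum_(i < n) C1 ^+ 2 * (kap * q u))).
  apply: ler_sum => i _; rewrite -m2 -exprMn -expr2 -[leLHS]real_normK ?num_real //.
  by rewrite ler_sqr ?nnegrE // mulr_ge0.
rewrite sumr_const card_ord -[leLHS]mulr_natl.
have -> : (n%:R * C1 ^+ 2 * kap + 1) * q u = n%:R * (C1 ^+ 2 * (kap * q u)) + q u by ring.
by rewrite lerDl.
Qed.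

(** By the discrete gradient identity the scalar product with u is q u / dt + M
    (energy (shifted u) - energy Q). The energy is bounded below, and q u tends
    to infinity with the norm of u. *)
Lemma residual_outward : exists2 rho, 0 < rho &
  forall u, norm2 u = rho -> 0 < dotr (residual u) u.
Proof.
pose kk := n%:R * C1 ^+ 2 * kap + 1.
have kk0 : 0 < kk by rewrite ltr_wpDl //; do 2![apply: mulr_ge0 => //]; exact: sqr_ge0.
pose S := `|energy p Omega Q| + `|C0| * volume_bound.
have S0 : 0 <= S by rewrite addr_ge0 // mulr_ge0 // volume_bound_ge0.
exists (1 + kk * dt * (M p * S)).
  by rewrite ltr_wpDr // !mulr_ge0 // ltW.
move=> u; set rho := 1 + _ => nu.
have rho1 : 1 <= rho by rewrite /rho lerDl !mulr_ge0 // ltW.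
have hq : rho ^+ 2 <= kk * q u by rewrite -nu sqr_norm2; exact: coord_le_q.
have rho2 : rho <= rho ^+ 2 by rewrite expr2 ler_peMr // (le_trans _ rho1).
rewrite residual_dot.
have -> : comb phi u = (fun x => -1 *: Q x + shifted u x).
  by apply/funext => x; rewrite /shifted scaleN1r addKr.
rewrite (H_diff K_gt0 K_bound p (pshift u) pQ (fun x => ThG_sym (shifted_ThG u) (x := x))
  (fun x => ThG_sym hQ (x := x))).
have -> : J (fun x => frob (-1 *: Q x + shifted u x) (-1 *: Q x + shifted u x)) = q u.
  by apply: (J_eq Th) => x _; rewrite /sqnorm /shifted scaleN1r addKr.
have low := energy_lower (pshift u) (fun x => ThG_sym (shifted_ThG u) (x := x)).
have q0 := J_sqnorm_ge0 K_gt0 K_bound (pshift u).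
have up := ler_norm (energy p Omega Q).
have h1 : - S <= energy p Omega (shifted u) - energy p Omega Q by rewrite /S; lra.
have h2 : M p * S < dt^-1 * q u.
  rewrite ltr_pdivlMl // -(ltr_pM2l kk0) mulrA; apply: lt_le_trans (le_trans rho2 hq).
  by rewrite /rho ltrDr.
have := ler_wpM2l (ltW M_gt0) h1; rewrite mulrN; lra.
Qed.

Lemma cont_add (f g : 'rV[R]_n -> R) : continuous (f : _ -> R^o) -> continuous (g : _ -> R^o) ->
  continuous (fun u => f u + g u : R^o).
Proof. by move=> cf cg u; apply: (@continuousD R R^o _ f g); [exact: cf|exact: cg]. Qed.

Lemma cont_mul (f g : 'rV[R]_n -> R) : continuous (f : _ -> R^o) -> continuous (g : _ -> R^o) ->
  continuous (fun u => f u * g u : R^o).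
Proof. by move=> cf cg u; apply: (@continuousM R _ f g); [exact: cf|exact: cg]. Qed.

Lemma cont_cst (c : R) : continuous (fun _ : 'rV[R]_n => c : R^o).
Proof. exact: cst_continuous. Qed.

Lemma cont_coord i : continuous (fun u : 'rV[R]_n => u 0 i : R^o).
Proof. exact: coord_continuous. Qed.

Lemma sqnorm_shifted u : J (sqnorm (shifted u)) =
  J (sqnorm Q) + 2 * (\sum_i u 0 i * J (fun x => frob (Q x) (phi i x))) + q u.
Proof.
rewrite -(J_comb u pQ).
have g1 := good_sqnorm K_bound pQ; have g2 := good_pair pQ (pcomb u).
have g3 := good_sqnorm K_bound (pcomb u).
rewrite -(jZ 2 g2) -(jD g1 (goodZ 2 g2)) -(jD (goodD g1 (goodZ 2 g2)) g3).
apply: (J_eq Th) => x _; rewrite /sqnorm /shifted frobDl !frobDr (frobC (comb _ _ _)); ring.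
Qed.

(** The estimate of H used for uniqueness also shows that H is locally
    Lipschitz in its first argument; the bound is explicit in u and vanishes at
    the base point. *)
Lemma cont_H i : continuous (fun u => H p Omega (shifted u) Q (phi i) : R^o).
Proof.
move=> u1; pose u : 'rV[R]_n := u1.
pose E := Num.sqrt (kap * J (sqnorm (phi i))).
pose W (v : 'rV[R]_n) := 4 * (volume_bound + 64 * inverse_const sigma *
    (J (sqnorm (shifted v)) + J (sqnorm (shifted u)) + J (sqnorm Q))).
pose bound (v : 'rV[R]_n) := CL * h^-1 ^+ 2 * Num.sqrt (kap * q (v - u)) * E * W v.
have supE f x : pw_affine Th f -> cells Th x ->
    jnorm h (jet_of f x) <= Num.sqrt (kap * J (sqnorm f)).
  move=> pf cx; have n0 := jnorm_ge0 (jet_of f x) (ltW (meshsize_gt0 Th K_gt0 K_bound Omega_neq0)).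
  rewrite -(ger0_norm n0) -sqrtr_sqr; apply: ler_wsqrtr.
  exact: (jnorm_sup K_gt0 K_bound sigma_gt0 balls Omega_neq0 pf cx).
have lip (v : 'rV[R]_n) : `|H p Omega (shifted v) Q (phi i) - H p Omega (shifted u) Q (phi i)| <= bound v.
  have diffE : (fun x => -1 *: shifted u x + shifted v x) = comb phi (v - u).
    apply/funext => x; rewrite /shifted scalerDr addrACA scaleN1r addNr add0r.
    rewrite /comb scaleN1r addrC -sumrB; apply: eq_bigr => j _.
    by rewrite !mxE scalerBl.
  apply: le_trans (H_lipschitz K_gt0 K_bound Omega_neq0 CL_ge0 CL_lip (pshift v) (pshift u)
    pQ (pphi i) (D := Num.sqrt (kap * q (v - u))) (E := E) _ _ _ _) _.
  - exact: sqrtr_ge0.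
  - exact: sqrtr_ge0.
  - by move=> x cx; rewrite diffE; exact: supE.
  - by move=> x cx; exact: supE.
  apply: ler_wpM2l; last exact: (J_weight_le (pshift v) (pshift u) pQ).
  by do 3![apply: mulr_ge0 => //; try exact: sqrtr_ge0]; exact: sqr_ge0.
have cq : continuous (fun v : 'rV[R]_n => q (v - u) : R^o).
  rewrite (_ : (fun v : 'rV[R]_n => q (v - u)) =
    (fun v : 'rV[R]_n => \sum_i \sum_j (v 0 i - u 0 i) * ((v 0 j - u 0 j) * gram i j))).
    apply: continuous_sumR => a; apply: continuous_sumR => b.
    apply: cont_mul; first by apply: cont_add; [exact: cont_coord|exact: cont_cst].
    apply: cont_mul; last exact: cont_cst.
    by apply: cont_add; [exact: cont_coord|exact: cont_cst].
  apply/funext => v; rewrite qE; apply: eq_bigr => a _; apply: eq_bigr => b _.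
  by rewrite !mxE.
have csq : continuous (fun v : 'rV[R]_n => Num.sqrt (kap * q (v - u)) : R^o).
  move=> v; apply: (@continuous_comp _ _ _ (fun v : 'rV[R]_n => kap * q (v - u)) Num.sqrt).
    by apply: cont_mul; [exact: cont_cst|exact: cq].
  exact: sqrt_continuous.
have cW : continuous (W : _ -> R^o).
  apply: cont_mul; first exact: cont_cst.
  apply: cont_add; first exact: cont_cst.
  apply: cont_mul; first exact: cont_cst.
  apply: cont_add; last exact: cont_cst.
  apply: cont_add; last exact: cont_cst.
  rewrite (_ : (fun v => J (sqnorm (shifted v))) = (fun v => J (sqnorm Q) +
    2 * (\sum_i v 0 i * J (fun x => frob (Q x) (phi i x))) +
    \sum_i \sum_j v 0 i * (v 0 j * gram i j))); last first.
    by apply/funext => v; rewrite sqnorm_shifted qE.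
  apply: cont_add.
    apply: cont_add; first exact: cont_cst.
    apply: cont_mul; first exact: cont_cst.
    by apply: continuous_sumR => a; apply: cont_mul; [exact: cont_coord|exact: cont_cst].
  apply: continuous_sumR => a; apply: continuous_sumR => b.
  by apply: cont_mul; [exact: cont_coord|apply: cont_mul; [exact: cont_coord|exact: cont_cst]].
have cb : continuous (bound : _ -> R^o).
  apply: cont_mul; last exact: cW.
  apply: cont_mul; last exact: cont_cst.
  by apply: cont_mul; [exact: cont_cst|exact: csq].
have b0 : bound u = 0.
  rewrite /bound subrr qE big1 ?mulr0 ?sqrtr0 ?mulr0 ?mul0r // => a _.
  by rewrite big1 // => b _; rewrite mxE mul0r.
have key : forall e, 0 < e -> \forall v \near nbhs u1,
    `|H p Omega (shifted u1) Q (phi i) - H p Omega (shifted v) Q (phi i)| < e.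
  move=> e e0; have /cvgrPdist_lt/(_ _ e0) := cb u1; rewrite (b0 : bound u1 = 0).
  apply: filterS => v; rewrite sub0r normrN => hb.
  by rewrite distrC; apply: le_lt_trans (lip v) (le_lt_trans (ler_norm _) hb).
exact: (proj2 (@cvgrPdist_lt R R^o _ (nbhs u1) (nbhs_filter u1)
  (fun u => H p Omega (shifted u) Q (phi i)) _) key).
Qed.

Lemma cont_residual i : continuous (fun u => residual u 0 i).
Proof.
rewrite (_ : (fun u => residual u 0 i) = (fun u => dt^-1 * (\sum_j u 0 j * gram i j) +
    M p * H p Omega (shifted u) Q (phi i))); last first.
  apply/funext => u; rewrite mxE; congr (_ * _ + _).
  rewrite -(J_comb u (pphi i)); by apply: (J_eq Th) => x _; rewrite frobC.
apply: cont_add; last by apply: cont_mul; [exact: cont_cst|exact: cont_H].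
apply: cont_mul; first exact: cont_cst.
by apply: continuous_sumR => j; apply: cont_mul; [exact: cont_coord|exact: cont_cst].
Qed.

Lemma residual_zero : exists u, residual u = 0.
Proof.
have [rho rho0 out] := residual_outward.
exact: (zero_of_outward rho0 cont_residual out).
Qed.

End Existence.

Theorem step_exists dt Q : 0 < dt -> ThG Th G Q ->
  exists Q', ThG Th G Q' /\ scheme_step p Th dt Q Q'.
Proof.
move=> dt0 hQ; have pQ := ThG_pw hQ.
have [n [phi [tphi span [C1 C10 coord]]]] := Th0_basis Th.
have [u ru] := residual_zero dt0 hQ tphi C10 coord.
have hS := shifted_ThG hQ tphi u; have pS := ThG_pw hS.
exists (shifted Q phi u); split => // f tf; have pf := Th0_pw tf.
have [w fw] := span f tf; have pw := Th0_pw (Th0_comb w tphi).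
rewrite scheme_stepE // (H_eq K_gt0 K_bound p pS pS pQ pf pw (fun _ _ => erefl) fw).
have := residual_dot dt hQ tphi u w.
rewrite ru (_ : dotr 0 w = 0); last by rewrite /dotr big1 // => i _; rewrite mxE mul0r.
move=> /esym/eqP; rewrite addr_eq0 mulNr => /eqP <-; congr (_ * _).
apply: (J_eq Th) => x cx; rewrite (fw x (cells_sub_closure cx)).
by rewrite /shifted scaleN1r addKr.
Qed.

End Step.

(** * Existence and uniqueness *)

(** The bound K on the coordinates replaces the boundedness of Omega: it bounds
    the volume, the diameters of the elements and the values of affine
    functions. *)
Lemma bounded_closure_coord (R : realType) (A : set 'rV[R]_3) : bounded_set A ->
  exists2 K : R, 0 < K & forall x k, closure A x -> `|x 0 k| <= K.
Proof.
move=> [B [Breal hB]]; exists (`|B| + 1) => [|x k xA].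
  by rewrite ltr_wpDl.
apply: le_trans (coord_le_norm x k) _.
have cl : closed [set y : 'rV[R]_3 | `|y| <= `|B| + 1].
  apply: (@closed_comp _ _ (fun y : 'rV[R]_3 => `|y|) [set z | z <= `|B| + 1]).
    by move=> y _; exact: norm_continuous.
  exact: closed_le.
suff : closure [set y : 'rV[R]_3 | `|y| <= `|B| + 1] x by rewrite -(closure_id _).1.
apply: (closureS _ xA) => y Ay; apply: hB => //.
by rewrite (le_lt_trans (ler_norm B)) // ltrDl.
Qed.

Theorem theorem3p3 (R : realType) (p : params R)
  (L1_gt0 : 0 < L1 p) (L2_gt0 : 0 < L2 p) (L3_gt0 : 0 < L3 p)
  (L4_gt0 : 0 < L4 p) (L5_ge0 : 0 <= L5 p) (M_gt0 : 0 < M p)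
  (c_gt0 : 0 < c p) (a_lt : a p < b p ^+ 2 / (27 * c p))
  (Omega : set 'rV[R]_3) (Omega_domain : domain Omega)
  (Omega_bounded : bounded_set Omega)
  (I : Type) (mesh : I -> triangulation Omega) (mesh_qu : quasi_uniform mesh)
  (G : tensor_field R) (G_sym : forall x, boundary Omega x -> symtl (G x)) :
  (forall (i : I) (dt : R) (n : nat) (Q : nat -> tensor_field R),
     0 < dt -> scheme_iterates p (mesh i) G dt n Q ->
     exists Q', ThG (mesh i) G Q' /\ scheme_step p (mesh i) dt (Q n) Q')
  /\
  (forall E0 : R, exists2 C : R, 0 < C &
     forall (i : I) (dt : R) (n : nat) (Q : nat -> tensor_field R),
     0 < dt -> dt <= C * meshsize (mesh i) ^+ (3 + 2) ->
     scheme_iterates p (mesh i) G dt n Q -> energy p Omega (Q 0%N) <= E0 ->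
     forall Q' Q'',
       ThG (mesh i) G Q' -> scheme_step p (mesh i) dt (Q n) Q' ->
       ThG (mesh i) G Q'' -> scheme_step p (mesh i) dt (Q n) Q'' ->
       forall x, Omega x -> Q' x = Q'' x).
Proof.
have [_ _ Omega_neq0] := Omega_domain.
have [K K_gt0 K_bound] := bounded_closure_coord Omega_bounded.
have [C0 C0_bulk] := bulk_coercive c_gt0.
have K4_gt0 : 0 < 4 * K by rewrite mulr_gt0.
have [CL CL_ge0 CL_lip] := h_dens_lipschitz p K4_gt0.
have [sigma sigma_gt0 balls] := mesh_qu.
split => [i dt n Q dt_gt0 itQ|E0].
  exact: (step_exists K_gt0 K_bound L1_gt0 L2_gt0 L3_gt0 L4_gt0 L5_ge0 M_gt0 C0_bulk
    sigma_gt0 (balls i) Omega_neq0 CL_ge0 CL_lip dt_gt0 (iterates_ThG itQ)).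
exists (uniqueness_const K p C0 sigma CL E0).
  exact: uniqueness_const_gt0.
move=> i dt n Q dt_gt0 dt_le itQ QE0 Q1 Q2 hQ1 st1 hQ2 st2 x xO.
have En := le_trans (iterates_energy K_gt0 K_bound M_gt0 dt_gt0 itQ) QE0.
exact: (step_unique K_gt0 K_bound L1_gt0 L2_gt0 L3_gt0 L4_gt0 L5_ge0 M_gt0 C0_bulk
  sigma_gt0 (balls i) Omega_neq0 CL_ge0 CL_lip dt_gt0 dt_le En (iterates_ThG itQ)
  hQ1 st1 hQ2 st2 (subset_closure xO)).
Qed.
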